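(* Let $k$ be a field, let $\Gamma$ be a ring and let $\iota_1,\iota_2:k[[X]]\to Z(\Gamma)$ be two embeddings which both turn $\Gamma$ into a $k[[X]]$-order. Then the functor $-\otimes_\Gamma\Gamma/\iota_i(X)\Gamma$ for $i\in\{1,2\}$ induces a bijection between the isomorphism classes of pre-silting complexes over $\Gamma$ and those over $\Gamma/\iota_i(X)\Gamma$, and in particular induces isomorphisms of partially ordered sets $$\mathrm{silt}\text{-}\Gamma/\iota_1(X)\Gamma\;\stackrel{\sim}{\longleftrightarrow}\;\mathrm{t\text{-}silt}\text{-}\Gamma\;\stackrel{\sim}{\longleftrightarrow}\;\mathrm{silt}\text{-}\Gamma/\iota_2(X)\Gamma.$$ (That the relation $\geq$ on $\mathrm{t\text{-}silt}\text{-}\Gamma$ is a partial order is part of the assertion.)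
   Context: A $k[[X]]$-order is a $k[[X]]$-algebra that is free and finitely generated as a $k[[X]]$-module. Modules are right modules. For a ring $A$, a complex $T\in K^b(\mathrm{proj}\text{-}A)$ (bounded complexes of finitely generated projectives up to homotopy) is pre-silting if $\mathrm{Hom}_{D^b(A)}(T,T[i])=0$ for all $i>0$, and silting if moreover the smallest thick subcategory containing $T$ is $K^b(\mathrm{proj}\text{-}A)$. $\mathrm{silt}\text{-}A$ is the set of isomorphism classes of basic silting complexes (basic: no two isomorphic indecomposable summands in a decomposition). A pre-silting complex $T$ over a ring $\Gamma$ is torsion-silting if every $S$ in the unbounded derived category $D(\Gamma)$ with $\mathrm{Hom}_{D(\Gamma)}(T[i],S)=0$ for all $i\in\mathbb Z$ satisfies $H^i(S)=H^i(S)\cdot\mathrm{rad}(\Gamma)$ for all $i$; $\mathrm{t\text{-}silt}\text{-}\Gamma$ is the set of isomorphism classes of basic torsion-silting complexes. Both $\mathrm{silt}\text{-}A$ and $\mathrm{t\text{-}silt}\text{-}\Gamma$ carry the relation $S\geq T$ iff $\mathrm{Hom}(S,T[i])=0$ for all $i>0$, which is known to be a partial order on $\mathrm{silt}\text{-}A$. *)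

(* Defs.v *)
From HB Require Import structures.
From mathcomp Require Import all_boot all_order all_algebra.
From mathcomp Require Import generic_quotient.
From mathcomp Require Import boolp classical_sets.

Set Implicit Arguments.
Unset Strict Implicit.
Unset Printing Implicit Defensive.

Import GRing.Theory.
Local Open Scope ring_scope.
Local Open Scope quotient_scope.
Local Open Scope classical_set_scope.

Record fps (k : Type) := Fps { fps_coef : nat -> k }.

HB.instance Definition _ (k : Type) := [isNew for @fps_coef k].
HB.instance Definition _ (k : Type) := gen_eqMixin (fps k).
HB.instance Definition _ (k : Type) := gen_choiceMixin (fps k).

Section FpsRing.
Variable k : comNzRingType.
Implicit Types f g h : fps k.

Lemma fpsP f g : (forall n, fps_coef f n = fps_coef g n) -> f = g.
Proof. by case: f g => [f] [g] /= fg; congr Fps; apply/funext. Qed.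

Definition fps_add f g := Fps (fun n => fps_coef f n + fps_coef g n).
Definition fps_opp f := Fps (fun n => - fps_coef f n).
Definition fps_const (a : k) := Fps (fun n => if n == 0 then a else 0).
Definition fps_mul f g :=
  Fps (fun n => \sum_(i < n.+1) fps_coef f i * fps_coef g (n - i)%N).
Definition fps_X : fps k := Fps (fun n => (n == 1)%:R).

Fact fps_addA : associative fps_add.
Proof. by move=> f g h; apply/fpsP => n /=; rewrite addrA. Qed.
Fact fps_addC : commutative fps_add.
Proof. by move=> f g; apply/fpsP => n /=; rewrite addrC. Qed.
Fact fps_add0 : left_id (fps_const 0) fps_add.
Proof. by move=> f; apply/fpsP => n /=; rewrite if_same add0r. Qed.
Fact fps_addN : left_inverse (fps_const 0) fps_opp fps_add.
Proof. by move=> f; apply/fpsP => n /=; rewrite if_same addNr. Qed.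

HB.instance Definition _ := GRing.isZmodule.Build (fps k)
  fps_addA fps_addC fps_add0 fps_addN.

Definition fps_trunc n f : {poly k} := \poly_(i < n.+1) fps_coef f i.

Fact coef_fps_trunc n f i : (i <= n)%N -> (fps_trunc n f)`_i = fps_coef f i.
Proof. by move=> le_in; rewrite coef_poly ltnS le_in. Qed.

Fact fps_coef_mul n m f g : (m <= n)%N ->
  fps_coef (fps_mul f g) m = (fps_trunc n f * fps_trunc n g)`_m.
Proof.
move=> le_mn; rewrite coefM /=; apply: eq_bigr => i _.
rewrite !coef_fps_trunc //; last by rewrite (leq_trans _ le_mn) // -ltnS.
exact: leq_trans (leq_subr _ _) le_mn.
Qed.

Fact fps_trunc_mul n f g i : (i <= n)%N ->
  (fps_trunc n (fps_mul f g))`_i = (fps_trunc n f * fps_trunc n g)`_i.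
Proof. by move=> le_in; rewrite coef_fps_trunc // (fps_coef_mul _ _ le_in). Qed.

Fact fps_mulA : associative fps_mul.
Proof.
move=> f g h; apply/fpsP => n; rewrite !(fps_coef_mul _ _ (leqnn n)).
transitivity ((fps_trunc n f * fps_trunc n g * fps_trunc n h)`_n).
  rewrite -mulrA !coefM; apply: eq_bigr => i _.
  by rewrite fps_trunc_mul // leq_subr.
by rewrite !coefM; apply: eq_bigr => i _; rewrite fps_trunc_mul // -ltnS.
Qed.

Fact fps_mulC : commutative fps_mul.
Proof.
by move=> f g; apply/fpsP => n; rewrite !(fps_coef_mul _ _ (leqnn n)) mulrC.
Qed.

Fact fps_mul1 : left_id (fps_const 1) fps_mul.
Proof.
move=> f; apply/fpsP => n /=; rewrite big_ord_recl /= mul1r subn0 big1 ?addr0 //.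
by move=> i _; rewrite mul0r.
Qed.

Fact fps_mulDl : left_distributive fps_mul fps_add.
Proof.
move=> f g h; apply/fpsP => n /=; rewrite -big_split /=.
by apply: eq_bigr => i _; rewrite mulrDl.
Qed.

Fact fps_1neq0 : fps_const 1 != 0.
Proof.
apply/eqP => /(congr1 (fun f => fps_coef f 0)) /= /eqP.
by rewrite (negPf (oner_neq0 k)).
Qed.

HB.instance Definition _ := GRing.Zmodule_isComNzRing.Build (fps k)
  fps_mulA fps_mulC fps_mul1 fps_mulDl fps_1neq0.

End FpsRing.

Notation "k [[X]]" := (fps k) (at level 2, format "k [[X]]") : type_scope.

Record ideal (R : pzRingType) := Ideal {
  ideal_set : set R;
  ideal0 : ideal_set 0;
  idealB : forall x y, ideal_set x -> ideal_set y -> ideal_set (x - y);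
  idealMl : forall a x, ideal_set x -> ideal_set (a * x);
  idealMr : forall x a, ideal_set x -> ideal_set (x * a) }.

Section RingQuotient.
Variables (R : pzRingType) (I : ideal R).

Definition rquot_rel : rel R := fun x y => `[< ideal_set I (x - y) >].

Fact rquot_rel_refl : reflexive rquot_rel.
Proof. by move=> x; apply/asboolP; rewrite subrr; exact: ideal0. Qed.
Fact rquot_rel_sym : symmetric rquot_rel.
Proof.
suff H x y : rquot_rel x y -> rquot_rel y x by move=> x y; apply/idP/idP; exact: H.
move=> /asboolP Ixy; apply/asboolP; rewrite -opprB -sub0r.
by apply: idealB => //; exact: ideal0.
Qed.
Fact rquot_rel_trans : transitive rquot_rel.
Proof.
move=> y x z /asboolP Ixy; rewrite rquot_rel_sym => /asboolP Izy; apply/asboolP.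
by have := idealB Ixy Izy; rewrite opprB addrA subrK.
Qed.
Canonical rquot_equiv :=
  EquivRel rquot_rel rquot_rel_refl rquot_rel_sym rquot_rel_trans.

Definition rquot := {eq_quot rquot_rel}.

HB.instance Definition _ := Choice.on rquot.

Definition rpi (x : R) : rquot := \pi_rquot x.

Fact rpi_eq x y : rpi x = rpi y <-> ideal_set I (x - y).
Proof.
split=> [/eqP|Ixy]; first by rewrite /rpi piE => /asboolP.
by apply/eqP; rewrite /rpi piE; apply/asboolP.
Qed.
Fact rpi_repr (u : rquot) : rpi (repr u) = u.
Proof. by rewrite /rpi reprK. Qed.

Definition rquot_add (u v : rquot) := rpi (repr u + repr v).
Definition rquot_opp (u : rquot) := rpi (- repr u).
Definition rquot_mul (u v : rquot) := rpi (repr u * repr v).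

Fact repr_rpi x : ideal_set I (repr (rpi x) - x).
Proof. by apply/rpi_eq; rewrite rpi_repr. Qed.
Fact rpi_add x y : rquot_add (rpi x) (rpi y) = rpi (x + y).
Proof.
apply/rpi_eq; rewrite opprD addrACA -[X in _ + X]opprK.
apply: idealB (repr_rpi x) _; rewrite -sub0r.
by apply: idealB (repr_rpi y); exact: ideal0.
Qed.
Fact rpi_opp x : rquot_opp (rpi x) = rpi (- x).
Proof.
apply/rpi_eq; rewrite -opprD -sub0r.
by apply: idealB (repr_rpi x); exact: ideal0.
Qed.
Fact rpi_mul x y : rquot_mul (rpi x) (rpi y) = rpi (x * y).
Proof.
apply/rpi_eq; set x' := repr _; set y' := repr _.
have -> : x' * y' - x * y = (x' - x) * y' - x * (y - y').
  by rewrite mulrBl mulrBr opprB addrA subrK.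
apply: idealB; first by apply: idealMr; exact: repr_rpi.
apply: idealMl; rewrite -opprB -sub0r.
by apply: idealB (repr_rpi y); exact: ideal0.
Qed.

Fact rquot_addA : associative rquot_add.
Proof. by move=> u v w; rewrite -[u]rpi_repr -[v]rpi_repr -[w]rpi_repr !(rpi_add, rpi_opp, rpi_mul) addrA. Qed.
Fact rquot_addC : commutative rquot_add.
Proof. by move=> u v; rewrite -[u]rpi_repr -[v]rpi_repr !(rpi_add, rpi_opp, rpi_mul) addrC. Qed.
Fact rquot_add0 : left_id (rpi 0) rquot_add.
Proof. by move=> u; rewrite -[u]rpi_repr !(rpi_add, rpi_opp, rpi_mul) add0r. Qed.
Fact rquot_addN : left_inverse (rpi 0) rquot_opp rquot_add.
Proof. by move=> u; rewrite -[u]rpi_repr !(rpi_add, rpi_opp, rpi_mul) addNr. Qed.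

HB.instance Definition _ := GRing.isZmodule.Build rquot
  rquot_addA rquot_addC rquot_add0 rquot_addN.

Fact rquot_mulA : associative rquot_mul.
Proof. by move=> u v w; rewrite -[u]rpi_repr -[v]rpi_repr -[w]rpi_repr !(rpi_add, rpi_opp, rpi_mul) mulrA. Qed.
Fact rquot_mul1r : left_id (rpi 1) rquot_mul.
Proof. by move=> u; rewrite -[u]rpi_repr !(rpi_add, rpi_opp, rpi_mul) mul1r. Qed.
Fact rquot_mulr1 : right_id (rpi 1) rquot_mul.
Proof. by move=> u; rewrite -[u]rpi_repr !(rpi_add, rpi_opp, rpi_mul) mulr1. Qed.
Fact rquot_mulDl : left_distributive rquot_mul rquot_add.
Proof. by move=> u v w; rewrite -[u]rpi_repr -[v]rpi_repr -[w]rpi_repr !(rpi_add, rpi_opp, rpi_mul) mulrDl. Qed.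
Fact rquot_mulDr : right_distributive rquot_mul rquot_add.
Proof. by move=> u v w; rewrite -[u]rpi_repr -[v]rpi_repr -[w]rpi_repr !(rpi_add, rpi_opp, rpi_mul) mulrDr. Qed.

HB.instance Definition _ := GRing.Zmodule_isPzRing.Build rquot
  rquot_mulA rquot_mul1r rquot_mulr1 rquot_mulDl rquot_mulDr.

Fact rpi_is_additive : zmod_morphism rpi.
Proof.
move=> x y; rewrite -[rpi x - rpi y]/(rquot_add (rpi x) (rquot_opp (rpi y))).
by rewrite rpi_opp rpi_add.
Qed.
Fact rpi_is_multiplicative : monoid_morphism rpi.
Proof. by split=> // x y; symmetry; exact: rpi_mul. Qed.
HB.instance Definition _ := GRing.isZmodMorphism.Build R rquot rpi rpi_is_additive.
HB.instance Definition _ :=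
  GRing.isMonoidMorphism.Build R rquot rpi rpi_is_multiplicative.

End RingQuotient.

Section Radical.
Variable R : pzRingType.

Definition right_ideal (J : set R) :=
  [/\ J 0, forall x y, J x -> J y -> J (x + y) & forall x a, J x -> J (x * a)].

Definition max_right_ideal (J : set R) :=
  [/\ right_ideal J, ~ J 1 &
      forall J', right_ideal J' -> ~ J' 1 -> J `<=` J' -> J' = J].

Definition jacobson_radical : set R :=
  [set x | forall J, max_right_ideal J -> J x].

End Radical.

(** A right [A]-module is a left module over the converse ring [A^c]: the
element written [(a : A^c) *: m] is the right multiple [m a]. *)

Notation rmodType A := (lmodType A^c).

Definition fin_generated (A : pzRingType) (M : rmodType A) :=
  exists n (e : 'I_n -> M), forall x, exists a : 'I_n -> A,
    x = \sum_(i < n) (a i : A^c) *: e i.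

Definition projective (A : pzRingType) (P : rmodType A) :=
  forall (M N : rmodType A) (p : {linear M -> N}) (f : {linear P -> N}),
    (forall y, exists x, p x = y) ->
    exists g : {linear P -> M}, forall x, p (g x) = f x.

(** Extension of scalars: the tensor product of a right [R]-module [M] with
[S], where [S] is a left [R]-module through [phi : R -> S].

The list [[:: (m1, s1); ...; (mn, sn)]] stands for the sum of the elementary
tensors [mi (x) si]. As [- (m (x) s) = (- m) (x) s], such sums exhaust the
tensor product, and [tens_eq] is the congruence for concatenation generated by
commutativity, biadditivity and balancedness. *)

Section Tensor.
Variables (R S : pzRingType) (phi : {rmorphism R -> S}) (M : rmodType R).
Implicit Types s t : seq (M * S).

Inductive tens_eq : seq (M * S) -> seq (M * S) -> Prop :=
| tens_refl s : tens_eq s s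
| tens_sym s t : tens_eq s t -> tens_eq t s
| tens_trans t s u : tens_eq s t -> tens_eq t u -> tens_eq s u
| tens_cat s s' t t' : tens_eq s s' -> tens_eq t t' -> tens_eq (s ++ t) (s' ++ t')
| tens_comm s t : tens_eq (s ++ t) (t ++ s)
| tens_0 a : tens_eq [:: (0, a)] [::]
| tens_Dl m m' a : tens_eq [:: (m + m', a)] [:: (m, a); (m', a)]
| tens_Dr m a a' : tens_eq [:: (m, a + a')] [:: (m, a); (m, a')]
| tens_bal m (r : R) a : tens_eq [:: ((r : R^c) *: m, a)] [:: (m, phi r * a)].

Definition tens_rel : rel (seq (M * S)) := fun s t => `[< tens_eq s t >].

Fact tens_rel_refl : reflexive tens_rel.
Proof. by move=> s; apply/asboolP; exact: tens_refl. Qed.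
Fact tens_rel_sym : symmetric tens_rel.
Proof. by move=> s t; apply/asboolP/asboolP; exact: tens_sym. Qed.
Fact tens_rel_trans : transitive tens_rel.
Proof. by move=> t s u /asboolP st /asboolP tu; apply/asboolP; exact: tens_trans tu. Qed.
Canonical tens_equiv := EquivRel tens_rel tens_rel_refl tens_rel_sym tens_rel_trans.

Definition tens := {eq_quot tens_rel}.

HB.instance Definition _ := Choice.on tens.

Definition tpi s : tens := \pi_tens s.

Fact tpi_eq s t : tpi s = tpi t <-> tens_eq s t.
Proof.
split=> [/eqP|st]; first by rewrite /tpi piE => /asboolP.
by apply/eqP; rewrite /tpi piE; apply/asboolP.
Qed.
Fact tpi_repr (u : tens) : tpi (repr u) = u.
Proof. by rewrite /tpi reprK. Qed.
Fact repr_tpi s : tens_eq (repr (tpi s)) s.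
Proof. by apply/tpi_eq; rewrite tpi_repr. Qed.

Definition seq_opp s := [seq (- p.1, p.2) | p <- s].
Definition seq_scale (a : S) s := [seq (p.1, p.2 * a) | p <- s].

Fact seq_opp_eq s t : tens_eq s t -> tens_eq (seq_opp s) (seq_opp t).
Proof.
elim=> {s t} [s|s t _ IH|t s u _ IH1 _ IH2|s s' t t' _ IH1 _ IH2|s t|a|m m' a|m a a'|m r a].
- exact: tens_refl.
- exact: tens_sym.
- exact: tens_trans IH1 IH2.
- by rewrite /seq_opp !map_cat; exact: tens_cat.
- by rewrite /seq_opp !map_cat; exact: tens_comm.
- by rewrite /= oppr0; exact: tens_0.
- by rewrite /= opprD; exact: tens_Dl.
- exact: tens_Dr.
- by rewrite /= -scalerN; exact: tens_bal.
Qed.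

Fact seq_scale_eq a s t : tens_eq s t -> tens_eq (seq_scale a s) (seq_scale a t).
Proof.
elim=> {s t} [s|s t _ IH|t s u _ IH1 _ IH2|s s' t t' _ IH1 _ IH2|s t|b|m m' b|m b b'|m r b].
- exact: tens_refl.
- exact: tens_sym.
- exact: tens_trans IH1 IH2.
- by rewrite /seq_scale !map_cat; exact: tens_cat.
- by rewrite /seq_scale !map_cat; exact: tens_comm.
- exact: tens_0.
- exact: tens_Dl.
- by rewrite /= mulrDl; exact: tens_Dr.
- by rewrite /= -mulrA; exact: tens_bal.
Qed.

Definition tens_add (u v : tens) := tpi (repr u ++ repr v).
Definition tens_opp (u : tens) := tpi (seq_opp (repr u)).
Definition tens_scale (a : S^c) (u : tens) := tpi (seq_scale a (repr u)).

Fact tpi_add s t : tens_add (tpi s) (tpi t) = tpi (s ++ t).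
Proof. by apply/tpi_eq; apply: tens_cat; exact: repr_tpi. Qed.
Fact tpi_opp s : tens_opp (tpi s) = tpi (seq_opp s).
Proof. by apply/tpi_eq; apply: seq_opp_eq; exact: repr_tpi. Qed.
Fact tpi_scale a s : tens_scale a (tpi s) = tpi (seq_scale a s).
Proof. by apply/tpi_eq; apply: seq_scale_eq; exact: repr_tpi. Qed.

Fact tens_addA : associative tens_add.
Proof.
move=> u v w; rewrite -[u]tpi_repr -[v]tpi_repr -[w]tpi_repr.
by rewrite !tpi_add catA.
Qed.
Fact tens_addC : commutative tens_add.
Proof.
move=> u v; rewrite -[u]tpi_repr -[v]tpi_repr !tpi_add.
by apply/tpi_eq; exact: tens_comm.
Qed.
Fact tens_add0 : left_id (tpi [::]) tens_add.
Proof. by move=> u; rewrite -[u]tpi_repr tpi_add. Qed.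
Fact tens_addN : left_inverse (tpi [::]) tens_opp tens_add.
Proof.
move=> u; rewrite -[u]tpi_repr tpi_opp tpi_add; apply/tpi_eq.
elim: (repr u) => [|[m a] s IH] /=; first exact: tens_refl.
rewrite -cat1s -[(m, a) :: s]cat1s.
have H : tens_eq (seq_opp s ++ [:: (m, a)] ++ s) ([:: (m, a)] ++ seq_opp s ++ s).
  rewrite !catA; apply: tens_cat; last exact: tens_refl.
  exact: tens_comm.
apply: tens_trans (tens_cat (tens_refl _) H) _.
rewrite catA -[[::]]cats0; apply: tens_cat IH.
apply: tens_trans (tens_sym (tens_Dl _ _ _)) _.
by rewrite addNr; exact: tens_0.
Qed.

HB.instance Definition _ := GRing.isZmodule.Build tens
  tens_addA tens_addC tens_add0 tens_addN.

Fact tens_scaleA (a b : S^c) u : tens_scale a (tens_scale b u) = tens_scale (a * b) u.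
Proof.
rewrite -[u]tpi_repr !tpi_scale /seq_scale -map_comp; congr tpi.
by apply: eq_map => p /=; rewrite -mulrA.
Qed.
Fact tens_scale1 : left_id (1 : S^c) tens_scale.
Proof.
move=> u; rewrite -[u]tpi_repr tpi_scale /seq_scale -[in RHS](map_id (repr u)).
by congr tpi; apply: eq_map => -[m a] /=; rewrite mulr1.
Qed.
Fact tens_scaleDr : right_distributive tens_scale +%R.
Proof.
move=> a u v; rewrite -[u]tpi_repr -[v]tpi_repr.
rewrite -[tpi _ + tpi _]/(tens_add _ _) -[RHS]/(tens_add _ _).
by rewrite tpi_add !tpi_scale tpi_add /seq_scale map_cat.
Qed.
Fact tens_scaleDl v : {morph tens_scale^~ v : a b / a + b}.
Proof.
move=> a b; rewrite -[v]tpi_repr -[RHS]/(tens_add _ _) !tpi_scale tpi_add.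
apply/tpi_eq; elim: (repr v) => [|[m c] s IH] /=; first exact: tens_refl.
rewrite -cat1s -[(m, c * a) :: _]cat1s -[(m, c * b) :: _]cat1s.
apply: tens_trans (tens_cat (tens_refl _) IH) _.
set x := [:: (m, c * a)]; set y := [:: (m, c * b)].
set sa := seq_scale a s; set sb := seq_scale b s.
apply: (@tens_trans ((x ++ y) ++ sa ++ sb)).
  by apply: tens_cat (tens_refl _); rewrite mulrDr; exact: tens_Dr.
have -> : (x ++ y) ++ sa ++ sb = x ++ (y ++ sa) ++ sb by rewrite !catA.
have -> : x ++ sa ++ y ++ sb = x ++ (sa ++ y) ++ sb by rewrite !catA.
apply: tens_cat; first exact: tens_refl.
by apply: tens_cat (tens_refl _); exact: tens_comm.
Qed.

HB.instance Definition _ := GRing.Zmodule_isLmodule.Build S^c tens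
  tens_scaleA tens_scale1 tens_scaleDr tens_scaleDl.

End Tensor.

Section TensorMap.
Variables (R S : pzRingType) (phi : {rmorphism R -> S}) (M N : rmodType R).
Variable f : {linear M -> N}.

Definition seq_map (s : seq (M * S)) : seq (N * S) := [seq (f p.1, p.2) | p <- s].

Fact seq_map_eq s t : tens_eq phi s t -> tens_eq phi (seq_map s) (seq_map t).
Proof.
elim=> {s t} [s|s t _ IH|t s u _ IH1 _ IH2|s s' t t' _ IH1 _ IH2|s t|b|m m' b|m b b'|m r b].
- exact: tens_refl.
- exact: tens_sym.
- exact: tens_trans IH1 IH2.
- by rewrite /seq_map !map_cat; exact: tens_cat.
- by rewrite /seq_map !map_cat; exact: tens_comm.
- by rewrite /= linear0; exact: tens_0.
- by rewrite /= linearD; exact: tens_Dl.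
- exact: tens_Dr.
- by rewrite /= linearZ; exact: tens_bal.
Qed.

Definition tens_map (u : tens phi M) : tens phi N := tpi phi (seq_map (repr u)).

Fact tens_mapE s : tens_map (tpi phi s) = tpi phi (seq_map s).
Proof. by apply/tpi_eq; apply: seq_map_eq; exact: repr_tpi. Qed.

Fact tens_map_is_linear : linear tens_map.
Proof.
move=> a u v; rewrite -[u]tpi_repr -[v]tpi_repr.
rewrite -[_ *: _ + _]/(tens_add (tens_scale _ _) _).
rewrite -[RHS]/(tens_add (tens_scale _ _) _).
rewrite tpi_scale tpi_add !tens_mapE tpi_scale tpi_add; congr tpi.
by rewrite /seq_map /seq_scale map_cat -!map_comp.
Qed.
HB.instance Definition _ :=
  GRing.isLinear.Build S^c (tens phi M) (tens phi N) _ tens_map tens_map_is_linear.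

End TensorMap.

Arguments tens_map {R S} phi {M N} f u.

(** Cohomological grading. The differentials form a family indexed by all pairs [(i, j)], vanishing unless
[j = i + 1]; this avoids transport along equalities of degrees. *)

Record complex (A : pzRingType) := Complex {
  cterm :> int -> rmodType A;
  cdiff : forall i j, {linear cterm i -> cterm j};
  cdiff_shape : forall i j, j <> i + 1 -> forall x, cdiff i j x = 0;
  cdiffK : forall i j l x, cdiff j l (cdiff i j x) = 0 }.

Arguments cdiff {A} c i j : rename.

Record cmap (A : pzRingType) (X Y : complex A) := CMap {
  cfun :> forall i, {linear X i -> Y i};
  cfunC : forall i j x, cfun j (cdiff X i j x) = cdiff Y i j (cfun i x) }.

Section Complexes.
Variable A : pzRingType.
Implicit Types X Y Z T S : complex A.

Fact cmap_id_comm X i j x : idfun (cdiff X i j x) = cdiff X i j (idfun x).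
Proof. by []. Qed.
Definition cmap_id X : cmap X X := @CMap A X X (fun i => idfun) (@cmap_id_comm X).

Fact cmap0_comm X Y i j x :
  (\0 : {linear X j -> Y j}) (cdiff X i j x)
  = cdiff Y i j ((\0 : {linear X i -> Y i}) x).
Proof. by rewrite /= linear0. Qed.
Definition cmap0 X Y : cmap X Y := @CMap A X Y (fun i => \0) (@cmap0_comm X Y).

Fact cmap_comp_comm X Y Z (g : cmap Y Z) (f : cmap X Y) i j x :
  (g j \o f j) (cdiff X i j x) = cdiff Z i j ((g i \o f i) x).
Proof. by rewrite /= !cfunC. Qed.
Definition cmap_comp X Y Z (g : cmap Y Z) (f : cmap X Y) : cmap X Z :=
  @CMap A X Z (fun i => g i \o f i) (@cmap_comp_comm X Y Z g f).

Definition homotopic X Y (f g : cmap X Y) :=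
  exists h : forall i j, {linear X i -> Y j}, forall i x,
    f i x - g i x
    = cdiff Y (i - 1) i (h i (i - 1) x) + h (i + 1) i (cdiff X i (i + 1) x).

(** Isomorphism in the homotopy category. *)
Definition hiso X Y := exists (f : cmap X Y) (g : cmap Y X),
  homotopic (cmap_comp g f) (cmap_id X) /\ homotopic (cmap_comp f g) (cmap_id Y).

Definition hzero X := homotopic (cmap_id X) (cmap0 X X).

Definition cocycle X i : set (X i) := [set x | cdiff X i (i + 1) x = 0].
Definition coboundary X i : set (X i) := [set x | exists y, x = cdiff X (i - 1) i y].

(** [x] and [y] have the same class in the cohomology module of degree [i]. *)
Definition cohomologous X i (x y : X i) := coboundary (x - y).

(** The map induced on cohomology is injective and surjective. *)
Definition quasi_iso X Y (f : cmap X Y) := forall i,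
  (forall x x' : X i, cocycle x -> cocycle x' ->
     cohomologous (f i x) (f i x') -> cohomologous x x') /\
  (forall y : Y i, cocycle y -> exists2 x : X i, cocycle x & cohomologous (f i x) y).

(** Shift: [X[n]^i = X^(i+n)] with differential [(-1)^n d]. *)
Section Shift.
Variables (X : complex A) (n : int).
Definition shift_diff_fun (i j : int) (x : X (i + n)) : X (j + n) :=
  cdiff X (i + n) (j + n) x *~ ((-1) ^ n).
Fact shift_diff_linear i j : linear (@shift_diff_fun i j).
Proof. by move=> a x y; rewrite /shift_diff_fun linearP mulrzDl scalerMzr. Qed.
HB.instance Definition _ i j := GRing.isLinear.Build A^c _ _ _
  (@shift_diff_fun i j) (@shift_diff_linear i j).
Fact shift_shape i j : j <> i + 1 -> forall x, @shift_diff_fun i j x = 0.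
Proof.
move=> ij x; rewrite /shift_diff_fun cdiff_shape ?mul0rz // => e.
by apply: ij; apply: (addIr n); rewrite e addrAC.
Qed.
Fact shift_diffK i j l x : @shift_diff_fun j l (@shift_diff_fun i j x) = 0.
Proof. by rewrite /shift_diff_fun raddfMz /= cdiffK !mul0rz. Qed.
Definition shift : complex A :=
  @Complex A (fun i => X (i + n)) (fun i j => @shift_diff_fun i j)
    shift_shape shift_diffK.
End Shift.

Section Sum.
Variables X Y : complex A.
Definition csum_diff_fun (i j : int) (p : X i * Y i) : X j * Y j :=
  (cdiff X i j p.1, cdiff Y i j p.2).
Fact csum_diff_linear i j : linear (@csum_diff_fun i j).
Proof. by move=> a p q; rewrite /csum_diff_fun !linearP. Qed.
HB.instance Definition _ i j := GRing.isLinear.Build A^c _ _ _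
  (@csum_diff_fun i j) (@csum_diff_linear i j).
Fact csum_shape i j : j <> i + 1 -> forall p, @csum_diff_fun i j p = 0.
Proof. by move=> ij p; rewrite /csum_diff_fun !cdiff_shape. Qed.
Fact csum_diffK i j l p : @csum_diff_fun j l (@csum_diff_fun i j p) = 0.
Proof. by rewrite /csum_diff_fun /= !cdiffK. Qed.
Definition csum : complex A :=
  @Complex A (fun i => (X i * Y i)%type) (fun i j => @csum_diff_fun i j)
    csum_shape csum_diffK.
End Sum.

(** Mapping cone: [X^(i+1) (+) Y^i] with differential [(x, y) |-> (- d x, f x + d y)];
[ccast] identifies [Y^(i+1)] with [Y^j] when [j = i + 1]. *)
Section Cone.
Variables (X Y : complex A) (f : cmap X Y).
Definition ccast i j (e : i = j) (y : Y i) : Y j :=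
  match e in _ = j' return Y j' with erefl => y end.
Definition cone_diff_fun (i j : int) (p : X (i + 1) * Y i) : X (j + 1) * Y j :=
  if i + 1 =P j is ReflectT e then
    (- cdiff X (i + 1) (j + 1) p.1, ccast e (f (i + 1) p.1) + cdiff Y i j p.2)
  else 0.
Fact cone_diff_linear i j : linear (@cone_diff_fun i j).
Proof.
move=> a p q; rewrite /cone_diff_fun; case: eqP => [e|_]; last by rewrite scaler0 addr0.
subst j; rewrite /= !linearP; congr pair => /=.
by rewrite scalerDr addrACA.
Qed.
HB.instance Definition _ i j := GRing.isLinear.Build A^c _ _ _
  (@cone_diff_fun i j) (@cone_diff_linear i j).
Fact cone_shape i j : j <> i + 1 -> forall p, @cone_diff_fun i j p = 0.
Proof. by move=> ij p; rewrite /cone_diff_fun; case: eqP => // e; case: ij. Qed.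
Fact cone_diffK i j l p : @cone_diff_fun j l (@cone_diff_fun i j p) = 0.
Proof.
rewrite {2}/cone_diff_fun; case: eqP => [e|_]; last exact: linear0.
rewrite /cone_diff_fun; case: eqP => // e'; subst j; subst l => /=.
rewrite !linearN /= !linearD /= cfunC !cdiffK oppr0 addr0 oppr0.
by rewrite addNr.
Qed.
Definition cone : complex A :=
  @Complex A (fun i => (X (i + 1)%R * Y i)%type) (fun i j => @cone_diff_fun i j)
    cone_shape cone_diffK.
End Cone.

(** Morphisms [X -> Y] in the derived category are fractions [X <-s- Z -f-> Y] with [s] a quasi-isomorphism, two
fractions being equal when they have a common expansion in the homotopy
category. *)

Record roof X Y := Roof {
  apex : complex A;
  rden : cmap apex X;
  rnum : cmap apex Y;
  rden_qi : quasi_iso rden }.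

Definition roof_eq X Y (r r' : roof X Y) :=
  exists (W : complex A) (u : cmap W (apex r)) (v : cmap W (apex r')),
    [/\ quasi_iso (cmap_comp (rden r) u),
        homotopic (cmap_comp (rden r) u) (cmap_comp (rden r') v) &
        homotopic (cmap_comp (rnum r) u) (cmap_comp (rnum r') v)].

Fact cmap_id_qi X : quasi_iso (cmap_id X).
Proof.
move=> i; split=> // x Zx; exists x => //=.
by exists 0; rewrite linear0 subrr.
Qed.
Definition roof0 X Y : roof X Y := Roof (cmap0 X Y) (@cmap_id_qi X).

Definition dhom_zero X Y := forall r : roof X Y, roof_eq r (roof0 X Y).

Definition bounded X :=
  exists N : nat, forall i, (N < `|i|)%N -> forall x : X i, x = 0.

(** The objects of [K^b(proj-A)]. *)
Definition perfect X :=
  bounded X /\ forall i, fin_generated (X i) /\ projective (X i).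

Definition thick (P : complex A -> Prop) :=
  [/\ forall X, P X -> perfect X,
      forall X Y, P X -> perfect Y -> hiso X Y -> P Y,
      forall X (n : int), P X -> P (shift X n),
      forall X Y (f : cmap X Y), P X -> P Y -> P (cone f) &
      forall X Y, perfect X -> perfect Y -> P (csum X Y) -> P X].

Definition presilting T :=
  perfect T /\ forall i : int, 0 < i -> dhom_zero T (shift T i).

Definition silting T :=
  presilting T /\ forall P, thick P -> P T -> forall X, perfect X -> P X.

(** Each class in the cohomology of degree [i] is a sum of classes [z r], with
[z] a cohomology class and [r] in the Jacobson radical. *)
Definition cohomology_in_radical S i :=
  forall z : S i, cocycle z ->
    exists n (y : 'I_n -> S i) (r : 'I_n -> A),
      [/\ forall l, cocycle (y l),
          forall l, jacobson_radical (r l) &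
          cohomologous z (\sum_(l < n) (r l : A^c) *: y l)].

Definition torsion_silting T :=
  presilting T /\
  forall S, (forall i : int, dhom_zero (shift T i) S) ->
    forall i, cohomology_in_radical S i.

Definition indecomposable X :=
  [/\ perfect X, ~ hzero X &
      forall Y Z, perfect Y -> perfect Z -> hiso X (csum Y Z) -> hzero Y \/ hzero Z].

Definition basic T :=
  ~ exists X Y Z, [/\ indecomposable X, indecomposable Y, perfect Z,
                      hiso X Y & hiso T (csum X (csum Y Z))].

(** Collections of complexes are plain predicates: [complex A] lives in a universe
above the one of [set]. *)

Definition iso_class T : complex A -> Prop := fun X => perfect X /\ hiso T X.

Definition presilt (C : complex A -> Prop) :=
  exists2 T, presilting T & C = iso_class T.
Definition silt (C : complex A -> Prop) :=
  exists T, [/\ silting T, basic T & C = iso_class T].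
Definition tsilt (C : complex A -> Prop) :=
  exists T, [/\ torsion_silting T, basic T & C = iso_class T].

Definition silt_ge (C D : complex A -> Prop) :=
  forall S T, C S -> D T -> forall i : int, 0 < i -> dhom_zero S (shift T i).

End Complexes.

Section BaseChange.
Variables (R S : pzRingType) (phi : {rmorphism R -> S}).

Fact base_change_shape (X : complex R) i j :
  j <> i + 1 -> forall u, tens_map phi (cdiff X i j) u = 0.
Proof.
move=> ij u; rewrite -[u]tpi_repr tens_mapE; apply/(@tpi_eq _ _ _ _ _ [::]).
elim: (repr u) => [|[m a] s IH] /=; first exact: tens_refl.
rewrite cdiff_shape // -cat1s -[[::]]cats0; apply: tens_cat IH.
exact: tens_0.
Qed.
Fact base_change_diffK (X : complex R) i j l u :
  tens_map phi (cdiff X j l) (tens_map phi (cdiff X i j) u) = 0.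
Proof.
rewrite -[u]tpi_repr !tens_mapE; apply/(@tpi_eq _ _ _ _ _ [::]).
elim: (repr u) => [|[m a] s IH] /=; first exact: tens_refl.
rewrite cdiffK -cat1s -[[::]]cats0; apply: tens_cat IH.
exact: tens_0.
Qed.
Definition base_change (X : complex R) : complex S :=
  @Complex S (fun i => tens phi (X i)) (fun i j => tens_map phi (cdiff X i j))
    (@base_change_shape X) (@base_change_diffK X).

Definition class_base_change (C : complex R -> Prop) : complex S -> Prop :=
  fun P => perfect P /\ exists2 T, C T & hiso (base_change T) P.

End BaseChange.

Record central_embedding (k : fieldType) (G : pzRingType) := CentralEmbedding {
  cemb :> {rmorphism k[[X]] -> G};
  cemb_inj : injective cemb;
  cemb_central : forall f g, cemb f * g = g * cemb f }.

(** Finitely generated and free over [k[[X]]], i.e. there is a finite basis. *)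
Definition is_order (k : fieldType) (G : pzRingType) (iota : central_embedding k G) :=
  exists n (e : 'I_n -> G), forall a, exists! c : {ffun 'I_n -> k[[X]]},
    a = \sum_(i < n) iota (c i) * e i.

Section ModX.
Variables (k : fieldType) (G : pzRingType) (iota : central_embedding k G).

Definition X_ideal_set : set G := [set a | exists g, a = iota (fps_X k) * g].
Fact X_ideal0 : X_ideal_set 0.
Proof. by exists 0; rewrite mulr0. Qed.
Fact X_idealB x y : X_ideal_set x -> X_ideal_set y -> X_ideal_set (x - y).
Proof. by move=> [g ->] [h ->]; exists (g - h); rewrite mulrBr. Qed.
Fact X_idealMl a x : X_ideal_set x -> X_ideal_set (a * x).
Proof. by move=> [g ->]; exists (a * g); rewrite !mulrA cemb_central. Qed.
Fact X_idealMr x a : X_ideal_set x -> X_ideal_set (x * a).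
Proof. by move=> [g ->]; exists (g * a); rewrite mulrA. Qed.
Definition X_ideal : ideal G := Ideal X_ideal0 X_idealB X_idealMl X_idealMr.

Definition modX : pzRingType := rquot X_ideal.
Definition to_modX : {rmorphism G -> modX} := @rpi G X_ideal.

(** The functor [- (x)_G G/iota(X)G]. *)
Definition reduction (T : complex G) : complex modX := base_change to_modX T.
Definition class_reduction : (complex G -> Prop) -> (complex modX -> Prop) :=
  class_base_change to_modX.

End ModX.

Arguments reduction {k G} iota T.
Arguments class_reduction {k G} iota C.

Definition bij_on (E F : Type) (D : E -> Prop) (D' : F -> Prop) (f : E -> F) :=
  [/\ forall x, D x -> D' (f x),
      forall x y, D x -> D y -> f x = f y -> x = y &
      forall y, D' y -> exists2 x, D x & f x = y].

Definition partial_order_on (E : Type) (D : E -> Prop) (ge : E -> E -> Prop) :=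
  [/\ forall x, D x -> ge x x,
      forall x y, D x -> D y -> ge x y -> ge y x -> x = y &
      forall x y z, D x -> D y -> D z -> ge x y -> ge y z -> ge x z].

Definition poset_iso (E F : Type) (D : E -> Prop) (geD : E -> E -> Prop)
    (D' : F -> Prop) (geD' : F -> F -> Prop) (f : E -> F) :=
  [/\ partial_order_on D geD, partial_order_on D' geD', bij_on D D' f &
      forall x y, D x -> D y -> (geD x y <-> geD' (f x) (f y))].

(* Main.v *)
(** Reduction modulo [X]. The unit [T -> T/XT] has kernel [XT], and [Hom(T, S[n])] is a
finitely generated [k[[X]]]-module. Hence [Hom(T, S[n])] vanishes if its
reduction does (Nakayama), while vanishing in degrees [n] and [n + 1] implies
vanishing of the reduction in degree [n]. Maps lift along reduction once
[Hom(T, S[1]) = 0], and an endomorphism that is the identity modulo [X] is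
invertible, so that reduction reflects isomorphisms of pre-silting complexes.
Conversely, projective modules lift by lifting idempotents, and the differential
of [T'] lifts step by step modulo powers of [X], the obstruction lying in
[Hom(T', T'[2]) = 0].

Silting and torsion-silting. Say that [T] detects if, for any sequence of perfect
complexes [C_m] such that each [Hom(T, C_m[i])] is eventually zero, each
[H^j(C_m)] is eventually zero. Silting complexes detect, by thickness. A
pre-silting [T] that detects is silting: attaching cones of shifts of [T] to a
perfect [U] yields [U -> C_m] with cone in the thick closure of [T] and
[Hom(T, C_m[n]) = 0] for [n > -m], and by detection [U -> C_m] is null for large
[m], so that [U] is a summand of its cone, up to shift. If [T] is
torsion-silting, then its reduction detects: apply the definition to the
complex of germs [prod C_m / (+) C_m]. If the reduction of [T] detects, so does
[T], by Nakayama. Finally silting complexes are torsion-silting.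

Order. The same towers show that [Hom(Z, U) = 0] as soon as [Hom(T, U[n]) = 0] for
[n > 0] and [Hom(Z, T[n]) = 0] for [n >= 0]; this yields transitivity, and if
[S >= T >= S] the identity of [S] factors through a finite sum of copies of [T].
Over the finite-dimensional algebra [G/XG], Fitting's lemma makes endomorphism
rings of indecomposable objects local, whence [S] and [T] are isomorphic if they
are basic. *)

From HB Require Import structures.
Require Import Defs.
From mathcomp Require Import all_boot all_order all_algebra.
From mathcomp Require Import generic_quotient boolp classical_sets.
From mathcomp Require Import zify.

Set Implicit Arguments.
Unset Strict Implicit.
Unset Printing Implicit Defensive.

Import Order.TTheory GRing.Theory Num.Theory.
Local Open Scope ring_scope.
Local Open Scope quotient_scope.
Local Open Scope classical_set_scope.

(** * Homotopy category *)

(** The two embeddings never meet: [tsilt] does not mention [iota], so both halves are one statement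
    about a single embedding. Morphisms from a perfect complex to any target are homotopy classes,
    so fractions disappear after [dhom_zeroP]; the unbounded derived category survives only in the
    test objects of the torsion-silting condition. The obstacle is to get from arbitrary test
    objects to thick generation. The natural test object is the colimit of a tower over [T], but its
    cohomology need not be finitely generated, and then Nakayama says nothing about it. Keeping the
    tower as a sequence leaves each of its members finitely generated, and the reduced product packs
    all eventual statements into one test object; Nakayama is then applied to the members
    separately. Homotopy categories are never formed: maps are strict chain maps, so they form
    finitely generated modules, and homotopy enters as a submodule or a relation. No order argument
    is made over [G]: the order on [tsilt] is pulled back from [silt] over [G/XG], where the scalars
    form a field. *)

Definition mklin (R : pzRingType) (U V : lmodType R) (f : U -> V)
    (lf : linear f) : {linear U -> V} :=
  HB.pack f (GRing.isLinear.Build R U V *:%R f lf).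
Lemma mklinE (R : pzRingType) (U V : lmodType R) (f : U -> V) (lf : linear f) x :
  mklin lf x = f x.
Proof. by []. Qed.
Global Opaque mklin.

Section CmapGroup.
Variable A : pzRingType.
Implicit Types X Y Z W : complex A.

HB.instance Definition _ X Y := gen_eqMixin (cmap X Y).
HB.instance Definition _ X Y := gen_choiceMixin (cmap X Y).

Lemma linP (R : pzRingType) (U V : lmodType R) (f g : {linear U -> V}) :
  (forall x, f x = g x) -> f = g.
Proof.
case: f g => f cf [g cg] fg.
have e : f = g by apply: functional_extensionality_dep => x; exact: fg.
move=> {fg}; subst g; congr GRing.Linear.Pack.
case: cf cg => [[a] [b]] [[a'] [b']].
by rewrite (Prop_irrelevance a a') (Prop_irrelevance b b').
Qed.

Lemma cmapP X Y (f g : cmap X Y) : (forall i x, f i x = g i x) -> f = g.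
Proof.
case: f g => f cf [g cg] /= fg.
have e : f = g by apply: functional_extensionality_dep => i; apply: linP; exact: fg.
by subst g; congr CMap; apply: Prop_irrelevance.
Qed.

Fact cmap_add_comm X Y (f g : cmap X Y) i j x :
  (f j \+ g j) (cdiff X i j x) = cdiff Y i j ((f i \+ g i) x).
Proof. by rewrite /= !cfunC linearD. Qed.
Definition cmap_add X Y (f g : cmap X Y) := CMap (cmap_add_comm f g).
Fact cmap_opp_comm X Y (f : cmap X Y) i j x :
  (\- (f j)) (cdiff X i j x) = cdiff Y i j ((\- (f i)) x).
Proof. by rewrite /= !cfunC linearN. Qed.
Definition cmap_opp X Y (f : cmap X Y) := CMap (cmap_opp_comm f).

Fact cmap_addA X Y : associative (@cmap_add X Y).
Proof. by move=> f g h; apply/cmapP => i x /=; rewrite addrA. Qed.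
Fact cmap_addC X Y : commutative (@cmap_add X Y).
Proof. by move=> f g; apply/cmapP => i x /=; rewrite addrC. Qed.
Fact cmap_add0 X Y : left_id (cmap0 X Y) (@cmap_add X Y).
Proof. by move=> f; apply/cmapP => i x /=; rewrite add0r. Qed.
Fact cmap_addN X Y : left_inverse (cmap0 X Y) (@cmap_opp X Y) (@cmap_add X Y).
Proof. by move=> f; apply/cmapP => i x /=; rewrite addNr. Qed.
HB.instance Definition _ X Y := GRing.isZmodule.Build (cmap X Y)
  (@cmap_addA X Y) (@cmap_addC X Y) (@cmap_add0 X Y) (@cmap_addN X Y).

Lemma cmapD X Y (f g : cmap X Y) i x : (f + g) i x = f i x + g i x.
Proof. by []. Qed.
Lemma cmapB X Y (f g : cmap X Y) i x : (f - g) i x = f i x - g i x.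
Proof. by []. Qed.

Lemma comp_cmapA X Y Z W (h : cmap Z W) (g : cmap Y Z) (f : cmap X Y) :
  cmap_comp h (cmap_comp g f) = cmap_comp (cmap_comp h g) f.
Proof. exact/cmapP. Qed.
Lemma comp_cmap1 X Y (f : cmap X Y) : cmap_comp f (cmap_id X) = f.
Proof. exact/cmapP. Qed.
Lemma comp_1cmap X Y (f : cmap X Y) : cmap_comp (cmap_id Y) f = f.
Proof. exact/cmapP. Qed.
Lemma comp_cmapDl X Y Z (g g' : cmap Y Z) (f : cmap X Y) :
  cmap_comp (g + g') f = cmap_comp g f + cmap_comp g' f.
Proof. exact/cmapP. Qed.
Lemma comp_cmapDr X Y Z (g : cmap Y Z) (f f' : cmap X Y) :
  cmap_comp g (f + f') = cmap_comp g f + cmap_comp g f'.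
Proof. by apply/cmapP => i x /=; rewrite linearD. Qed.
Lemma comp_cmapNl X Y Z (g : cmap Y Z) (f : cmap X Y) :
  cmap_comp (- g) f = - cmap_comp g f.
Proof. exact/cmapP. Qed.
Lemma comp_cmapNr X Y Z (g : cmap Y Z) (f : cmap X Y) :
  cmap_comp g (- f) = - cmap_comp g f.
Proof. by apply/cmapP => i x /=; rewrite linearN. Qed.
Lemma comp_cmapBl X Y Z (g g' : cmap Y Z) (f : cmap X Y) :
  cmap_comp (g - g') f = cmap_comp g f - cmap_comp g' f.
Proof. by rewrite comp_cmapDl comp_cmapNl. Qed.
Lemma comp_cmapBr X Y Z (g : cmap Y Z) (f f' : cmap X Y) :
  cmap_comp g (f - f') = cmap_comp g f - cmap_comp g f'.
Proof. by rewrite comp_cmapDr comp_cmapNr. Qed.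

(** The homotopy may be read off in any indices [j, l] adjacent to [i], which
avoids transporting along equalities of degrees. *)
Definition nullh X Y (f : cmap X Y) :=
  exists h : forall i j, {linear X i -> Y j}, forall i j l x,
    j + 1 = i -> l = i + 1 ->
    f i x = cdiff Y j i (h i j x) + h l i (cdiff X i l x).

Lemma homotopicP X Y (f g : cmap X Y) : homotopic f g <-> nullh (f - g).
Proof.
split=> -[h hE]; exists h.
  move=> i j l x ji ->; have -> : j = i - 1 by rewrite -ji addrK.
  by rewrite cmapB hE.
by move=> i x; rewrite -(hE i (i - 1) (i + 1)) // subrK.
Qed.

Lemma nullh0 X Y : nullh (0 : cmap X Y).
Proof. by exists (fun i j => \0) => i j l x _ _ /=; rewrite linear0 addr0. Qed.
Lemma nullhD X Y (f g : cmap X Y) : nullh f -> nullh g -> nullh (f + g).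
Proof.
move=> [h hE] [h' hE']; exists (fun i j => h i j \+ h' i j) => i j l x ji li /=.
by rewrite (hE i j l) // (hE' i j l) // linearD addrACA.
Qed.
Lemma nullhN X Y (f : cmap X Y) : nullh f -> nullh (- f).
Proof.
move=> [h hE]; exists (fun i j => \- (h i j)) => i j l x ji li /=.
by rewrite (hE i j l) // linearN opprD.
Qed.
Lemma nullhB X Y (f g : cmap X Y) : nullh f -> nullh g -> nullh (f - g).
Proof. by move=> f0 g0; apply: nullhD => //; apply: nullhN. Qed.
Lemma nullh_sum X Y I (r : seq I) (P : pred I) (F : I -> cmap X Y) :
  (forall i, P i -> nullh (F i)) -> nullh (\sum_(i <- r | P i) F i).
Proof. by move=> F0; elim/big_ind: _ => //; [exact: nullh0 | exact: nullhD]. Qed.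
Lemma nullh_compl X Y Z (g : cmap Y Z) (f : cmap X Y) :
  nullh f -> nullh (cmap_comp g f).
Proof.
move=> [h hE]; exists (fun i j => g j \o h i j) => i j l x ji li /=.
by rewrite (hE i j l) // linearD !cfunC.
Qed.
Lemma nullh_compr X Y Z (g : cmap Y Z) (f : cmap X Y) :
  nullh g -> nullh (cmap_comp g f).
Proof.
move=> [h hE]; exists (fun i j => h i j \o f i) => i j l x ji li /=.
by rewrite (hE i j l) // cfunC.
Qed.

Definition heq X Y (f g : cmap X Y) := nullh (f - g).
Local Notation "f ~ g" := (heq f g) (at level 70).

Lemma heq_refl X Y (f : cmap X Y) : f ~ f.
Proof. by rewrite /heq subrr; apply: nullh0. Qed.
Lemma heq_sym X Y (f g : cmap X Y) : f ~ g -> g ~ f.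
Proof. by rewrite /heq => /nullhN; rewrite opprB. Qed.
Lemma heq_trans X Y (g f h : cmap X Y) : f ~ g -> g ~ h -> f ~ h.
Proof. by rewrite /heq => fg /(nullhD fg); rewrite addrA subrK. Qed.
Lemma heq_comp X Y Z (g g' : cmap Y Z) (f f' : cmap X Y) :
  g ~ g' -> f ~ f' -> cmap_comp g f ~ cmap_comp g' f'.
Proof.
move=> gg ff; apply: (@heq_trans _ _ (cmap_comp g' f)).
  by rewrite /heq -comp_cmapBl; apply: nullh_compr.
by rewrite /heq -comp_cmapBr; apply: nullh_compl.
Qed.
Lemma heqD X Y (f f' g g' : cmap X Y) : f ~ f' -> g ~ g' -> f + g ~ f' + g'.
Proof. by rewrite /heq => ff gg; rewrite opprD addrACA; apply: nullhD. Qed.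
Lemma heqB X Y (f f' g g' : cmap X Y) : f ~ f' -> g ~ g' -> f - g ~ f' - g'.
Proof.
move=> ff gg; apply: heqD => //.
by rewrite /heq -opprD; apply: nullhN.
Qed.
Lemma heq0 X Y (f : cmap X Y) : f ~ 0 <-> nullh f.
Proof. by rewrite /heq subr0. Qed.
Lemma heq_nullh X Y (f g : cmap X Y) : f ~ g -> nullh g -> nullh f.
Proof. by move=> fg /heq0 g0; apply/heq0; apply: heq_trans fg g0. Qed.

Definition hinv X Y (f : cmap X Y) (g : cmap Y X) :=
  cmap_comp g f ~ cmap_id X /\ cmap_comp f g ~ cmap_id Y.

Lemma hisoP X Y : hiso X Y <-> exists f g, @hinv X Y f g.
Proof. by split=> -[f [g [gf fg]]]; exists f, g; split; apply/homotopicP. Qed.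

Lemma hiso_refl X : hiso X X.
Proof.
by apply/hisoP; exists (cmap_id X), (cmap_id X); split; rewrite comp_cmap1; apply: heq_refl.
Qed.
Lemma hiso_sym X Y : hiso X Y -> hiso Y X.
Proof. by move=> [f [g [? ?]]]; exists g, f. Qed.
Lemma hiso_trans Y X Z : hiso X Y -> hiso Y Z -> hiso X Z.
Proof.
move=> /hisoP[f [g [gf fg]]] /hisoP[f' [g' [gf' fg']]]; apply/hisoP.
exists (cmap_comp f' f), (cmap_comp g g'); split.
  rewrite comp_cmapA -(comp_cmapA g); apply: heq_trans gf.
  apply: heq_comp (heq_refl _); rewrite -[X in _ ~ X]comp_cmap1.
  exact: heq_comp (heq_refl _) _.
rewrite comp_cmapA -(comp_cmapA f'); apply: heq_trans fg'.
apply: heq_comp (heq_refl _); rewrite -[X in _ ~ X]comp_cmap1.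
exact: heq_comp (heq_refl _) _.
Qed.

Lemma hiso_strict X Y (f : cmap X Y) (g : cmap Y X) :
  (forall i x, g i (f i x) = x) -> (forall i y, f i (g i y) = y) -> hiso X Y.
Proof.
move=> gf fg; apply/hisoP; exists f, g; split.
  by have -> : cmap_comp g f = cmap_id X; [apply/cmapP | apply: heq_refl].
by have -> : cmap_comp f g = cmap_id Y; [apply/cmapP | apply: heq_refl].
Qed.

Definition hz0 X Y := forall f : cmap X Y, nullh f.

Lemma hz0_retr X Y Z (a : cmap Y Z) (b : cmap Z Y) :
  cmap_comp b a ~ cmap_id Y -> hz0 X Z -> hz0 X Y.
Proof.
move=> ba XZ f; apply: (@heq_nullh _ _ _ (cmap_comp b (cmap_comp a f))).
  rewrite comp_cmapA -{1}[f]comp_1cmap; apply: heq_comp (heq_refl _).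
  exact: heq_sym.
exact: nullh_compl.
Qed.
Lemma hz0_retl X Y Z (a : cmap Y Z) (b : cmap Z Y) :
  cmap_comp b a ~ cmap_id Y -> hz0 Z X -> hz0 Y X.
Proof.
move=> ba ZX f; apply: (@heq_nullh _ _ _ (cmap_comp (cmap_comp f b) a)).
  rewrite -comp_cmapA -{1}[f]comp_cmap1; apply: heq_comp (heq_refl _) _.
  exact: heq_sym.
exact: nullh_compr.
Qed.
Lemma hz0_isor X Y Z : hiso Y Z -> hz0 X Y -> hz0 X Z.
Proof. by move=> /hisoP[f [g [_ fg]]]; apply: hz0_retr fg. Qed.
Lemma hz0_isol X Y Z : hiso Y Z -> hz0 Y X -> hz0 Z X.
Proof. by move=> /hisoP[f [g [_ fg]]]; apply: hz0_retl fg. Qed.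

End CmapGroup.
Notation "f ~ g" := (heq f g) (at level 70) : ring_scope.

(** * Shifts and transport between degrees *)

Section Shifts.
Variable A : pzRingType.
Implicit Types X Y Z W : complex A.

Section Transport.
Variables (X : complex A) (i j : int).
(** Transport along an equality of degrees, made total by the value 0 for distinct degrees. No proof
    of equality occurs in its type, so it composes and rewrites freely. *)
Definition tr_fun (x : X i) : X j :=
  if i =P j is ReflectT e then ccast e x else 0.
Fact tr_linear : linear tr_fun.
Proof.
by move=> a x y; rewrite /tr_fun; case: eqP => [e|_]; [subst j | rewrite scaler0 addr0].
Qed.
Definition tr := mklin tr_linear.
End Transport.
Arguments tr X i j : clear implicits.

Lemma trid X i x : tr X i i x = x.
Proof. by rewrite mklinE /tr_fun; case: eqP => // e; rewrite (eq_irrelevance e erefl). Qed.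
Lemma trK X i j x : i = j -> tr X j i (tr X i j x) = x.
Proof. by move=> ij; subst j; rewrite !trid. Qed.
Lemma diff_tr X i i' j j' x : i = i' -> j = j' ->
  cdiff X i' j' (tr X i i' x) = tr X j j' (cdiff X i j x).
Proof. by move=> ii jj; subst i' j'; rewrite !trid. Qed.
Lemma cfun_tr X Y (f : cmap X Y) i j x : i = j -> f j (tr X i j x) = tr Y i j (f i x).
Proof. by move=> ij; subst j; rewrite !trid. Qed.

Section MkCmap.
Variables (X Y : complex A) (f : forall i, {linear X i -> Y i}).
Hypothesis fC : forall i j x, j = i + 1 -> f j (cdiff X i j x) = cdiff Y i j (f i x).
Fact mkcmap_comm i j x : f j (cdiff X i j x) = cdiff Y i j (f i x).
Proof. by have [/fC //|ij] := pselect (j = i + 1); rewrite !cdiff_shape // linear0. Qed.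
Definition mkcmap := CMap mkcmap_comm.
End MkCmap.

Definition sg (n : int) : int := (-1) ^ n.
Lemma sgD m n : sg (m + n) = sg m * sg n.
Proof. by rewrite /sg exprzDr // unitrN1. Qed.
Lemma sg0 : sg 0 = 1. Proof. by []. Qed.
Lemma sg2 n : sg n * sg n = 1.
Proof.
by rewrite /sg -exprMz_comm ?unitrN1 // mulrNN mulr1 exp1rz.
Qed.
Lemma sg1 : sg 1 = -1. Proof. by []. Qed.
Lemma sgK (V : zmodType) n : involutive (fun x : V => x *~ sg n).
Proof. by move=> x; rewrite -mulrzA sg2 mulr1z. Qed.

Section Lscale.
Variables (R : pzRingType) (U V : lmodType R) (f : {linear U -> V}) (s : int).
Fact lscale_linear : linear (fun x => f x *~ s).
Proof. by move=> a x y; rewrite linearP mulrzDl scalerMzr. Qed.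
Definition lscale := mklin lscale_linear.
Lemma lscaleE x : lscale x = f x *~ s.
Proof. exact: mklinE. Qed.
End Lscale.

Lemma lin_mulz (R : pzRingType) (U V : lmodType R) (f : {linear U -> V}) x s :
  f (x *~ s) = f x *~ s.
Proof. by rewrite raddfMz. Qed.

Lemma shiftE X n i j x : cdiff (shift X n) i j x = cdiff X (i + n) (j + n) x *~ sg n.
Proof. by []. Qed.

Fact cshift_comm X Y (f : cmap X Y) n i j x :
  f (j + n) (cdiff (shift X n) i j x) = cdiff (shift Y n) i j (f (i + n) x).
Proof. by rewrite !shiftE lin_mulz cfunC. Qed.
Definition cshift X Y (f : cmap X Y) n : cmap (shift X n) (shift Y n) :=
  @CMap A (shift X n) (shift Y n) (fun i => f (i + n)) (@cshift_comm X Y f n).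

Lemma nullh_shift X Y (f : cmap X Y) n : nullh f -> nullh (cshift f n).
Proof.
(* The differentials of the shifts carry the sign [sg n], so the homotopy must carry it too; the two
   signs cancel. *)
move=> [h hE]; exists (fun i j => lscale (h (i + n) (j + n)) (sg n)) => i j l x ji li.
rewrite !shiftE !lscaleE !lin_mulz -!mulrzA sg2 !mulr1z.
by apply: hE; lia.
Qed.

Lemma shift_nullh X Y (f : cmap X Y) n : nullh (cshift f n) -> nullh f.
Proof.
move=> [h hE].
have e i : i = i - n + n by rewrite subrK.
exists (fun i j => lscale (tr Y _ j \o (h (i - n) (j - n) \o tr X i _)) (sg n)) => i j l x ji li /=.
have := hE (i - n) (j - n) (l - n) (tr X i _ x).
rewrite !shiftE /= (cfun_tr f) // => H.
have := congr1 (tr Y (i - n + n) i) (H _ _).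
rewrite trK // => ->; [| by rewrite -ji addrAC | by rewrite li addrAC].
rewrite !lscaleE /= linearD !lin_mulz; congr (_ *~ _ + _ *~ _).
  by rewrite (diff_tr _ (esym (e j)) (esym (e i))).
by rewrite (diff_tr x (e i) (e l)).
Qed.

Lemma shift_shift X m n : hiso (shift (shift X m) n) (shift X (m + n)).
Proof.
have e i : i + n + m = i + (m + n) by rewrite -addrA [n + m]addrC.
have C i j x : j = i + 1 ->
    tr X (j + n + m) (j + (m + n)) (cdiff (shift (shift X m) n) i j x)
    = cdiff (shift X (m + n)) i j (tr X (i + n + m) (i + (m + n)) x).
  move=> _; rewrite !shiftE !lin_mulz sgD mulrzA.
  by rewrite (diff_tr _ (e i) (e j)).
have C' i j x : j = i + 1 ->
    tr X (j + (m + n)) (j + n + m) (cdiff (shift X (m + n)) i j x)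
    = cdiff (shift (shift X m) n) i j (tr X (i + (m + n)) (i + n + m) x).
  move=> _; rewrite !shiftE !lin_mulz sgD mulrzA.
  by rewrite (diff_tr _ (esym (e i)) (esym (e j))).
by apply: (@hiso_strict _ _ _ (@mkcmap (shift (shift X m) n) (shift X (m + n)) _ C)
  (@mkcmap (shift X (m + n)) (shift (shift X m) n) _ C')) => i x /=; rewrite trK.
Qed.

Lemma shift0 X : hiso (shift X 0) X.
Proof.
have C i j x : j = i + 1 -> tr X (j + 0) j (cdiff (shift X 0) i j x)
    = cdiff X i j (tr X (i + 0) i x).
  by move=> _; rewrite shiftE sg0 mulr1z (diff_tr _ (addr0 i) (addr0 j)).
have C' i j x : j = i + 1 -> tr X j (j + 0) (cdiff X i j x)
    = cdiff (shift X 0) i j (tr X i (i + 0) x).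
  by move=> _; rewrite shiftE sg0 mulr1z (diff_tr _ (esym (addr0 i)) (esym (addr0 j))).
by apply: (@hiso_strict _ _ _ (@mkcmap (shift X 0) X _ C)
  (@mkcmap X (shift X 0) _ C')) => i x /=; rewrite trK ?addr0.
Qed.

Lemma hiso_shift X Y n : hiso X Y -> hiso (shift X n) (shift Y n).
Proof.
move=> /hisoP[f [g [gf fg]]]; apply/hisoP; exists (cshift f n), (cshift g n).
by split; [move: (nullh_shift n gf) | move: (nullh_shift n fg)];
  congr nullh; apply/cmapP.
Qed.

Lemma shift_hz0 X Y n : hz0 (shift X n) (shift Y n) -> hz0 X Y.
Proof. by move=> H f; apply: (@shift_nullh _ _ _ n). Qed.

Lemma shiftNK X n : hiso (shift (shift X n) (- n)) X.
Proof. by apply: hiso_trans (shift_shift _ _ _) _; rewrite subrr; apply: shift0. Qed.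

Lemma hz0_shift X Y n : hz0 X Y -> hz0 (shift X n) (shift Y n).
Proof.
move=> XY; apply: (@shift_hz0 _ _ (- n)).
apply: hz0_isor (hiso_sym (shiftNK Y n)) _.
exact: hz0_isol (hiso_sym (shiftNK X n)) XY.
Qed.

(** [Hom(X, Y[n])] vanishes in the homotopy category. *)
Definition hz n X Y := hz0 X (shift Y n).

Lemma hz_0 X Y : hz 0 X Y <-> hz0 X Y.
Proof. by split; apply: hz0_isor; [|apply: hiso_sym]; apply: shift0. Qed.
Lemma hz_shiftr n m X Y : hz n X (shift Y m) <-> hz (m + n) X Y.
Proof. by split; apply: hz0_isor; [|apply: hiso_sym]; apply: shift_shift. Qed.
Lemma hz_shift n m X Y : hz n (shift X m) (shift Y m) <-> hz n X Y.
Proof.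
have e : hiso (shift (shift Y m) n) (shift (shift Y n) m).
  apply: hiso_trans (shift_shift _ _ _) _; rewrite addrC.
  exact: hiso_sym (shift_shift _ _ _).
split=> [H|/(@hz0_shift _ _ m)]; last exact: hz0_isor (hiso_sym e).
by apply: (@shift_hz0 _ _ m); apply: hz0_isor e H.
Qed.
Lemma hz_shiftl n m X Y : hz n (shift X m) Y <-> hz (n - m) X Y.
Proof.
have e : hiso (shift (shift X m) (- m)) X by apply: shiftNK.
split=> H.
  rewrite addrC; apply/hz_shiftr.
  by apply: hz0_isol e _; apply/hz_shift.
apply/(hz_shift _ (- m)); apply: hz0_isol (hiso_sym e) _.
by apply/hz_shiftr; rewrite addrC.
Qed.
Lemma hz_isor n X Y Z : hiso Y Z -> hz n X Y -> hz n X Z.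
Proof. by move=> YZ; apply: hz0_isor; apply: hiso_shift. Qed.
Lemma hz_isol n X Y Z : hiso Y Z -> hz n Y X -> hz n Z X.
Proof. exact: hz0_isol. Qed.

End Shifts.
Arguments tr {A} X i j.

Lemma pairE (T U : Type) (p q : T * U) : p.1 = q.1 -> p.2 = q.2 -> p = q.
Proof. by case: p q => [? ?] [? ?] /= -> ->. Qed.

(** * Finitely generated and projective modules *)

Section Span.
Variables (R : pzRingType).
Implicit Types V W : lmodType R.

(** Recursion on the list of generators instead of a sum over ordinals: the finiteness arguments
    below remove one generator at a time. *)
Fixpoint span V (s : seq V) (x : V) : Prop :=
  if s is e :: s' then exists c y, span s' y /\ x = c *: e + y else x = 0.

Definition submod V (N : set V) :=
  [/\ N 0, forall x y, N x -> N y -> N (x + y) & forall a x, N x -> N (a *: x)].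

Lemma submodN V (N : set V) x : submod N -> N x -> N (- x).
Proof. by move=> [_ _ NZ] Nx; rewrite -scaleN1r; apply: NZ. Qed.
Lemma submodB V (N : set V) x y : submod N -> N x -> N y -> N (x - y).
Proof. by move=> N1 Nx Ny; case: (N1) => _ D _; apply: D => //; apply: submodN. Qed.
Lemma submod_sum V (N : set V) I r (P : pred I) (F : I -> V) : submod N ->
  (forall i, P i -> N (F i)) -> N (\sum_(i <- r | P i) F i).
Proof. by move=> [N0 ND _] NF; elim/big_ind: _. Qed.

Lemma span_submod V (s : seq V) : submod (span s).
Proof.
elim: s => [|e s [s0 sD sZ]]; first by split=> /= [|x y -> ->|a x ->]; rewrite ?addr0 ?scaler0.
split=> /= [|x y [c [x' [sx ->]]] [d [y' [sy ->]]]|a x [c [x' [sx ->]]]].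
- by exists 0, 0; rewrite scale0r addr0.
- by exists (c + d), (x' + y'); split; [exact: sD | rewrite scalerDl addrACA].
- by exists (a * c), (a *: x'); split; [exact: sZ | rewrite scalerDr scalerA].
Qed.
Lemma span_mem V (s : seq V) x : x \in s -> span s x.
Proof.
elim: s => //= e s IH; rewrite inE => /orP[/eqP->|/IH sx].
  by exists 1, 0; rewrite scale1r addr0; split=> //; case: (span_submod s).
by exists 0, x; rewrite scale0r add0r.
Qed.
Lemma span_min V (s : seq V) (N : set V) x :
  submod N -> {in s, forall y, N y} -> span s x -> N x.
Proof.
move=> [N0 ND NZ]; elim: s x => [|e s IH] x Ns /=; first by move=> ->.
move=> [c [y [sy ->]]]; apply: ND; first by apply/NZ/Ns/mem_head.
by apply: IH => // z zs; apply: Ns; rewrite inE zs orbT.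
Qed.
Lemma span_sub V (s t : seq V) x : {subset s <= t} -> span s x -> span t x.
Proof. by move=> st; apply: span_min (span_submod t) _ => y /st; apply: span_mem. Qed.
Lemma span_map V W (f : {linear V -> W}) s x : span s x -> span (map f s) (f x).
Proof.
elim: s x => [|e s IH] x /=; first by move=> ->; rewrite linear0.
by move=> [c [y [/IH sy ->]]]; exists c, (f y); rewrite linearP.
Qed.
Lemma span_nth V (s : seq V) x : span s x ->
  exists a : 'I_(size s) -> R, x = \sum_(i < size s) a i *: s`_i.
Proof.
elim: s x => [|e s IH] x /=; first by exists (fun=> 0); rewrite big_ord0.
move=> [c [y [/IH[a ->] ->]]].
exists (fun i => oapp a c (unlift ord0 i)); rewrite big_ord_recl unlift_none; congr (_ + _).
by apply: eq_bigr => i _; rewrite liftK.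
Qed.
Lemma span_ord V n (e : 'I_n -> V) (a : 'I_n -> R) :
  span [seq e i | i <- enum 'I_n] (\sum_(i < n) a i *: e i).
Proof.
apply: submod_sum => [|i _]; first exact: span_submod.
by case: (span_submod [seq e i | i <- enum 'I_n]) => _ _; apply; apply/span_mem/map_f/mem_enum.
Qed.
End Span.

Lemma fgP (A : pzRingType) (M : rmodType A) :
  fin_generated M <-> exists s : seq M, forall x, span s x.
Proof.
split=> [[n [e eM]]|[s sM]].
  exists [seq e i | i <- enum 'I_n] => x; have [a ->] := eM x.
  exact: (@span_ord A^c).
by exists (size s), (fun i => s`_i) => x; have [a ->] := span_nth (sM x); exists a.
Qed.

Section ProjProd.
Variable A : pzRingType.
Implicit Types M N P Q : rmodType A.

Definition inl_lin M N : {linear M -> (M * N)%type}.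
Proof.
apply: (@mklin _ M (M * N)%type (fun x => (x, 0))) => a x y.
by apply: pairE; rewrite /= ?scaler0 ?addr0.
Defined.
Definition inr_lin M N : {linear N -> (M * N)%type}.
Proof.
apply: (@mklin _ N (M * N)%type (fun x => (0, x))) => a x y.
by apply: pairE; rewrite /= ?scaler0 ?addr0.
Defined.
Definition fst_lin M N : {linear (M * N)%type -> M} := fst.
Definition snd_lin M N : {linear (M * N)%type -> N} := snd.
Lemma inl_linE M N x : inl_lin M N x = (x, 0). Proof. exact: mklinE. Qed.
Lemma inr_linE M N x : inr_lin M N x = (0, x). Proof. exact: mklinE. Qed.

Definition pair_lin M N P (f : {linear P -> M}) (g : {linear P -> N}) : {linear P -> (M * N)%type}.
Proof.
apply: (@mklin _ P (M * N)%type (fun x => (f x, g x))) => a x y.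
by rewrite !linearP.
Defined.
Lemma pair_linE M N P (f : {linear P -> M}) (g : {linear P -> N}) x :
  pair_lin f g x = (f x, g x).
Proof. exact: mklinE. Qed.

Lemma fg_prod M N : fin_generated M -> fin_generated N -> fin_generated (M * N)%type.
Proof.
move=> /fgP[s sM] /fgP[t tN]; apply/fgP.
exists (map (inl_lin M N) s ++ map (inr_lin M N) t) => -[x y].
have -> : (x, y) = inl_lin M N x + inr_lin M N y.
  by rewrite inl_linE inr_linE; apply: pairE; rewrite /= ?addr0 ?add0r.
have [_ D _] := span_submod (map (inl_lin M N) s ++ map (inr_lin M N) t).
apply: D.
  by apply: span_sub (span_map _ (sM x)) => z; rewrite mem_cat => ->.
by apply: span_sub (span_map _ (tN y)) => z; rewrite mem_cat => ->; rewrite orbT.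
Qed.

Lemma proj_prod P Q : projective P -> projective Q -> projective (P * Q)%type.
Proof.
move=> pP pQ M N p f p_surj.
have [g gE] := pP M N p (f \o inl_lin P Q) p_surj.
have [h hE] := pQ M N p (f \o inr_lin P Q) p_surj.
exists ((g \o fst_lin P Q) \+ (h \o snd_lin P Q)) => -[x y] /=.
rewrite linearD gE hE /= -linearD inl_linE inr_linE; congr (f _).
by apply: pairE; rewrite /= ?addr0 ?add0r.
Qed.

Lemma fg_surj M N (f : {linear M -> N}) : (forall y, exists x, f x = y) ->
  fin_generated M -> fin_generated N.
Proof.
move=> fs /fgP[s sM]; apply/fgP; exists (map f s) => y.
by have [x <-] := fs y; apply: span_map.
Qed.
Lemma proj_retract P Q (a : {linear Q -> P}) (b : {linear P -> Q}) :
  (forall x, b (a x) = x) -> projective P -> projective Q.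
Proof.
move=> ba pP M N p f p_surj.
have [g gE] := pP M N p (f \o b) p_surj.
by exists (g \o a) => x /=; rewrite gE /= ba.
Qed.
End ProjProd.

Section Perfect.
Variable A : pzRingType.
Implicit Types X Y Z W : complex A.

Lemma perfect_shift X n : perfect X -> perfect (shift X n).
Proof.
move=> [[N NX] pX]; split=> [|i]; last exact: pX.
by exists (N + `|n|)%N => i iN x; apply: NX; lia.
Qed.
Lemma perfect_cone X Y (f : cmap X Y) : perfect X -> perfect Y -> perfect (cone f).
Proof.
move=> [[N NX] pX] [[M MY] pY]; split=> [|i].
  exists (N + M + 1)%N => i iN [x y]; rewrite (NX _ _ x) ?(MY _ _ y) //; lia.
by have [? ?] := pX (i + 1); have [? ?] := pY i; split; [apply: fg_prod | apply: proj_prod].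
Qed.
Lemma perfect_csum X Y : perfect X -> perfect Y -> perfect (csum X Y).
Proof.
move=> [[N NX] pX] [[M MY] pY]; split=> [|i].
  exists (N + M + 1)%N => i iN [x y]; rewrite (NX _ _ x) ?(MY _ _ y) //; lia.
by have [? ?] := pX i; have [? ?] := pY i; split; [apply: fg_prod | apply: proj_prod].
Qed.
End Perfect.

Lemma addrAK (V : zmodType) (a b c : V) : a + b + c - a = b + c.
Proof. by rewrite addrC -addrA addKr. Qed.

(** * Cones and direct sums *)

Section Cones.
Variable A : pzRingType.
Implicit Types X Y Z W : complex A.

Lemma coneE X Y (f : cmap X Y) i j p : j = i + 1 ->
  cdiff (cone f) i j p =
  (- cdiff X (i + 1) (j + 1) p.1, tr Y (i + 1) j (f (i + 1) p.1) + cdiff Y i j p.2).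
Proof.
move=> ji; subst j; rewrite trid /= /cone_diff_fun.
by case: eqP => // e; rewrite (eq_irrelevance e erefl).
Qed.

Section ConeMaps.
Variables (X Y : complex A) (f : cmap X Y).

Fact cone_in_comm i j y : j = i + 1 ->
  inr_lin (X (j + 1)) (Y j) (cdiff Y i j y)
  = cdiff (cone f) i j (inr_lin (X (i + 1)) (Y i) y).
Proof. by move=> ji; rewrite coneE // !inr_linE /=; apply: pairE; rewrite /= ?linear0 ?oppr0 ?add0r. Qed.
Definition cone_in : cmap Y (cone f) := @mkcmap A Y (cone f) _ cone_in_comm.
Lemma cone_inE i y : cone_in i y = (0, y).
Proof. exact: inr_linE. Qed.

Fact cone_out_comm i j p : j = i + 1 ->
  fst_lin (X (j + 1)) (Y j) (cdiff (cone f) i j p)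
  = cdiff (shift X 1) i j (fst_lin (X (i + 1)) (Y i) p).
Proof. by move=> ji; rewrite coneE // shiftE sg1 mulrN1z. Qed.
Definition cone_out : cmap (cone f) (shift X 1) :=
  @mkcmap A (cone f) (shift X 1) _ cone_out_comm.
Lemma cone_outE i p : cone_out i p = p.1.
Proof. by []. Qed.

Lemma cone_in_null : nullh (cmap_comp cone_in f).
Proof.
exists (fun i j => inl_lin (X (j + 1)) (Y j) \o tr X i (j + 1)) => i j l x ji li.
have e : l + 1 = i + 1 + 1 by rewrite li.
rewrite /= coneE // cone_inE !inl_linE /= linear0 addr0.
apply: pairE; rewrite /= ?addr0.
  by rewrite (diff_tr x (esym ji) li) ?li ?addNr.
by rewrite cfun_tr // trK.
Qed.

(** Exactness of the triangle at [Y]. The first component of a null-homotopy with values in the cone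
    is the required chain map [b], and the second one is a homotopy from [f b] to [g]. *)
Lemma cone_in_null_factor Z (g : cmap Z Y) :
  nullh (cmap_comp cone_in g) -> exists b : cmap Z X, g ~ cmap_comp f b.
Proof.
move=> [h hE].
have h1 i j l x : j + 1 = i -> l = i + 1 ->
    cdiff X (j + 1) (i + 1) (h i j x).1 = (h l i (cdiff Z i l x)).1.
  move=> ji li; have := congr1 fst (hE i j l x ji li).
  by rewrite /= cone_inE coneE //= => /esym/eqP; rewrite addr_eq0 eqr_opp => /eqP.
have h2 i j l x : j + 1 = i -> l = i + 1 ->
    g i x = tr Y (j + 1) i (f (j + 1) (h i j x).1) + cdiff Y j i (h i j x).2
            + (h l i (cdiff Z i l x)).2.
  move=> ji li; have := congr1 snd (hE i j l x ji li).
  by rewrite /= cone_inE coneE.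
pose b i : {linear Z i -> X i} := tr X (i - 1 + 1) i \o (fst_lin _ _ \o h i (i - 1)).
have bC i j x : j = i + 1 -> b j (cdiff Z i j x) = cdiff X i j (b i x).
  move=> ji; have e : i = j - 1 by rewrite ji addrK.
  subst i; rewrite /b /= (diff_tr _ (subrK 1 _) (subrK 1 j)).
  by rewrite (h1 (j - 1) _ j) ?subrK.
exists (mkcmap bC), (fun i j => snd_lin _ _ \o h i j) => i j l x ji li.
have e : j = i - 1 by rewrite -ji addrK.
by subst j; rewrite cmapB (h2 i (i - 1) l) //= cfun_tr ?subrK // addrAK.
Qed.

(** Exactness of the triangle at the cone. Subtracting the boundary of the homotopy [(h, 0)] makes
    the first component of [g] vanish, so the rest lies in [Y]. *)
Lemma cone_out_null_factor Z (g : cmap Z (cone f)) :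
  nullh (cmap_comp cone_out g) -> exists b : cmap Z Y, g ~ cmap_comp cone_in b.
Proof.
move=> [h hE].
pose k i j : {linear Z i -> cone f j} := inl_lin (X (j + 1)) (Y j) \o h i j.
pose b i : {linear Z i -> Y i} := (snd_lin (X (i + 1)) (Y i) \o g i)
   \- (tr Y (i - 1 + 1) i \o (f (i - 1 + 1) \o h i (i - 1))).
have bE i j l x : j + 1 = i -> l = i + 1 ->
    g i x = cdiff (cone f) j i (k i j x) + k l i (cdiff Z i l x) + (0, b i x).
  move=> ji li; have e : j = i - 1 by rewrite -ji addrK.
  subst j; rewrite coneE // /k /b /= !inl_linE /= linear0 addr0; apply: pairE => /=.
    rewrite addr0; have := hE i _ l x ji li.
    by rewrite /= shiftE sg1 mulrN1z.
  by rewrite addr0 subrKC.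
have bC i j x : j = i + 1 -> b j (cdiff Z i j x) = cdiff Y i j (b i x).
  move=> ji; have := cfunC g j x.
  rewrite (bE i (i - 1) j) ?subrK // (bE j i (j + 1)) // cdiffK !linear0 addr0.
  rewrite !linearD cdiffK add0r => /addrI /(congr1 snd).
  by rewrite coneE //= linear0 linear0 add0r => ->; rewrite linearD.
exists (mkcmap bC), k => i j l x ji li.
by rewrite cmapB (bE i j l) //= cone_inE addrK.
Qed.

(** The contravariant counterpart: subtracting the boundary of the homotopy composed with the second
    projection makes [g] vanish on [Y], so the rest depends on the first component only. *)
Lemma cone_map_factor W (g : cmap (cone f) W) :
  nullh (cmap_comp g cone_in) -> exists b : cmap (shift X 1) W, g ~ cmap_comp b cone_out.
Proof.
move=> [h hE].
pose k i j : {linear cone f i -> W j} := h i j \o snd_lin (X (i + 1)) (Y i).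
pose b i : {linear shift X 1 i -> W i} := (g i \o inl_lin (X (i + 1)) (Y i)) \- (h (i + 1) i \o f (i + 1)).
have bE i j l p : j + 1 = i -> l = i + 1 ->
    g i p = cdiff W j i (k i j p) + k l i (cdiff (cone f) i l p) + b i p.1.
  move=> ji li; subst l; rewrite coneE //= trid linearD inl_linE.
  have -> : p = (p.1, 0) + cone_in i p.2.
    by rewrite cone_inE; apply: pairE; rewrite /= ?addr0 ?add0r.
  rewrite linearD -[g i (cone_in _ _)]/(cmap_comp g cone_in i p.2) (hE i j (i + 1)) //=.
  rewrite cone_inE /= !add0r !addr0 [RHS]addrC -!addrA; congr (_ + _).
  by rewrite addrCA addKr.
have bC i j x : j = i + 1 -> b j (cdiff (shift X 1) i j x) = cdiff W i j (b i x).
  move=> ji; have := cfunC g j (x, 0).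
  rewrite (bE i (i - 1) j) ?subrK // (bE j i (j + 1)) // cdiffK !linear0 addr0.
  rewrite !linearD cdiffK add0r => /addrI.
  by rewrite coneE //= shiftE sg1 mulrN1z.
exists (mkcmap bC), k => i j l x ji li.
by rewrite cmapB (bE i j l) //= addrK.
Qed.

End ConeMaps.

Lemma hz0_cone_r X Y (f : cmap X Y) Z : hz0 Z Y -> hz0 Z (shift X 1) -> hz0 Z (cone f).
Proof.
move=> ZY ZX g; have [b gb] := cone_out_null_factor (ZX (cmap_comp (cone_out f) g)).
by apply: heq_nullh gb _; apply: nullh_compl.
Qed.
Lemma hz0_cone_l X Y (f : cmap X Y) W : hz0 Y W -> hz0 (shift X 1) W -> hz0 (cone f) W.
Proof.
move=> YW XW g; have [b gb] := cone_map_factor (YW (cmap_comp g (cone_in f))).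
by apply: heq_nullh gb _; apply: nullh_compr.
Qed.

(** Shifting the cone multiplies also the component [f] of its differential by the sign, whereas the
    cone of the shifted map leaves it unchanged. A sign on the summand [Y] compensates for this. *)
Lemma cone_shift X Y (f : cmap X Y) n : hiso (cone (cshift f n)) (shift (cone f) n).
Proof.
have e i : i + 1 + n = i + n + 1 by lia.
pose a i : {linear cone (cshift f n) i -> shift (cone f) n i} :=
  pair_lin (tr X (i + 1 + n) (i + n + 1) \o fst_lin (X (i + 1 + n)) (Y (i + n)))
   (lscale (snd_lin (X (i + 1 + n)) (Y (i + n))) (sg n)).
pose b i : {linear shift (cone f) n i -> cone (cshift f n) i} :=
  pair_lin (tr X (i + n + 1) (i + 1 + n) \o fst_lin (X (i + n + 1)) (Y (i + n)))
   (lscale (snd_lin (X (i + n + 1)) (Y (i + n))) (sg n)).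
have aE i p : a i p = (tr X (i + 1 + n) (i + n + 1) p.1, p.2 *~ sg n).
  by rewrite pair_linE lscaleE.
have bE i p : b i p = (tr X (i + n + 1) (i + 1 + n) p.1, p.2 *~ sg n).
  by rewrite pair_linE lscaleE.
have ab i p : a i (b i p) = p by rewrite aE bE /= sgK trK ?e //; case: p.
have ba i p : b i (a i p) = p by rewrite aE bE /= sgK trK ?e //; case: p.
have aC i j p : j = i + 1 -> a j (cdiff (cone (cshift f n)) i j p)
    = cdiff (shift (cone f) n) i j (a i p).
  move=> ji; subst j.
  rewrite coneE // !aE [RHS]shiftE coneE ?e //= !shiftE trid.
  rewrite (cfun_tr f _ (e i)) trK ?e // (diff_tr _ (e i) (e (i + 1))).
  by apply: pairE; rewrite /= ?linearN ?lin_mulz ?mulNrz ?mulrzDl ?lin_mulz.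
have bC i j p : j = i + 1 -> b j (cdiff (shift (cone f) n) i j p)
    = cdiff (cone (cshift f n)) i j (b i p).
  by move=> ji; rewrite -{1}[p]ab -aC // ba.
exact: (hiso_strict (f := mkcmap aC) (g := mkcmap bC)).
Qed.
End Cones.

Section Triangles.
Variable A : pzRingType.
Implicit Types X Y Z W : complex A.

Lemma hz_cone_r n X Y (f : cmap X Y) Z : hz n Z Y -> hz (n + 1) Z X -> hz n Z (cone f).
Proof.
move=> ZY ZX; apply: hz0_isor (cone_shift f n) _.
by apply: hz0_cone_r => //; apply/(hz_shiftr 1).
Qed.
Lemma hz_cone_l n X Y (f : cmap X Y) W : hz n Y W -> hz (n - 1) X W -> hz n (cone f) W.
Proof. by move=> YW XW; apply: hz0_cone_l => //; apply/hz_shiftl. Qed.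

(** Both sides are the total complex of the two maps into [Y], with the summands permuted. It shows
    that attaching a cone of [X] to the target of [f] amounts to attaching it to [cone f], which
    keeps cones inside a thick class. *)
Lemma cone_swap U X Y (f : cmap U Y) (g : cmap X Y) :
  hiso (cone (cmap_comp (cone_in f) g)) (cone (cmap_comp (cone_in g) f)).
Proof.
pose s U X (f : cmap U Y) (g : cmap X Y) i :
    {linear cone (cmap_comp (cone_in f) g) i -> cone (cmap_comp (cone_in g) f) i} :=
  pair_lin (fst_lin (U (i + 1)) (Y i) \o snd_lin (X (i + 1)) (U (i + 1)%R * Y i)%type)
    (pair_lin (fst_lin (X (i + 1)) (U (i + 1)%R * Y i)%type)
     (snd_lin (U (i + 1)) (Y i) \o snd_lin (X (i + 1)) (U (i + 1)%R * Y i)%type)).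
have sE V W (f' : cmap V Y) (g' : cmap W Y) i p : s V W f' g' i p = (p.2.1, (p.1, p.2.2)).
  by rewrite !pair_linE.
have sC V W (f' : cmap V Y) (g' : cmap W Y) i j p : j = i + 1 ->
    s V W f' g' j (cdiff (cone (cmap_comp (cone_in f') g')) i j p)
    = cdiff (cone (cmap_comp (cone_in g') f')) i j (s V W f' g' i p).
  move=> ji; subst j; rewrite !coneE // !sE /= ?coneE //= !trid (cone_inE f') (cone_inE g') /=.
  by apply: pairE => /=; rewrite ?add0r //; apply: pairE; rewrite /= ?add0r // addrCA.
by apply: (hiso_strict (f := mkcmap (sC U X f g)) (g := mkcmap (sC X U g f)));
  move=> i [x [y z]] /=; rewrite !sE.
Qed.

Section SumMaps.
Variables X Y : complex A.
Fact csum_in1_comm i j x : j = i + 1 ->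
  inl_lin (X j) (Y j) (cdiff X i j x) = cdiff (csum X Y) i j (inl_lin (X i) (Y i) x).
Proof. by rewrite !inl_linE /= /csum_diff_fun /= linear0. Qed.
Definition csum_in1 : cmap X (csum X Y) := @mkcmap A X (csum X Y) _ csum_in1_comm.
Fact csum_in2_comm i j x : j = i + 1 ->
  inr_lin (X j) (Y j) (cdiff Y i j x) = cdiff (csum X Y) i j (inr_lin (X i) (Y i) x).
Proof. by rewrite !inr_linE /= /csum_diff_fun /= linear0. Qed.
Definition csum_in2 : cmap Y (csum X Y) := @mkcmap A Y (csum X Y) _ csum_in2_comm.
Fact csum_out1_comm i j p : j = i + 1 ->
  fst_lin (X j) (Y j) (cdiff (csum X Y) i j p) = cdiff X i j (fst_lin (X i) (Y i) p).
Proof. by []. Qed.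
Definition csum_out1 : cmap (csum X Y) X := @mkcmap A (csum X Y) X _ csum_out1_comm.
Fact csum_out2_comm i j p : j = i + 1 ->
  snd_lin (X j) (Y j) (cdiff (csum X Y) i j p) = cdiff Y i j (snd_lin (X i) (Y i) p).
Proof. by []. Qed.
Definition csum_out2 : cmap (csum X Y) Y := @mkcmap A (csum X Y) Y _ csum_out2_comm.
Lemma csum_in1E i x : csum_in1 i x = (x, 0). Proof. exact: inl_linE. Qed.
Lemma csum_in2E i x : csum_in2 i x = (0, x). Proof. exact: inr_linE. Qed.

Lemma csum_out1_in1 : cmap_comp csum_out1 csum_in1 = cmap_id X.
Proof. by apply/cmapP => i x /=; rewrite csum_in1E. Qed.
Lemma csum_out2_in2 : cmap_comp csum_out2 csum_in2 = cmap_id Y.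
Proof. by apply/cmapP => i x /=; rewrite csum_in2E. Qed.
Lemma csum_out1_in2 : cmap_comp csum_out1 csum_in2 = 0.
Proof. by apply/cmapP => i x /=; rewrite csum_in2E. Qed.
Lemma csum_out2_in1 : cmap_comp csum_out2 csum_in1 = 0.
Proof. by apply/cmapP => i x /=; rewrite csum_in1E. Qed.
Lemma csum_in_out :
  cmap_comp csum_in1 csum_out1 + cmap_comp csum_in2 csum_out2 = cmap_id (csum X Y).
Proof.
apply/cmapP => i p; rewrite cmapD /= csum_in1E csum_in2E.
by apply: pairE; rewrite /= ?addr0 ?add0r.
Qed.
End SumMaps.

(** A direct sum in the homotopy category, given by biproduct identities: these can be verified from
    the four maps alone and are preserved by additive functors. *)
Definition isum W X Y := exists (i1 : cmap X W) (i2 : cmap Y W) (p1 : cmap W X) (p2 : cmap W Y),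
  [/\ cmap_comp p1 i1 ~ cmap_id X, cmap_comp p2 i2 ~ cmap_id Y,
      nullh (cmap_comp p1 i2), nullh (cmap_comp p2 i1) &
      cmap_comp i1 p1 + cmap_comp i2 p2 ~ cmap_id W].

Lemma isumP W X Y : isum W X Y <-> hiso W (csum X Y).
Proof.
split=> [[i1 [i2 [p1 [p2 [e1 e2 z1 z2 e]]]]] | /hisoP[f [g [gf fg]]]].
  apply/hisoP.
  exists (cmap_comp (csum_in1 X Y) p1 + cmap_comp (csum_in2 X Y) p2).
  exists (cmap_comp i1 (csum_out1 X Y) + cmap_comp i2 (csum_out2 X Y)); split.
    rewrite !comp_cmapDr !comp_cmapDl -!comp_cmapA.
    rewrite !(comp_cmapA (csum_out1 X Y)) !(comp_cmapA (csum_out2 X Y)).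
    rewrite csum_out1_in1 csum_out1_in2 csum_out2_in1 csum_out2_in2 !comp_1cmap.
    have z U V (h : cmap U V) T : cmap_comp (0 : cmap V T) h = 0 by exact/cmapP.
    have z' U V (h : cmap U V) T : cmap_comp h (0 : cmap T U) = 0.
      by apply/cmapP => ? ? /=; rewrite linear0.
    by rewrite !z !z' addr0 add0r.
  rewrite !comp_cmapDr !comp_cmapDl -!comp_cmapA.
  rewrite !(comp_cmapA p1) !(comp_cmapA p2) -(csum_in_out X Y).
  apply: heqD.
    rewrite -[X in _ ~ X]addr0; apply: heqD.
      apply: heq_comp (heq_refl _) _.
      by rewrite -[X in _ ~ X]comp_1cmap; apply: heq_comp (heq_refl _).
    by apply/heq0; apply: nullh_compl; apply: nullh_compr.
  rewrite -[X in _ ~ X]add0r; apply: heqD.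
    by apply/heq0; apply: nullh_compl; apply: nullh_compr.
  apply: heq_comp (heq_refl _) _.
  by rewrite -[X in _ ~ X]comp_1cmap; apply: heq_comp (heq_refl _).
have mid U V (a : cmap U (csum X Y)) (b : cmap (csum X Y) V) :
    cmap_comp (cmap_comp b f) (cmap_comp g a) ~ cmap_comp b a.
  rewrite -comp_cmapA (comp_cmapA f).
  apply: heq_comp (heq_refl _) _.
  by rewrite -[X in _ ~ X]comp_1cmap; apply: heq_comp (heq_refl _).
exists (cmap_comp g (csum_in1 X Y)), (cmap_comp g (csum_in2 X Y)).
exists (cmap_comp (csum_out1 X Y) f), (cmap_comp (csum_out2 X Y) f); split.
- by rewrite -(csum_out1_in1 X Y); apply: mid.
- by rewrite -(csum_out2_in2 X Y); apply: mid.
- by apply: heq_nullh (mid _ _ _ _) _; rewrite csum_out1_in2; apply: nullh0.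
- by apply: heq_nullh (mid _ _ _ _) _; rewrite csum_out2_in1; apply: nullh0.
rewrite !comp_cmapA -!(comp_cmapA g) -comp_cmapDr -comp_cmapDl csum_in_out.
by rewrite comp_1cmap.
Qed.

Lemma hz_csuml n X Y W : hz n (csum X Y) W -> hz n X W.
Proof.
apply: (@hz0_retl _ _ _ _ (csum_in1 X Y) (csum_out1 X Y)).
by rewrite csum_out1_in1; apply: heq_refl.
Qed.

(** The shear [(x, y) |-> (x, y + h x)] by a null-homotopy [h] removes [f] from the differential of
    the cone. *)
Lemma cone_null X Y (f : cmap X Y) : nullh f -> hiso (cone f) (csum (shift X 1) Y).
Proof.
move=> [h hE].
pose b (s : int) i : {linear (X (i + 1)%R * Y i)%type -> (X (i + 1)%R * Y i)%type} :=
  pair_lin (fst_lin (X (i + 1)) (Y i))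
   (snd_lin (X (i + 1)) (Y i) \+ lscale (h (i + 1) i \o fst_lin (X (i + 1)) (Y i)) s).
have bE s i p : b s i p = (p.1, p.2 + h (i + 1) i p.1 *~ s).
  by rewrite pair_linE /= lscaleE.
have bb s t i p : s + t = 0 -> b s i (b t i p) = p.
  move=> st; rewrite !bE /= -addrA -mulrzDr.
  by rewrite [t + s]addrC st mulr0z addr0; case: p.
have fE i x : f (i + 1) x = cdiff Y i (i + 1) (h (i + 1) i x)
    + h (i + 1 + 1) (i + 1) (cdiff X (i + 1) (i + 1 + 1) x) by exact: hE.
have C i j p : j = i + 1 ->
   b (-1) j (cdiff (csum (shift X 1) Y) i j p) = cdiff (cone f) i j (b (-1) i p).
  move=> ji; subst j; rewrite coneE // !bE /= shiftE sg1 !mulrN1z trid.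
  apply: pairE => //=; rewrite fE linearN opprK linearD linearN /=.
  by rewrite [RHS]addrC addrA subrK.
have C' i j p : j = i + 1 ->
   b 1 j (cdiff (cone f) i j p) = cdiff (csum (shift X 1) Y) i j (b 1 i p).
  move=> ji; rewrite -{1}[p](@bb (-1) 1) ?addNr //.
  by rewrite -C // bb ?subrr.
by apply: (hiso_strict (f := @mkcmap _ (cone f) (csum (shift X 1) Y) _ C')
    (g := @mkcmap _ (csum (shift X 1) Y) (cone f) _ C)) => i p; apply: bb.
Qed.
End Triangles.

(** * Perfect complexes in the derived category *)

Section RowLin.
Variables (R : pzRingType) (M : lmodType R) (n : nat) (e : 'I_n -> M).
Fact rowlin_linear : linear (fun v : 'rV[R]_n => \sum_(i < n) v 0 i *: e i).
Proof.
move=> a u v; rewrite scaler_sumr -big_split; apply: eq_bigr => i _ /=.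
by rewrite !mxE scalerDl scalerA.
Qed.
Definition rowlin := mklin rowlin_linear.
Lemma rowlinE v : rowlin v = \sum_(i < n) v 0 i *: e i.
Proof. exact: mklinE. Qed.
End RowLin.

Lemma row_delta (R : pzRingType) n (v : 'rV[R]_n) : v = \sum_(i < n) v 0 i *: delta_mx 0 i.
Proof.
apply/rowP => j; rewrite summxE (bigD1 j) //= !mxE !eqxx mulr1 big1 ?addr0 // => i ij.
by rewrite !mxE eqxx eq_sym (negPf ij) mulr0.
Qed.
Lemma lin_row (R : pzRingType) (M : lmodType R) n (f : {linear 'rV[R]_n -> M}) v :
  f v = \sum_(i < n) v 0 i *: f (delta_mx 0 i).
Proof. by rewrite {1}[v]row_delta linear_sum; apply: eq_bigr => i _; rewrite linearZ. Qed.

Section FgProj.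
Variable A : pzRingType.
Implicit Types M N P : rmodType A.

Lemma fgproj_split P : fin_generated P -> projective P ->
  exists n (p : {linear 'rV[A^c]_n -> P}) (s : {linear P -> 'rV[A^c]_n}), forall x, p (s x) = x.
Proof.
move=> [n [e eP]] pP; exists n, (rowlin e).
have [|s sE] := pP 'rV[A^c]_n P (rowlin e) idfun; last by exists s.
move=> y; have [a ->] := eP y; exists (\row_i (a i : A^c)).
by rewrite rowlinE; apply: eq_bigr => i _; rewrite mxE.
Qed.

(** Here [p] has to reach only the image of [f], which spares the construction of image submodules.
    Writing [P] as a retract of a free module reduces the lift to finitely many basis vectors. *)
Lemma fgproj_lift P M N (p : {linear M -> N}) (f : {linear P -> N}) :
  fin_generated P -> projective P -> (forall x, exists y, p y = f x) ->
  exists g : {linear P -> M}, forall x, p (g x) = f x.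
Proof.
move=> fP pP pf; have [n [q [s qs]]] := fgproj_split fP pP.
have /choice[e eE] : forall i : 'I_n, exists y, p y = f (q (delta_mx 0 i)).
  by move=> i; apply: pf.
exists (rowlin e \o s) => x /=; rewrite rowlinE linear_sum -[in RHS](qs x).
rewrite (lin_row q) linear_sum; apply: eq_bigr => i _.
by rewrite linearZ eE linearZ.
Qed.
End FgProj.

Section Derived.
Variable A : pzRingType.
Implicit Types X Y Z W : complex A.

Definition exact_at Y j := forall y : Y j, cocycle y -> coboundary y.

(** The homotopy is built by descending induction on the degree. What [f] lacks in the next degree
    is a cocycle of [Y], hence a boundary, and projectivity turns the primitives into a linear map.
    Exactness of [Y] is used only where [X] lives. *)
Lemma null_of_exact X Y (N : nat) (f : cmap X Y) :
  (forall i, fin_generated (X i) /\ projective (X i)) ->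
  (forall i, (N < `|i|)%N -> forall x : X i, x = 0) ->
  (forall j, (`|j| <= N)%N -> exact_at Y j) -> nullh f.
Proof.
move=> pX bX exY.
suff H n : exists h : forall i j, {linear X i -> Y j}, forall i j l x,
    j + 1 = i -> l = i + 1 -> N%:Z - n%:Z < i ->
    f i x = cdiff Y j i (h i j x) + h l i (cdiff X i l x).
  (* After [N + N + 1] steps all degrees above [- N - 1] are treated; in the others [X] vanishes. *)
  have [h hE] := H (N + N + 1)%N; exists h => i j l x ji li.
  have [|Ni] := ltP (N%:Z - (N + N + 1)%N%:Z) i; first exact: hE.
  by rewrite (bX i _ x) ?linear0 ?addr0 //; lia.
elim: n => [|n [h hE]].
  exists (fun i j => \0) => i j l x ji li Ni.
  by rewrite (bX i _ x) ?linear0 /= ?linear0 ?addr0; last lia.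
pose i0 := N%:Z - n%:Z.
have [Ni0|Ni0] := ltnP N `|i0|%N.
  exists h => i j l x ji li Ni; have [|ii0] := ltP i0 i; first exact: hE.
  by rewrite (bX i _ x) ?linear0 /= ?linear0 ?addr0; last lia.
pose g : {linear X i0 -> Y i0} := f i0 \- (h (i0 + 1) i0 \o cdiff X i0 (i0 + 1)).
have gE x : exists y, cdiff Y (i0 - 1) i0 y = g x.
  suff /exY[//|y ->] : cocycle (g x) by exists y.
  rewrite /cocycle /= linearB -cfunC (hE (i0 + 1) i0 (i0 + 1 + 1)) //; last by lia.
  by rewrite cdiffK linear0 addr0 subrr.
have [k kE] := fgproj_lift (pX i0).1 (pX i0).2 gE.
exists (fun i j => if i == i0 then (tr Y (i0 - 1) j \o (k \o tr X i i0) : {linear X i -> Y j}) else h i j).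
move=> i j l x ji li Ni; have l0 : (l == i0) = false by apply/eqP; lia.
rewrite l0; case: eqP => [ii0|ii0]; last by apply: hE => //; lia.
have e : j = i0 - 1 by lia.
by clear ji Ni; subst i l j; rewrite /= !trid kE /= subrK.
Qed.

Lemma quasi_iso_cone X Y (f : cmap X Y) i : quasi_iso f -> exact_at (cone f) i.
Proof.
move=> qf [x y] dxy; have : cdiff (cone f) i (i + 1) (x, y) = 0 := dxy.
rewrite coneE //= trid => -[/(congr1 -%R)].
rewrite opprK oppr0 => dx fxy.
have [w xw] : coboundary x.
  have := (qf (i + 1)).1 x 0 dx; rewrite /cohomologous !subr0; apply.
    by rewrite /cocycle /= linear0.
  rewrite linear0 subr0; exists (tr Y i (i + 1 - 1) (- y)).
  by rewrite (diff_tr _ _ (erefl _)) ?addrK // trid linearN; apply/eqP; rewrite -addr_eq0 fxy.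
have {xw} : x = cdiff X i (i + 1) (tr X (i + 1 - 1) i w).
  by rewrite (diff_tr _ _ (erefl _)) ?addrK // trid.
set z := tr X _ _ w => xz.
(* As [x = d z], the element [f z + y] is a cocycle. Surjectivity on cohomology replaces it by some
   [f u], and [u - z] corrects the first component. *)
have [u du [v uv]] : exists2 u : X i, cocycle u & cohomologous (f i u) (f i z + y).
  by apply: (qf i).2; rewrite /cocycle /= linearD -cfunC -xz fxy.
exists (tr X i (i - 1 + 1) (u - z), - v); rewrite coneE ?subrK //=.
rewrite !trid /=.
rewrite linearB du sub0r opprK -xz linearN -uv linearB; congr pair.
by rewrite opprB addrC addrA subrK addrAC subrr add0r.
Qed.

(** The cone of [s] is exact, so the identity of [X] becomes null in it and therefore factors
    through [s] up to homotopy. *)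
Lemma quasi_iso_section X Z (s : cmap Z X) : perfect X -> quasi_iso s ->
  exists t : cmap X Z, cmap_comp s t ~ cmap_id X.
Proof.
move=> [[N bX] pX] qs.
have [|b] := @cone_in_null_factor A Z X s X (cmap_id X).
  by apply: null_of_exact pX bX _ => j _; apply: quasi_iso_cone.
by move=> /heq_sym; exists b.
Qed.

Lemma heq_id_quasi_iso X (f : cmap X X) : f ~ cmap_id X -> quasi_iso f.
Proof.
move=> [h hE] i.
have fx x : cocycle x -> coboundary (f i x - x).
  move=> dx; exists (h i (i - 1) x).
  have := hE i (i - 1) (i + 1) x; rewrite cmapB /= => -> //; last by rewrite subrK.
  by rewrite dx linear0 addr0.
split=> [x x' dx dx'|y dy]; last by exists y => //; apply: fx.
move=> [u fxx]; have [[v fxv] [w fxw]] := (fx _ dx, fx _ dx').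
exists (u - v + w); rewrite linearD linearB -fxx -fxv -fxw.
by rewrite opprB [_ - _ + (x - _)]addrC !addrA !subrK.
Qed.

(** Denominators over a perfect source have sections up to homotopy, so every fraction out of [X]
    comes from a chain map. The target is arbitrary, as torsion-silting requires. *)
Lemma dhom_zeroP X Y : perfect X -> dhom_zero X Y <-> hz0 X Y.
Proof.
move=> pX; split=> [H f | H [Z s f qs]].
  have [Z [u [v [qu _ fu]]]] := H (Roof f (@cmap_id_qi _ X)).
  move: qu fu; rewrite /= comp_1cmap => qu /homotopicP fu.
  have [t ut] := quasi_iso_section pX qu.
  have f0 : nullh (cmap_comp f u).
    apply: heq_nullh fu _; have -> : cmap_comp (cmap0 X Y) v = 0 by apply/cmapP.
    exact: nullh0.
  apply: (@heq_nullh _ _ _ _ (cmap_comp (cmap_comp f u) t)).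
    by rewrite -comp_cmapA -{1}[f]comp_cmap1; apply: heq_comp (heq_refl _) (heq_sym _).
  exact: nullh_compr.
have [t st] := quasi_iso_section pX qs.
exists X, t, (cmap_id X) => /=; split.
- exact: heq_id_quasi_iso.
- by apply/homotopicP; rewrite comp_cmap1.
apply/homotopicP; have -> : cmap_comp (cmap0 X Y) (cmap_id X) = 0 by apply/cmapP.
by apply/heq0; apply: H.
Qed.
End Derived.

Section FreeRank1.
Variable A : pzRingType.
Implicit Types X Y Z W C T S : complex A.

Lemma fg_row n : @fin_generated A 'rV[A^c]_n.
Proof.
exists n, (fun i => delta_mx 0 i) => x; exists (fun i => x 0 i); exact: row_delta.
Qed.
Lemma proj_row n : @projective A 'rV[A^c]_n.
Proof.
move=> M N p f p_surj.
have /choice[e eE] : forall i : 'I_n, exists y, p y = f (delta_mx 0 i) by move=> i.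
exists (rowlin e) => x; rewrite rowlinE linear_sum lin_row.
by apply: eq_bigr => i _; rewrite linearZ eE.
Qed.

(** The ring placed in degree 0: the boolean [i == 0], read as a number, is the rank in degree
    [i]. *)
Definition free1 : complex A :=
  @Complex A (fun i => 'rV[A^c]_(i == 0)) (fun i j => \0)
    (fun i j _ x => erefl) (fun i j l x => erefl).

Lemma perfect_free1 : perfect free1.
Proof.
split=> [|i]; last by split; [apply: fg_row | apply: proj_row].
exists 0%N => i i0 x; apply/rowP => -[m /= mi]; exfalso.
by have e : (i == 0) = false by [lia]; rewrite e in mi.
Qed.

(** A cocycle [z] of degree [j] is the image of 1 under a chain map from [free1] to the shift of
    [C]; a null-homotopy of this map, evaluated at 1, is a primitive of [z] up to sign. *)
Lemma exact_of_hz j C : hz j free1 C -> exact_at C j.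
Proof.
move=> H z dz.
pose f i : {linear free1 i -> shift C j i} :=
  @rowlin A^c (C (i + j)) (i == 0) (fun=> tr C j (i + j) z).
have fC i l v : l = i + 1 -> f l (cdiff free1 i l v) = cdiff (shift C j) i l (f i v).
  move=> li; rewrite /f /= linear0 rowlinE linear_sum big1 // => -[m mi] _.
  rewrite linearZ /= shiftE.
  have i0 : i = 0 by apply/eqP; case: eqP mi.
  subst i; rewrite (diff_tr z (esym (add0r j)) (erefl _)) trid.
  have -> : cdiff C j (l + j) z = 0.
    by have -> : l + j = j + 1 by [rewrite li add0r addrC]; exact: dz.
  by rewrite mul0rz scaler0.
have [h hE] := H (mkcmap fC).
have := hE 0 (-1) 1 (const_mx 1) (addNr 1) (esym (add0r 1)).
rewrite /= linear0 addr0 rowlinE big_ord1 mxE scale1r shiftE => e.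
exists (tr C (-1 + j) (j - 1) (h 0 (-1) (const_mx 1)) *~ sg j).
rewrite lin_mulz (diff_tr _ (addrC _ _) (add0r j)) -(lin_mulz (tr C (0 + j) j)).
by rewrite -e trK // add0r.
Qed.

(** Each closure property combines finitely many of the bounds [M], so eventual vanishing is a thick
    condition. The bound may depend on the shift [i]. *)
Lemma thick_eventually_hz (C : nat -> complex A) :
  thick (fun Z => perfect Z /\ forall i, exists M : nat, forall m, (M <= m)%N -> hz i Z (C m)).
Proof.
split.
- by move=> X [].
- move=> X Y [pX HX] pY XY; split=> // i.
  by have [M HM] := HX i; exists M => m /HM; apply: hz_isol.
- move=> X n [pX HX]; split=> [|i]; first exact: perfect_shift.
  by have [M HM] := HX (i - n); exists M => m /HM H; apply/hz_shiftl.
- move=> X Y f [pX HX] [pY HY]; split=> [|i]; first exact: perfect_cone.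
  have [[M HM] [M' HM']] := (HX (i - 1), HY i); exists (maxn M M') => m.
  by rewrite geq_max => /andP[/HM ? /HM' ?]; apply: hz_cone_l.
- move=> X Y pX pY [_ H]; split=> // i.
  by have [M HM] := H i; exists M => m /HM; apply: hz_csuml.
Qed.

Lemma silting_eventually_exact T (C : nat -> complex A) : silting T ->
  (forall i, exists M : nat, forall m, (M <= m)%N -> hz i T (C m)) ->
  forall j, exists M : nat, forall m, (M <= m)%N -> exact_at (C m) j.
Proof.
move=> [[pT _] gT] TC j.
have [] := gT _ (thick_eventually_hz C) _ _ perfect_free1; first by split.
by move=> _ /(_ j)[M HM]; exists M => m /HM; apply: exact_of_hz.
Qed.

(** Applied to the constant sequence [S], detection makes [S] exact, and the empty sum witnesses the
    radical condition. *)
Lemma silting_torsion_silting T : silting T -> torsion_silting T.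
Proof.
move=> sT; have [pT _] := sT; split=> // S TS i z dz.
have [|M /(_ M (leqnn M)) eS] := @silting_eventually_exact T (fun=> S) sT _ i.
  move=> l; exists 0%N => _ _; rewrite -[l]opprK -sub0r; apply/hz_shiftl/hz_0.
  by apply/(dhom_zeroP _ (perfect_shift _ pT.1)).
exists 0%N, (fun=> 0), (fun=> 0); split=> [[]//|[]//|].
by rewrite big_ord0 /cohomologous subr0; apply: eS.
Qed.
End FreeRank1.

(** * Finiteness *)

Section Noetherian.
Variable K : comNzRingType.

Definition principal_ideals := forall I : set K,
  I 0 -> (forall x y, I x -> I y -> I (x + y)) -> (forall c x, I x -> I (c * x)) ->
  exists2 g, I g & forall x, I x -> exists c, x = c * g.

(** The coefficients of the first generator [e] occurring in [N] form an ideal. One element of [N]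
    realizing a generator of this ideal reduces [N] to its part inside the span of the remaining
    generators. *)
Lemma submod_fg (V : lmodType K) (s : seq V) (N : set V) : principal_ideals ->
  submod N -> (forall x, N x -> span s x) ->
  exists2 t : seq V, {in t, forall y, N y} & forall x, N x -> span t x.
Proof.
move=> pK; elim: s N => [|e s IH] N sN Ns; first by exists [::].
have [s0 sD sZ] := span_submod s; have [N0 ND NZ] := sN.
pose I : set K := [set c | exists2 y, span s y & N (c *: e + y)].
have [| |c x|g [y sy Ny] Ig] := pK I.
- by exists 0 => //; rewrite scale0r addr0.
- move=> c d [y sy Ny] [z sz Nz]; exists (y + z); first exact: sD.
  by rewrite scalerDl addrACA; apply: ND.
- move=> [y sy Ny]; exists (c *: y); first exact: sZ.
  by rewrite -scalerA -scalerDr; apply: NZ.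
have [|t tN tS] := IH (fun x => span s x /\ N x) _ (fun x => @proj1 _ _).
  by split=> [|u v [? ?] [? ?]|a u [? ?]]; split; auto.
exists (g *: e + y :: t) => [z|x Nx].
  by rewrite inE => /orP[/eqP->//|/tN[]].
have [c [z [sz xE]]] := Ns x Nx.
have [|d cd] := Ig c; first by exists z => //; rewrite -xE.
exists d, (x - d *: (g *: e + y)); split; last by rewrite subrKC.
apply: tS; split; last by apply: submodB => //; apply: NZ.
rewrite xE cd scalerDr scalerA opprD addrACA subrr add0r.
by apply: (submodB (span_submod s)) => //; apply: sZ.
Qed.

(** Modulo [N], a generator [e] satisfies [e = a c e + y] with [y] in the span of the other
    generators; as [1 - a c] is invertible, [e] can be eliminated. *)
Lemma nakayama (V : lmodType K) (a : K) (s : seq V) (M N : set V) :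
  (forall c, exists d, d * (1 - a * c) = 1) -> submod N ->
  {in s, forall e, M e} -> (forall v, M v -> span s v) ->
  (forall v, M v -> exists n v', [/\ N n, M v' & v = n + a *: v']) ->
  forall v, M v -> N v.
Proof.
move=> ua sN sM Ms NV.
have [N0 ND NZ] := sN.
(* The induction runs on the statement that [s] spans [M] modulo [N], since the exact spanning
   hypothesis is lost when a generator is dropped. *)
suff: forall v, M v -> exists n y, [/\ N n, span s y & v = n + y].
  elim: s {Ms} sM => [_ H v /H|e s IH sM H].
    by move=> [n [y [Nn -> ->]]]; rewrite addr0.
  have [s0 sD sZ] := span_submod s.
  have [n [y [Nn sy eE]]] : exists n y, [/\ N n, span s y & e = n + y].
    have [n [v' [Nn Mv' eE]]] := NV e (sM e (mem_head _ _)).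
    have [n' [_ [Nn' [c [y [sy ->]]] v'E]]] := H v' Mv'.
    have [d dE] := ua c.
    exists (d *: (n + a *: n')), (d *: (a *: y)); split.
    - by apply/NZ/ND => //; apply: NZ.
    - by apply/sZ/sZ.
    rewrite -scalerDr -[LHS]scale1r -dE -scalerA scalerBl scale1r; congr (_ *: _).
    rewrite {1}eE v'E !scalerDr scalerA; set z := (a * c) *: e.
    by rewrite [z + _]addrC !addrA addrK.
  apply: IH => [u us|v Mv]; first by apply: sM; rewrite inE us orbT.
  have [n' [_ [Nn' [c [y' [sy' ->]]] ->]]] := H v Mv.
  exists (n' + c *: n), (c *: y + y'); split.
  - by apply: ND => //; apply: NZ.
  - by apply: sD => //; apply: sZ.
  by rewrite {1}eE scalerDr !addrA.
by move=> v Mv; exists 0, v; rewrite add0r; split=> //; apply: Ms.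
Qed.
End Noetherian.

Section Central.
Variables (A : pzRingType) (K : comNzRingType) (rho : {rmorphism K -> A}).
Hypothesis rhoC : forall c a, rho c * a = a * rho c.
Implicit Types (M : rmodType A) (X Y : complex A).

(** The phantom argument [rhoC] lets the instances below depend on the
centrality of [rho]. *)
Definition kmod M : Type := (fun _ : forall c a, rho c * a = a * rho c => M : Type) rhoC.
HB.instance Definition _ M := GRing.Zmodule.on (kmod M).

Definition kmod_scale M (c : K) (x : kmod M) : kmod M := (rho c : A^c) *: (x : M).
Fact kmod_scaleA M a b (x : kmod M) : kmod_scale a (kmod_scale b x) = kmod_scale (a * b) x.
Proof. by rewrite /kmod_scale scalerA mulrC rmorphM. Qed.
Fact kmod_scale1 M : left_id 1 (@kmod_scale M).
Proof. by move=> x; rewrite /kmod_scale rmorph1 scale1r. Qed.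
Fact kmod_scaleDr M : right_distributive (@kmod_scale M) +%R.
Proof. by move=> a x y; rewrite /kmod_scale scalerDr. Qed.
Fact kmod_scaleDl M x : {morph (@kmod_scale M)^~ x : a b / a + b}.
Proof. by move=> a b; rewrite /kmod_scale rmorphD scalerDl. Qed.
HB.instance Definition _ M := GRing.Zmodule_isLmodule.Build K (kmod M)
  (@kmod_scaleA M) (@kmod_scale1 M) (@kmod_scaleDr M) (@kmod_scaleDl M).

Lemma kmodZ M c (x : kmod M) : c *: x = (rho c : A^c) *: (x : M).
Proof. by []. Qed.

Definition kfinite := exists n (e : 'I_n -> A), forall a, exists c : 'I_n -> K,
  a = \sum_(i < n) rho (c i) * e i.

Lemma kmod_fg M : kfinite -> fin_generated M -> exists t : seq (kmod M), forall x, span t x.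
Proof.
move=> [n [e eA]] /fgP[s sM].
pose t : seq (kmod M) := [seq ((e i : A^c) *: (y : M) : kmod M) | y <- s, i <- enum 'I_n].
exists t => x; have [t0 tD tZ] := span_submod t.
have : {subset s <= s} by [].
elim: {1 2}s x (sM x) => [|y s' IH] x /=; first by move=> ->.
move=> [a [z [sz ->]]] ss; apply: tD; last first.
  by apply: IH sz _ => u us; apply: ss; rewrite inE us orbT.
have [c ->] := eA a.
have -> : ((\sum_(i < n) rho (c i) * e i : A^c) *: y : kmod M)
    = \sum_(i < n) c i *: ((e i : A^c) *: y : kmod M).
  rewrite scaler_suml; apply: eq_bigr => i _.
  by rewrite kmodZ scalerA rhoC.
apply: submod_sum => [|i _]; first exact: span_submod.
apply/tZ/span_mem/allpairsP; exists (y, i); split=> //=; last exact: mem_enum.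
by apply: ss; rewrite inE eqxx.
Qed.

Definition kcmap (X Y : complex A) : Type :=
  (fun _ : forall c a, rho c * a = a * rho c => cmap X Y : Type) rhoC.
HB.instance Definition _ X Y := GRing.Zmodule.on (kcmap X Y).

Section Cscale.
Variables (X Y : complex A) (c : K) (f : cmap X Y).
Fact cscale_linear i : linear (fun x => (rho c : A^c) *: f i x).
Proof. by move=> a x y; rewrite linearP scalerDr !scalerA /= -[_ * _](rhoC c a). Qed.
Fact cscale_comm i j x :
  mklin (@cscale_linear j) (cdiff X i j x) = cdiff Y i j (mklin (@cscale_linear i) x).
Proof. by rewrite !mklinE cfunC linearZ. Qed.
Definition cscale : kcmap X Y := CMap cscale_comm.
Lemma cscaleE i x : (cscale : cmap X Y) i x = (rho c : A^c) *: f i x.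
Proof. exact: mklinE. Qed.
End Cscale.

Fact cscaleA X Y a b (f : kcmap X Y) : cscale a (cscale b f) = cscale (a * b) f.
Proof. by apply/cmapP => i x; rewrite !cscaleE scalerA mulrC rmorphM. Qed.
Fact cscale1 X Y : left_id 1 (@cscale X Y : K -> kcmap X Y -> kcmap X Y).
Proof. by move=> f; apply/cmapP => i x; rewrite !cscaleE rmorph1 scale1r. Qed.
Fact cscaleDr X Y : right_distributive (@cscale X Y : K -> kcmap X Y -> kcmap X Y) +%R.
Proof. by move=> a f g; apply/cmapP => i x; rewrite !(cscaleE, cmapD) scalerDr. Qed.
Fact cscaleDl X Y (f : kcmap X Y) :
  {morph (@cscale X Y : K -> kcmap X Y -> kcmap X Y)^~ f : a b / a + b}.
Proof. by move=> a b; apply/cmapP => i x; rewrite !(cscaleE, cmapD) rmorphD scalerDl. Qed.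
HB.instance Definition _ X Y := GRing.Zmodule_isLmodule.Build K (kcmap X Y)
  (@cscaleA X Y) (@cscale1 X Y) (@cscaleDr X Y) (@cscaleDl X Y).

Lemma kcmapZ X Y c (f : kcmap X Y) i x : ((c *: f : kcmap X Y) : cmap X Y) i x
   = (rho c : A^c) *: (f : cmap X Y) i x.
Proof. exact: cscaleE. Qed.

Section Finite.
Hypothesis pK : principal_ideals K.
Hypothesis fA : kfinite.

Definition ev X Y (t : {i : int & X i}) (f : kcmap X Y) : kmod (Y (tag t)) :=
  (f : cmap X Y) (tag t) (tagged t).
Fact ev_linear X Y (t : {i : int & X i}) : linear (@ev X Y t).
Proof. by move=> a f g; rewrite /ev kmodZ -kcmapZ. Qed.

(** Induction on the evaluation points. The values of [N] at the first point form a finitely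
    generated module; subtracting preimages of its generators leads to the submodule of maps
    vanishing there, which the remaining points handle. *)
Lemma eval_fg X Y (tl : seq {i : int & X i}) (N : set (kcmap X Y)) :
  (forall i, fin_generated (Y i)) -> submod N ->
  exists2 fs : seq (kcmap X Y), {in fs, forall f, N f} &
    forall f, N f -> exists2 g, span fs g & {in tl, forall t, ev t (f - g) = 0}.
Proof.
move=> fY; elim: tl N => [|t tl IH] N sN.
  by exists [::] => // f Nf; exists 0.
have [N0 ND NZ] := sN.
pose evl := mklin (@ev_linear X Y t).
have [r rY] := kmod_fg fA (fY (tag t)).
have [|v _|us usN usS] := @submod_fg K _ r (evl @` N) pK.
- split=> [|_ _ [f Nf <-] [g Ng <-]|a _ [f Nf <-]].
  + by exists 0 => //; rewrite linear0.
  + by exists (f + g); rewrite ?linearD //; apply: ND.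
  + by exists (a *: f); rewrite ?linearZ //; apply: NZ.
- exact: rY.
have [gs gsN gsE] : exists2 gs : seq (kcmap X Y), {in gs, forall f, N f} & map evl gs = us.
  elim: us usN {usS} => [|u us IHu] usN; first by exists [::].
  have [gs gsN gsE] : exists2 gs : seq (kcmap X Y), {in gs, forall f, N f} & map evl gs = us.
    by apply: IHu => v vus; apply: usN; rewrite inE vus orbT.
  have [f Nf fE] := usN u (mem_head _ _).
  exists (f :: gs) => [g|]; last by rewrite /= fE gsE.
  by rewrite inE => /orP[/eqP->|/gsN].
pose N' : set (kcmap X Y) := [set f | N f /\ evl f = 0].
have sN' : submod N'.
  split=> [|f g [Nf f0] [Ng g0]|a f [Nf f0]]; first by rewrite /N' /= linear0.
    by split; [exact: ND | rewrite linearD f0 g0 addr0].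
  by split; [exact: NZ | rewrite linearZ f0 /= scaler0].
have [fs fsN fsS] := IH N' sN'.
exists (gs ++ fs) => [f|f Nf].
  by rewrite mem_cat => /orP[/gsN//|/fsN[]].
have [g sg fg] : exists2 g, span gs g & evl f = evl g.
  have : span (map evl gs) (evl f) by rewrite gsE; apply: usS; exists f.
  elim: {gsE gsN} gs (evl f) => [|g gs IHg] v /=; first by move=> ->; exists 0; rewrite ?linear0.
  move=> [c [y [/IHg[g' sg' ->] ->]]]; exists (c *: g + g'); last by rewrite linearP.
  by exists c, g'.
have Ng : N g by apply: span_min sg.
have [|h sh hE] := fsS (f - g).
  by split; [exact: submodB | rewrite linearB fg subrr].
exists (g + h) => [|u].
  have [_ D _] := span_submod (gs ++ fs); apply: D.
    by apply: span_sub sg => z; rewrite mem_cat => ->.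
  by apply: span_sub sh => z; rewrite mem_cat => ->; rewrite orbT.
rewrite opprD addrA inE => /orP[/eqP->|/hE//].
have [_ h0] : N' h by apply: span_min sh.
by rewrite -[LHS](mklinE (@ev_linear X Y t)) -/evl !linearB fg subrr h0 subr0.
Qed.

(** A perfect complex has finitely many generators over all degrees, so evaluation at them embeds
    the chain maps into a finite product of terms of [Y]. *)
Lemma perfect_gens X : perfect X -> exists tl : seq {i : int & X i},
  forall Y (f : cmap X Y), {in tl, forall t, f (tag t) (tagged t) = 0} -> f = 0.
Proof.
move=> [[N bX] pX].
pose s i := projT1 (cid ((fgP (X i)).1 (pX i).1)).
have sX i x : span (s i) x by rewrite /s; case: cid.
pose tl := [seq existT (fun i : int => X i : Type) (n%:Z - N%:Z) x | n <- iota 0 (N + N + 1), x <- s (n%:Z - N%:Z)].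
exists tl => Y f f0; apply/cmapP => i x.
have [Ni|iN] := ltnP N `|i|%N; first by rewrite (bX i Ni x) linear0.
apply: (span_min (N := [set x | f i x = 0])) (sX i x).
  split=> [|u v /= u0 v0|a u /= u0]; first exact: linear0.
    by rewrite linearD u0 v0 addr0.
  by rewrite linearZ u0 /= scaler0.
move=> y sy; apply: (f0 (existT (fun i : int => X i : Type) i y)).
have e : (absz (i + N%:Z))%:Z - N%:Z = i by lia.
rewrite -e in y sy *; apply/allpairsPdep; exists (absz (i + N%:Z)), y; split=> //.
by rewrite mem_iota; lia.
Qed.

Lemma cmap_fg X Y (N : set (kcmap X Y)) :
  perfect X -> (forall i, fin_generated (Y i)) -> submod N ->
  exists2 fs : seq (kcmap X Y), {in fs, forall f, N f} & forall f, N f -> span fs f.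
Proof.
move=> pX fY sN; have [tl tlX] := perfect_gens pX.
have [fs fsN fsS] := eval_fg tl fY sN; exists fs => // f /fsS[g sg fg].
by rewrite -[f](subrK g) (tlX _ _ fg) add0r.
Qed.
End Finite.
End Central.

Lemma dependent_choice_nat (T : Type) (Q : nat -> T -> Prop) :
  (exists x, Q 0%N x) -> (forall m x, Q m x -> exists y, Q m.+1 y) ->
  exists f : nat -> T, forall m, Q m (f m).
Proof.
move=> /cid[x0 Q0] st.
pose f := fix f m : {x | Q m x} :=
  if m is m'.+1 then cid (st m' (proj1_sig (f m')) (proj2_sig (f m'))) else exist _ x0 Q0.
by exists (fun m => proj1_sig (f m)) => m; apply: proj2_sig.
Qed.

Section Contractible.
Variable A : pzRingType.
Implicit Types X Y Z W C T U : complex A.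

Lemma cone_id_null X : nullh (cmap_id (cone (cmap_id X))).
Proof.
exists (fun i j => inl_lin (X (j + 1)) (X j) \o (tr X i (j + 1) \o snd_lin (X (i + 1)) (X i))).
move=> i j l p ji li; subst i l; rewrite !coneE //= !trid !inl_linE /= linear0 addr0.
by apply: pairE; rewrite /= ?addr0 // [p.1 + _]addrC addKr.
Qed.

Lemma contractible_hiso X Y : nullh (cmap_id X) -> nullh (cmap_id Y) -> hiso X Y.
Proof.
move=> X0 Y0; apply/hisoP; exists 0, 0.
by split; apply: heq_trans (heq_sym _) => //; apply/heq0 => //; apply: nullh_compl; apply: nullh0.
Qed.

Lemma bounded_hz T U : bounded T -> bounded U ->
  exists N : nat, forall n : int, N%:Z < n -> hz n T U.
Proof.
move=> [N bT] [M bU]; exists (N + M)%N => n Nn f.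
have -> : f = 0; last exact: nullh0.
apply/cmapP => i x; have [Ni|iN] := ltnP N `|i|%N; first by rewrite (bT i Ni x) linear0.
by apply: (bU (i + n)); lia.
Qed.
End Contractible.

(** * Towers of cones over a pre-silting complex *)

Section Tower.
Variables (A : pzRingType) (K : comNzRingType) (rho : {rmorphism K -> A}).
Hypothesis rhoC : forall c a, rho c * a = a * rho c.
Hypotheses (pK : principal_ideals K) (fA : kfinite rho).
Implicit Types X Y Z W C T U : complex A.

Definition pretilt T := perfect T /\ forall n : int, 0 < n -> hz n T T.

Lemma pretiltP T : pretilt T <-> presilting T.
Proof.
split=> -[pT HT]; split=> // n n0; first by apply/(dhom_zeroP _ pT); apply: HT.
by have /(dhom_zeroP _ pT) := HT n n0.
Qed.

Lemma pretilt_shift T n : pretilt T -> pretilt (shift T n).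
Proof.
by move=> [pT HT]; split=> [|l l0]; [exact: perfect_shift | apply/hz_shift; exact: HT].
Qed.

(** Factorization through a finite sum of copies of [T], encoded by the list of components so that
    the sum need not be formed. *)
Definition factors_through T Z C (f : cmap Z C) :=
  exists s : seq (cmap T C * cmap Z T), f ~ \sum_(p <- s) cmap_comp p.1 p.2.

Fact postcomp_linear X Y Z (g : cmap Y Z) :
  linear (fun f : kcmap rhoC X Y => cmap_comp g f : kcmap rhoC X Z).
Proof.
move=> a f f'; apply/cmapP => i x.
rewrite -[LHS]/(g i (((a *: f : kcmap rhoC X Y) : cmap X Y) i x + (f' : cmap X Y) i x)).
rewrite kcmapZ linearP -[RHS]/(((a *: (cmap_comp g f : kcmap rhoC X Z) : kcmap rhoC X Z)
  : cmap X Z) i x + g i ((f' : cmap X Y) i x)).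
by rewrite kcmapZ.
Qed.

Lemma nullh_scale X Y c (f : kcmap rhoC X Y) : nullh f -> nullh (c *: f : kcmap rhoC X Y).
Proof.
move=> f0; have -> : (c *: f : kcmap rhoC X Y)
    = cmap_comp f ((c *: (cmap_id X : kcmap rhoC X X)) : kcmap rhoC X X) :> cmap X Y.
  by apply/cmapP => i x /=; rewrite !kcmapZ linearZ.
exact: nullh_compr.
Qed.

(** [C'] arises from [C] by attaching one cone of [T] for each generator of the
finitely generated module of maps [T -> C]. *)
Lemma cone_kill_generators T C : pretilt T -> perfect C -> (forall n : int, 0 < n -> hz n T C) ->
  exists C' (i : cmap C C'),
  [/\ perfect C', forall n : int, 0 <= n -> hz n T C',
      forall Z (f : cmap Z C), nullh (cmap_comp i f) -> factors_through T f &
      forall P, thick P -> P T -> forall U (f : cmap U C), perfect U ->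
        P (cone f) -> P (cone (cmap_comp i f))].
Proof.
move=> [pT HT] pC HC.
have [gs _ gsC] : exists2 gs : seq (kcmap rhoC T C), {in gs, forall f, setT f} &
    forall f, setT f -> span gs f.
  by apply: cmap_fg => // i; exact: (pC.2 i).1.
(* Spanning is weakened to hold up to homotopy, as only this form survives when [C] is replaced by a
   cone. *)
have {gsC} : forall f : cmap T C, exists2 g : kcmap rhoC T C, span gs g & f ~ g.
  by move=> f; exists f; [exact: gsC | exact: heq_refl].
move: {2}(size gs) (erefl (size gs)) => n; elim: n C gs pC HC => [|n IH] C [|g gs] //= pC HC.
  move=> _ gsC.
  exists C, (cmap_id C); split=> //.
  - move=> n; rewrite le_eqVlt => /orP[/eqP<-|]; last exact: HC.
    by apply/hz_0 => f; have [_ -> /heq0] := gsC f.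
  - move=> Z f; rewrite comp_1cmap => /heq0 f0; exists [::]; rewrite big_nil //.
  - by move=> P tP PT U f _; rewrite comp_1cmap.
move=> [gsn] gsC.
have [|||f|C' [i [pC' HC' iF iP]]] := IH (cone (g : cmap T C))
  [seq mklin (postcomp_linear (cone_in (g : cmap T C))) f | f <- gs].
- exact: perfect_cone.
- move=> l l0; apply: hz_cone_r; first exact: HC.
  by apply: HT; lia.
- by rewrite size_map.
(* Since [Hom(T, T[1]) = 0], each map from [T] to the cone of [g] comes from [C], where its
   component along [g] becomes null: one generator fewer is left. *)
- have [b fb] := cone_out_null_factor (HT 1 isT (cmap_comp (cone_out (g : cmap T C)) f)).
  have [_ [c [y [sy ->]]] by_] := gsC b.
  exists (cmap_comp (cone_in (g : cmap T C)) y).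
    exact: (span_map (mklin (postcomp_linear (cone_in (g : cmap T C)))) sy).
  apply: heq_trans fb _; apply: heq_trans (heq_comp (heq_refl _) by_) _.
  rewrite -[X in heq _ X]add0r comp_cmapDr; apply: heqD (heq_refl _); apply/heq0.
  have := linearZ_LR (mklin (postcomp_linear (cone_in (g : cmap T C)))) c g.
  by rewrite !mklinE => ->; apply: nullh_scale; apply: cone_in_null.
exists C', (cmap_comp i (cone_in (g : cmap T C))); split=> // [Z f|P tP PT U f pU Pf].
  rewrite -comp_cmapA => /iF[s fs].
  have lift (p : cmap T (cone (g : cmap T C))) : exists b, p ~ cmap_comp (cone_in (g : cmap T C)) b.
    exact: (cone_out_null_factor (HT 1 isT (cmap_comp (cone_out (g : cmap T C)) p))).
  have [s' fs'] : exists s' : seq (cmap T C * cmap Z T),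
     \sum_(p <- s) cmap_comp p.1 p.2
       ~ cmap_comp (cone_in (g : cmap T C)) (\sum_(p <- s') cmap_comp p.1 p.2).
    elim: s {fs} => [|[a b] s [s' IHs]].
      by exists [::]; rewrite !big_nil; apply/heq_sym/heq0; apply: nullh_compl; apply: nullh0.
    have [a' aa'] := lift a; exists ((a', b) :: s'); rewrite !big_cons comp_cmapDr.
    by apply: heqD IHs; rewrite comp_cmapA /=; apply: heq_comp (heq_refl _).
  (* What remains of [f] dies in the cone of [g], so it factors through [g] and contributes one more
     term to the list. *)
  have [|b fb] := @cone_in_null_factor _ _ _ (g : cmap T C) _ (f - \sum_(p <- s') cmap_comp p.1 p.2).
    by rewrite comp_cmapBr; exact: heq_trans fs fs'.
  exists (((g : cmap T C), b) :: s'); rewrite big_cons /=.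
  by rewrite -[f](subrK (\sum_(p <- s') cmap_comp p.1 p.2)); apply: heqD (heq_refl _).
rewrite -comp_cmapA; apply: iP => //; have [tperf tiso _ tcone _] := tP.
(* After the swap this is the cone of a map from [T] to [cone f], both of which satisfy [P]. *)
apply: tiso (cone_swap f g); last by apply: perfect_cone => //; apply: perfect_cone.
exact: tcone.
Qed.

(** A criterion for a pre-silting complex to be silting: unlike generation by a
thick subcategory, it passes through reduction modulo [X] in both directions. *)
Definition detects T := forall C : nat -> complex A, (forall m, perfect (C m)) ->
  (forall i, exists M : nat, forall m, (M <= m)%N -> hz i T (C m)) ->
  forall j, exists M : nat, forall m, (M <= m)%N -> exact_at (C m) j.

(** Only the finitely many degrees in which [Z] lives need exactness, so one index [m] serves them
    all. *)
Lemma detects_null T Z (C : nat -> complex A) : detects T -> perfect Z ->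
  (forall m, perfect (C m)) ->
  (forall i, exists M : nat, forall m, (M <= m)%N -> hz i T (C m)) ->
  exists m, hz0 Z (C m).
Proof.
move=> dT [[N bZ] pZ] pC /(dT C pC) /choice[M HM].
exists (\max_(n < N + N + 1) M (n%:Z - N%:Z)%R)%N => f.
apply: null_of_exact pZ bZ _ => j jN; apply: HM.
have jN' : (absz (j + N%:Z)%R < N + N + 1)%N by lia.
apply: leq_trans (leq_bigmax (Ordinal jN')) => /=.
by have -> : (absz (j + N%:Z))%:Z - N%:Z = j by lia.
Qed.

(** The stages approximate a complex orthogonal to all shifts of [T], but no colimit is taken. The
    third clause says that passing to a stage loses no map from an object left orthogonal to [T] in
    degrees at least 0; the fourth controls the difference between [U] and the stage. *)
Lemma tower T U : pretilt T -> perfect U -> (forall n : int, 0 < n -> hz n T U) ->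
  exists C : forall m : nat, {C : complex A & cmap U C}, forall m,
  [/\ perfect (tag (C m)), forall n : int, - m%:Z < n -> hz n T (tag (C m)),
      forall Z (f : cmap Z U), (forall n : int, 0 <= n -> hz n Z T) ->
        nullh (cmap_comp (tagged (C m)) f) -> nullh f &
      forall P, thick P -> P T -> P (cone (tagged (C m)))].
Proof.
move=> pT pU HU; have [|m [C j] /= [pC HC jF jP]|C HC] := @dependent_choice_nat {C : complex A & cmap U C} (fun (m : nat) (C : {C : complex A & cmap U C}) =>
  [/\ perfect (tag C), forall n : int, - m%:Z < n -> hz n T (tag C),
      forall Z (f : cmap Z U), (forall n : int, 0 <= n -> hz n Z T) ->
        nullh (cmap_comp (tagged C) f) -> nullh f &
      forall P, thick P -> P T -> P (cone (tagged C))]); last by exists C.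
  exists (existT (fun C => cmap U C) U (cmap_id U)); split=> //= P tP PT.
  have [_ tiso _ tcone _] := tP.
  (* The cone of the identity of [U] is contractible, hence isomorphic to that of [T], which lies in
     [P]. *)
  apply: (tiso (cone (cmap_id T))); first exact: tcone.
    exact: perfect_cone.
  by apply: contractible_hiso; apply: cone_id_null.
(* At stage [m] the shift by [m] moves the vanishing range [n > - m] to the positive degrees;
   killing degree 0 then extends the range by [- m]. *)
have [|C' [i [pC' HC' iF iP]]] := @cone_kill_generators (shift T m%:Z) C (pretilt_shift _ pT) pC.
  by move=> n n0; apply/hz_shiftl; apply: HC; lia.
exists (existT (fun C => cmap U C) C' (cmap_comp i j)); split=> //= [n nm|Z f ZT|P tP PT].
- rewrite -[n](addrK m%:Z); apply/hz_shiftl.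
  by apply: HC'; lia.
- rewrite -comp_cmapA => /iF[s fs]; apply: (jF) => //.
  apply: heq_nullh fs _; apply: nullh_sum => -[a b] _; apply: nullh_compl.
  exact: (ZT m%:Z).
apply: iP => //; last exact: jP.
by have [_ _ tsh _ _] := tP; apply: tsh.
Qed.

Lemma tower_eventually T (C : nat -> complex A) :
  (forall m (n : int), - m%:Z < n -> hz n T (C m)) ->
  forall i, exists M : nat, forall m, (M <= m)%N -> hz i T (C m).
Proof. by move=> H i; exists (`|i|.+1)%N => m Mm; apply: H; lia. Qed.

Lemma hz0_tower T U Z : pretilt T -> detects T -> perfect U -> perfect Z ->
  (forall n : int, 0 < n -> hz n T U) -> (forall n : int, 0 <= n -> hz n Z T) -> hz0 Z U.
Proof.
move=> pT dT pU pZ TU ZT f; have [C HC] := tower pT pU TU.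
have [||m ZC] := @detects_null T Z (fun m => tag (C m)) dT pZ.
- by move=> m; have [] := HC m.
- by apply: tower_eventually => m; have [] := HC m.
by have [_ _ jF _] := HC m; apply: jF.
Qed.

Lemma detects_silting T : pretilt T -> detects T -> silting T.
Proof.
move=> pT dT; split=> [|P tP PT U pU]; first exact/pretiltP.
(* Boundedness gives vanishing only beyond some [N]; shifting [U] by [N] meets the positivity
   condition of the tower, and the shift is undone at the end. *)
have [N TU] := bounded_hz pT.1.1 pU.1.
have [_ tiso tsh _ tsum] := tP.
have pU' : perfect (shift U N) by apply: perfect_shift.
have [|C HC] := tower pT pU'; first by move=> n n0; apply/hz_shiftr/TU; lia.
have [||m ZC] := @detects_null T (shift U N) (fun m => tag (C m)) dT pU'.
- by move=> m; have [] := HC m.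
- by apply: tower_eventually => m; have [] := HC m.
have [pC _ _ /(_ P tP PT) Pj] := HC m.
have PU : P (shift (shift U N) 1).
  have pU1 := perfect_shift 1 pU'.
  apply: (tsum _ (tag (C m))) => //; apply: tiso Pj _ (cone_null (ZC _)).
  exact: perfect_csum.
apply: (tiso (shift (shift (shift (shift U N) 1) (- 1)) (- N%:Z))) => //.
  by apply/tsh/tsh.
by apply: hiso_trans (hiso_shift _ (shiftNK _ _)) (shiftNK _ _).
Qed.
End Tower.

(** * Extension and restriction of scalars *)

Section Restriction.
Variables (R S : pzRingType) (phi : {rmorphism R -> S}).
Implicit Types (M : rmodType R) (N : rmodType S).

(** The phantom argument [phi] lets the module structure depend on the ring map although the
    underlying type does not. *)
Definition restr N : Type := (fun _ : {rmorphism R -> S} => N : Type) phi.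
HB.instance Definition _ N := GRing.Zmodule.on (restr N).
Definition restr_scale N (r : R^c) (x : restr N) : restr N := (phi r : S^c) *: (x : N).
Fact restr_scaleA N a b (x : restr N) :
  restr_scale a (restr_scale b x) = restr_scale (a * b) x.
Proof. by rewrite /restr_scale scalerA -[_ * _]/(phi b * phi a) -rmorphM. Qed.
Fact restr_scale1 N : left_id 1 (@restr_scale N).
Proof. by move=> x; rewrite /restr_scale rmorph1 scale1r. Qed.
Fact restr_scaleDr N : right_distributive (@restr_scale N) +%R.
Proof. by move=> a x y; rewrite /restr_scale scalerDr. Qed.
Fact restr_scaleDl N x : {morph (@restr_scale N)^~ x : a b / a + b}.
Proof. by move=> a b; rewrite /restr_scale rmorphD scalerDl. Qed.
HB.instance Definition _ N := GRing.Zmodule_isLmodule.Build R^c (restr N)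
  (@restr_scaleA N) (@restr_scale1 N) (@restr_scaleDr N) (@restr_scaleDl N).

Lemma restrZ N r (x : restr N) : r *: x = (phi r : S^c) *: (x : N).
Proof. by []. Qed.

Section RestrLin.
Variables (N N' : rmodType S) (f : {linear N -> N'}).
Fact restr_lin_linear : linear (f : restr N -> restr N').
Proof. by move=> a x y; rewrite restrZ linearP. Qed.
Definition restr_lin : {linear restr N -> restr N'} := mklin restr_lin_linear.
Lemma restr_linE x : restr_lin x = f x. Proof. exact: mklinE. Qed.
End RestrLin.

Fact crestr_shape (C : complex S) i j : j <> i + 1 -> forall x, restr_lin (cdiff C i j) x = 0.
Proof. by move=> ij x; rewrite restr_linE cdiff_shape. Qed.
Fact crestr_diffK (C : complex S) i j l x :
  restr_lin (cdiff C j l) (restr_lin (cdiff C i j) x) = 0.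
Proof. by rewrite !restr_linE cdiffK. Qed.
Definition crestr (C : complex S) : complex R :=
  @Complex R (fun i => restr (C i)) (fun i j => restr_lin (cdiff C i j))
    (@crestr_shape C) (@crestr_diffK C).
Lemma crestrE (C : complex S) i j x : cdiff (crestr C) i j x = cdiff C i j x.
Proof. exact: restr_linE. Qed.

Lemma crestr_shift (C : complex S) n : hiso (crestr (shift C n)) (shift (crestr C) n).
Proof.
have E i j x : cdiff (crestr (shift C n)) i j x = cdiff (shift (crestr C) n) i j x.
  by rewrite crestrE !shiftE crestrE.
apply: (@hiso_strict _ _ _ (@CMap _ (crestr (shift C n)) (shift (crestr C) n)
    (fun i => idfun) E) (@CMap _ (shift (crestr C) n) (crestr (shift C n))
    (fun i => idfun) (fun i j x => esym (E i j x)))) => //.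
Qed.

Lemma exact_crestr (C : complex S) j : exact_at (crestr C) j -> exact_at C j.
Proof.
move=> H z dz; have [|w zw] := H z; first by rewrite /cocycle /= restr_linE.
by exists w; rewrite zw /= restr_linE.
Qed.

Definition tens_unit_fun M (m : M) : restr (tens phi M) := tpi phi [:: (m, 1)].
Fact tens_unit_linear M : linear (@tens_unit_fun M).
Proof.
move=> a m m'; rewrite restrZ.
rewrite -[RHS]/(tens_add (tens_scale (phi a : S^c) (tens_unit_fun m)) (tens_unit_fun m')).
rewrite tpi_scale tpi_add; apply/tpi_eq.
apply: tens_trans (tens_Dl _ _ _ _) _; rewrite -cat1s; apply: tens_cat (tens_refl _ _) => /=.
by rewrite mul1r -[phi a]mulr1; apply: tens_bal.
Qed.
Definition tens_unit M := mklin (@tens_unit_linear M).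

Lemma tpi_sum M (s : seq (M * S)) :
  tpi phi s = \sum_(p <- s) (p.2 : S^c) *: (tens_unit M p.1 : tens phi M).
Proof.
elim: s => [|[m a] s IH]; first by rewrite big_nil.
rewrite big_cons -IH mklinE /= -[RHS]/(tens_add (tens_scale _ _) _) tpi_scale tpi_add.
by rewrite /= mul1r.
Qed.

Lemma tens_lin_ext M N (f g : {linear tens phi M -> N}) :
  (forall m, f (tens_unit M m) = g (tens_unit M m)) -> forall u, f u = g u.
Proof.
move=> fg u; rewrite -[u]tpi_repr tpi_sum !linear_sum; apply: eq_bigr => p _.
by rewrite !linearZ fg.
Qed.

Section Extension.
Variables (M : rmodType R) (N : rmodType S) (g : {linear M -> restr N}).
Definition tens_eval (s : seq (M * S)) : N := \sum_(p <- s) (p.2 : S^c) *: (g p.1 : N).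
Fact tens_eval_eq s t : tens_eq phi s t -> tens_eval s = tens_eval t.
Proof.
rewrite /tens_eval.
elim=> {s t} [//|s t _ -> //|t s u _ -> //|s s' t t' _ IH1 _ IH2|s t|b|m m' b|m b b'|m r b].
- by rewrite !big_cat IH1 IH2.
- by rewrite !big_cat /= addrC.
- by rewrite big_seq1 big_nil linear0 scaler0.
- by rewrite !big_cons !big_nil !addr0 linearD scalerDr.
- by rewrite !big_cons !big_nil !addr0 scalerDl.
by rewrite !big_seq1 linearZ /= restrZ scalerA.
Qed.
Definition tens_ext_fun (u : tens phi M) : N := tens_eval (repr u).
Lemma tens_ext_funE s : tens_ext_fun (tpi phi s) = tens_eval s.
Proof. exact: tens_eval_eq (repr_tpi _ _). Qed.
Fact tens_ext_linear : linear tens_ext_fun.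
Proof.
move=> a u v; rewrite -[u]tpi_repr -[v]tpi_repr.
rewrite -[a *: _ + _]/(tens_add (tens_scale _ _) _) tpi_scale tpi_add !tens_ext_funE.
rewrite /tens_eval big_cat /seq_scale big_map scaler_sumr; congr (_ + _).
by apply: eq_bigr => p _; rewrite scalerA.
Qed.
Definition tens_ext := mklin tens_ext_linear.
Lemma tens_extE m : tens_ext (tens_unit M m) = g m.
Proof. by rewrite !mklinE tens_ext_funE /tens_eval big_seq1 scale1r. Qed.
End Extension.

Lemma tens_map_unit M M' (f : {linear M -> M'}) m :
  tens_map phi f (tens_unit M m) = tens_unit M' (f m).
Proof. by rewrite !mklinE tens_mapE. Qed.

Lemma fg_tens M : fin_generated M -> fin_generated (tens phi M).
Proof.
move=> /fgP[s sM]; apply/fgP; exists (map (tens_unit M) s) => u.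
rewrite -[u]tpi_repr tpi_sum; apply: submod_sum => [|p _]; first exact: span_submod.
have [s0 sD sZ] := @span_submod S^c (tens phi M) (map (tens_unit M) s); apply: sZ.
have := span_map (tens_unit M) (sM p.1).
elim: {sM} s (tens_unit M p.1) {s0 sD} => //= m s IH x [c [y [sy ->]]].
by exists (phi c), y; split; [exact: IH | rewrite restrZ].
Qed.

Lemma proj_tens M : projective M -> projective (tens phi M).
Proof.
move=> pM P N p f p_surj.
have [y|g gE] := pM (restr P) (restr N) (restr_lin p) (restr_lin f \o tens_unit M).
  by have [x <-] := p_surj y; exists x; rewrite restr_linE.
exists (tens_ext g) => u; apply: (tens_lin_ext (f := p \o tens_ext g)) => m /=.
by have := gE m; rewrite /= !restr_linE tens_extE.
Qed.

Lemma perfect_base_change T : perfect T -> perfect (base_change phi T).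
Proof.
move=> [[N bT] pT]; split=> [|i]; last first.
  by have [? ?] := pT i; split; [apply: fg_tens | apply: proj_tens].
exists N => i Ni u; rewrite -[u]tpi_repr tpi_sum big1 // => p _.
by rewrite (bT i Ni p.1) linear0 scaler0.
Qed.

Section BaseMaps.
Implicit Types X Y : complex R.

Lemma bc_diff_unit X i j x :
  cdiff (base_change phi X) i j (tens_unit (X i) x) = tens_unit (X j) (cdiff X i j x).
Proof. exact: tens_map_unit. Qed.

Fact bc_unit_comm X i j x :
  tens_unit (X j) (cdiff X i j x) = cdiff (crestr (base_change phi X)) i j (tens_unit (X i) x).
Proof. by rewrite crestrE bc_diff_unit. Qed.
Definition bc_unit X : cmap X (crestr (base_change phi X)) :=
  @CMap R X (crestr (base_change phi X)) (fun i => tens_unit (X i)) (@bc_unit_comm X).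

Fact bc_map_comm X Y (f : cmap X Y) i j u :
  tens_map phi (f j) (cdiff (base_change phi X) i j u)
  = cdiff (base_change phi Y) i j (tens_map phi (f i) u).
Proof.
apply: (tens_lin_ext (f := tens_map phi (f j) \o tens_map phi (cdiff X i j))
  (g := tens_map phi (cdiff Y i j) \o tens_map phi (f i))) => m.
by rewrite /= !tens_map_unit cfunC.
Qed.
Definition bc_map X Y (f : cmap X Y) : cmap (base_change phi X) (base_change phi Y) :=
  @CMap S (base_change phi X) (base_change phi Y) (fun i => tens_map phi (f i))
    (@bc_map_comm X Y f).

Lemma bc_mapE X Y (f : cmap X Y) i m : bc_map f i (tens_unit (X i) m) = tens_unit (Y i) (f i m).
Proof. exact: tens_map_unit. Qed.

Lemma bc_map_ext X (C : complex S) (f g : cmap (base_change phi X) C) :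
  (forall i m, f i (tens_unit (X i) m) = g i (tens_unit (X i) m)) -> f = g.
Proof. by move=> fg; apply/cmapP => i; apply: tens_lin_ext. Qed.

Lemma bc_mapB X Y (f g : cmap X Y) : bc_map (f - g) = bc_map f - bc_map g.
Proof. by apply: bc_map_ext => i m; rewrite cmapB !bc_mapE cmapB linearB. Qed.
Lemma bc_map_comp X Y Z (g : cmap Y Z) (f : cmap X Y) :
  bc_map (cmap_comp g f) = cmap_comp (bc_map g) (bc_map f).
Proof. by apply: bc_map_ext => i m; rewrite /= !tens_map_unit. Qed.
Lemma bc_map_id X : bc_map (cmap_id X) = cmap_id _.
Proof. by apply: bc_map_ext => i m; rewrite /= !tens_map_unit. Qed.

Lemma nullh_bc X Y (f : cmap X Y) : nullh f -> nullh (bc_map f).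
Proof.
move=> [h hE]; exists (fun i j => tens_map phi (h i j)) => i j l u ji li.
apply: (tens_lin_ext (f := tens_map phi (f i)) (g :=
  (tens_map phi (cdiff Y j i) \o tens_map phi (h i j))
  \+ (tens_map phi (h l i) \o tens_map phi (cdiff X i l)))) => m.
by rewrite /= !tens_map_unit (hE i j l) // linearD.
Qed.

Lemma hiso_bc X Y : hiso X Y -> hiso (base_change phi X) (base_change phi Y).
Proof.
move=> /hisoP[f [g [gf fg]]]; apply/hisoP; exists (bc_map f), (bc_map g).
by split; rewrite -bc_map_comp -bc_map_id /heq -bc_mapB; apply: nullh_bc.
Qed.

Fact bc_ext_comm X (C : complex S) (f : cmap X (crestr C)) i j u :
  tens_ext (f j) (cdiff (base_change phi X) i j u) = cdiff C i j (tens_ext (f i) u).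
Proof.
apply: (tens_lin_ext (f := tens_ext (f j) \o tens_map phi (cdiff X i j))
  (g := cdiff C i j \o tens_ext (f i))) => m.
by rewrite /= tens_map_unit !tens_extE cfunC crestrE.
Qed.
Definition bc_ext X (C : complex S) (f : cmap X (crestr C)) : cmap (base_change phi X) C :=
  @CMap S (base_change phi X) C (fun i => tens_ext (f i)) (@bc_ext_comm X C f).
Lemma bc_extE X (C : complex S) (f : cmap X (crestr C)) i m :
  bc_ext f i (tens_unit (X i) m) = f i m.
Proof. exact: tens_extE. Qed.

Fact bc_restr_comm (C D : complex S) (f : cmap C D) i j x :
  restr_lin (f j) (cdiff (crestr C) i j x) = cdiff (crestr D) i j (restr_lin (f i) x).
Proof. by rewrite !crestrE !restr_linE cfunC. Qed.
Definition crestr_map (C D : complex S) (f : cmap C D) : cmap (crestr C) (crestr D) :=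
  @CMap R (crestr C) (crestr D) (fun i => restr_lin (f i)) (@bc_restr_comm C D f).

(** The adjunction between extension and restriction of scalars, applied to homotopies as well as to
    maps. It turns questions over the quotient ring into questions about [X] itself, with a target
    that need not be projective. *)
Lemma hz0_bc X (C : complex S) : hz0 (base_change phi X) C <-> hz0 X (crestr C).
Proof.
split=> H f.
  have [h hE] := H (bc_ext f).
  exists (fun i j => restr_lin (h i j) \o tens_unit (X i)) => i j l x ji li.
  have := hE i j l (tens_unit (X i) x) ji li.
  by rewrite bc_extE bc_diff_unit crestrE /= !restr_linE.
have [h hE] := H (cmap_comp (crestr_map f) (bc_unit X)).
exists (fun i j => tens_ext (h i j)) => i j l u ji li.
apply: (tens_lin_ext (f := f i) (g := (cdiff C j i \o tens_ext (h i j))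
  \+ (tens_ext (h l i) \o tens_map phi (cdiff X i l)))) => m.
have := hE i j l m ji li; rewrite /= !restr_linE => ->.
rewrite tens_extE -[h l i _]tens_extE; congr (_ + tens_ext _ _); exact/esym/tens_map_unit.
Qed.

Lemma hz_bc n X (C : complex S) : hz n (base_change phi X) C <-> hz n X (crestr C).
Proof.
rewrite /hz; split=> [/hz0_bc|H]; first exact: hz0_isor (crestr_shift C n).
by apply/hz0_bc; apply: hz0_isor (hiso_sym (crestr_shift C n)) H.
Qed.
End BaseMaps.
End Restriction.

(** * Power series and orders *)

Section PowerSeries.
Variable k : fieldType.
Implicit Types f g : fps k.

Lemma fps_coefD f g n : fps_coef (f + g) n = fps_coef f n + fps_coef g n.
Proof. by []. Qed.
Lemma fps_coef0 n : fps_coef (0 : fps k) n = 0.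
Proof. by rewrite /= if_same. Qed.
Lemma fps_coefN f n : fps_coef (- f) n = - fps_coef f n.
Proof. by []. Qed.
Lemma fps_coefM f g n : fps_coef (f * g) n = \sum_(i < n.+1) fps_coef f i * fps_coef g (n - i)%N.
Proof. by []. Qed.
Lemma fps_coef1 n : fps_coef (1 : fps k) n = (n == 0)%:R.
Proof. by rewrite /=; case: eqP. Qed.

Local Notation X := (fps_X k).

Lemma fps_coef_Xmul f n : fps_coef (X * f) n = if n is m.+1 then fps_coef f m else 0.
Proof.
rewrite fps_coefM; case: n => [|n]; first by rewrite big_ord1 /= mul0r.
rewrite big_ord_recl /= mul0r add0r big_ord_recl /= mul1r subn1 big1 ?addr0 // => i _.
by rewrite mul0r.
Qed.
Lemma fps_coef_Xnmul m f n : fps_coef (X ^+ m * f) n = if (n < m)%N then 0 else fps_coef f (n - m).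
Proof.
elim: m n => [|m IH] n; first by rewrite expr0 mul1r subn0.
by rewrite exprS -mulrA fps_coef_Xmul; case: n => // n; rewrite IH ltnS subSS.
Qed.
Lemma fps_dvdXn m f : (forall n, (n < m)%N -> fps_coef f n = 0) -> exists g, f = X ^+ m * g.
Proof.
move=> f0; exists (Fps (fun n => fps_coef f (n + m))); apply/fpsP => n.
by rewrite fps_coef_Xnmul; case: ltnP => [/f0|mn] //=; rewrite subnK.
Qed.
Lemma fps_X_regular f : X * f = 0 -> f = 0.
Proof.
move=> f0; apply/fpsP => n; rewrite fps_coef0.
by have := fps_coef_Xmul f n.+1; rewrite f0 fps_coef0.
Qed.
Lemma fps_separated f : (forall n, exists g, f = X ^+ n * g) -> f = 0.
Proof.
by move=> fX; apply/fpsP => n; have [g ->] := fX n.+1; rewrite fps_coef_Xnmul ltnSn fps_coef0.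
Qed.

(** The convergent sum of the [X^i u_i]: only the indices [i <= n] contribute to the coefficient of
    degree [n]. *)
Definition fps_series (u : nat -> fps k) : fps k :=
  Fps (fun n => \sum_(i < n.+1) fps_coef (u i) (n - i)%N).
Lemma fps_seriesS u : fps_series u = u 0%N + X * fps_series (fun i => u i.+1).
Proof.
apply/fpsP => n; rewrite fps_coefD fps_coef_Xmul /= big_ord_recl subn0; congr (_ + _).
case: n => [|n]; first by rewrite big_ord0.
by apply: eq_bigr => i _; rewrite /= /bump /= subSS.
Qed.
Lemma fps_seriesE u n : fps_series u
  = \sum_(i < n) X ^+ i * u i + X ^+ n * fps_series (fun i => u (n + i)%N).
Proof.
elim: n => [|n IH]; first by rewrite big_ord0 add0r expr0 mul1r.
rewrite IH big_ord_recr /= -addrA; congr (_ + _).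
rewrite fps_seriesS mulrDr addn0 exprSr -mulrA; congr (_ + _ * (_ * _)).
by congr fps_series; apply/funext => i; rewrite addnS.
Qed.

(** The inverse is the geometric series in [X c]; the identity is checked modulo each power of [X],
    where the series becomes a finite sum. *)
Lemma fps_1BX_unit c : exists d : fps k, d * (1 - X * c) = 1.
Proof.
exists (fps_series (fun i => c ^+ i)); apply/eqP; rewrite -subr_eq0; apply/eqP.
apply: fps_separated => n; rewrite (fps_seriesE _ n); set t := fps_series _.
exists (t * (1 - X * c) - c ^+ n); rewrite [RHS]mulrBr [_ * (t * _)]mulrA mulrDl addrAC addrC; congr (_ + _).
have -> : \sum_(i < n) X ^+ i * c ^+ i = \sum_(i < n) (X * c) ^+ i.
  by apply: eq_bigr => i _; rewrite exprMn.
have -> : (\sum_(i < n) (X * c) ^+ i) * (1 - X * c) = - ((X * c) ^+ n - 1).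
  by rewrite subrX1 -[RHS]mulNr opprB mulrC.
by rewrite exprMn opprB addrAC subrr add0r.
Qed.

Lemma fps_unit f : fps_coef f 0 != 0 -> exists g, g * f = 1.
Proof.
move=> f0; pose a := fps_coef f 0.
have [|c cE] := @fps_dvdXn 1 (1 - fps_const a^-1 * f).
  move=> n; rewrite ltnS leqn0 => /eqP->.
  by rewrite fps_coefD fps_coef1 fps_coefN fps_coefM big_ord1 /= mulVf ?subrr.
have [d] := fps_1BX_unit c; rewrite -[X * c]/(X ^+ 1 * c) -cE subKr mulrA.
by exists (d * fps_const a^-1).
Qed.

(** An element of least order in [I] is a power of [X] times a unit, and this power divides every
    element of [I]. *)
Lemma fps_principal : principal_ideals (fps k).
Proof.
move=> I I0 ID IM.
have [[f0 If0 f0N]|nI] := pselect (exists2 f, I f & f <> 0); last first.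
  exists 0 => // f If; exists 0; rewrite mul0r.
  by apply: contrapT => f0; apply: nI; exists f.
pose P m := `[< exists2 f, I f & fps_coef f m != 0 >].
have exP : exists m, P m.
  apply: contrapT => nP; apply: f0N; apply/fpsP => n; rewrite fps_coef0.
  apply/eqP/negPn/negP => fn; apply: nP; exists n; apply/asboolP.
  by exists f0.
case: (ex_minnP exP) => m /asboolP[g Ig gm] mmin.
have div f : I f -> exists f', f = X ^+ m * f'.
  move=> If; apply: fps_dvdXn => n nm; apply/eqP/negPn/negP => fn.
  have /mmin : P n by apply/asboolP; exists f.
  by rewrite leqNgt nm.
have [g' gE] := div g Ig.
have [|h hE] := @fps_unit g'; first by move: gm; rewrite gE fps_coef_Xnmul ltnn subnn.
exists g => // f /div[f' ->]; exists (f' * h).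
by rewrite gE -mulrA [h * _]mulrCA hE mulr1 mulrC.
Qed.

Lemma field_principal : principal_ideals k.
Proof.
move=> I I0 ID IM.
have [[g Ig g0]|nI] := pselect (exists2 g, I g & g != 0).
  by exists g => // x _; exists (x / g); rewrite divfK.
exists 0 => // x Ix; exists 0; rewrite mul0r; apply/eqP/negPn/negP => x0.
by apply: nI; exists x.
Qed.

Fact fps_const_additive : zmod_morphism (@fps_const k).
Proof. by move=> a b; apply/fpsP => -[|n] //=; rewrite subrr. Qed.
Fact fps_const_multiplicative : monoid_morphism (@fps_const k).
Proof.
split=> // a b; apply/fpsP => n; rewrite fps_coefM big_ord_recl /= subn0.
rewrite big1 => [|i _]; last by rewrite mul0r.
by rewrite addr0; case: n => // n; rewrite mulr0.
Qed.
HB.instance Definition _ := GRing.isZmodMorphism.Build k (fps k) (@fps_const k) fps_const_additive.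
HB.instance Definition _ := GRing.isMonoidMorphism.Build k (fps k) (@fps_const k)
  fps_const_multiplicative.
Lemma fps_split f : exists g, f = fps_const (fps_coef f 0) + X * g.
Proof.
have [|g gE] := @fps_dvdXn 1 (f - fps_const (fps_coef f 0)).
  by move=> n; rewrite ltnS leqn0 => /eqP->; rewrite fps_coefD fps_coefN subrr.
by exists g; rewrite -[X]expr1 -gE subrKC.
Qed.
End PowerSeries.

Section Adic.
Variable k : fieldType.
Local Notation X := (fps_X k).
Implicit Types V W : lmodType (fps k).

(** Torsion-free, separated and complete for the powers of [X]. Completeness is stated for series
    [X^i u_i], which is the form produced by successive approximation and passes to retracts. *)
Definition adic V :=
  [/\ forall v : V, X *: v = 0 -> v = 0,
      forall v : V, (forall n, exists w, v = X ^+ n *: w) -> v = 0 &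
      forall u : nat -> V, exists s, forall n, exists w,
        s = \sum_(i < n) X ^+ i *: u i + X ^+ n *: w].

Lemma adic_retract V W (a : {linear W -> V}) (b : {linear V -> W}) :
  (forall w, b (a w) = w) -> adic V -> adic W.
Proof.
move=> ba [r s c]; split=> [w w0|w wX|u].
- by rewrite -[w]ba (r (a w)) ?linear0 // -linearZ w0 linear0.
- rewrite -[w]ba (s (a w)) ?linear0 // => n; have [v ->] := wX n.
  by exists (a v); rewrite linearZ.
have [t tE] := c (fun i => a (u i)); exists (b t) => n; have [w ->] := tE n.
exists (b w); rewrite linearD linear_sum linearZ; congr (_ + _).
by apply: eq_bigr => i _; rewrite linearZ ba.
Qed.
End Adic.

Section Order.
Variables (k : fieldType) (G : pzRingType) (iota : central_embedding k G).
Hypothesis iotaO : is_order iota.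
Local Notation X := (fps_X k).
Local Notation xx := (iota X).
Let iotaC := cemb_central iota.

Lemma order_kfinite : kfinite iota.
Proof.
have [n [e eG]] := iotaO; exists n, e => a.
by have [c [-> _]] := eG a; exists c.
Qed.

(** All three properties are checked on the coordinates over [k[[X]]] in the chosen basis. Rows
    serve for finitely generated projectives, square matrices for lifting idempotents. *)
Lemma order_adic p n : adic (kmod iotaC 'M[G^c]_(p, n)).
Proof.
have [r [e eG]] := iotaO.
have /choice[c cE] : forall a, exists c : {ffun 'I_r -> fps k}, a = \sum_(i < r) iota (c i) * e i.
  by move=> a; have [c [cE _]] := eG a; exists c.
have cU a (d : {ffun 'I_r -> fps k}) : a = \sum_(i < r) iota (d i) * e i -> c a = d.
  by move=> aE; have [d' [_ U]] := eG a; rewrite -(U _ (cE a)) -(U _ aE).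
have cM f a i : c (iota f * a) i = f * c a i.
  rewrite (cU _ [ffun i => f * c a i]) ?ffunE // {1}[a]cE mulr_sumr.
  by apply: eq_bigr => j _; rewrite ffunE rmorphM mulrA.
have c0 i : c 0 i = 0 by rewrite -[X in c X](mulr0 (iota 0)) cM mul0r.
have c_eq0 a : (forall i, c a i = 0) -> a = 0.
  by move=> a0; rewrite [a]cE big1 // => i _; rewrite a0 rmorph0 mul0r.
have sE f (v : kmod iotaC 'M[G^c]_(p, n)) l0 j : (f *: v : 'M[G^c]_(p, n)) l0 j = iota f * (v : 'M[G^c]_(p, n)) l0 j.
  by rewrite mxE iotaC.
split=> [v v0|v vX|u].
- apply/matrixP => l0 j; rewrite mxE; apply: c_eq0 => i; apply: fps_X_regular.
  by rewrite -cM -sE v0 mxE c0.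
- apply/matrixP => l0 j; rewrite mxE; apply: c_eq0 => i; apply: fps_separated => m.
  have [w ->] := vX m; exists (c ((w : 'M[G^c]_(p, n)) l0 j) i); by rewrite sE cM.
(* The tail of the series from index [m] on; the limit is the tail from 0. *)
pose w (m : nat) : 'M[G^c]_(p, n) := \matrix_(l0, j) \sum_(i < r)
  iota (fps_series (fun l => c ((u (m + l)%N : 'M[G^c]_(p, n)) l0 j) i)) * e i.
have key (a : nat -> G) m :
    \sum_(i < r) iota (fps_series (fun l => c (a l) i)) * e i
    = \sum_(l < m) iota (X ^+ l) * a l
      + iota (X ^+ m) * \sum_(i < r) iota (fps_series (fun l => c (a (m + l)%N) i)) * e i.
  rewrite [X in _ = X + _](eq_bigr (fun l : 'I_m => \sum_(i < r)
     iota (X ^+ l * c (a l) i) * e i)); last first.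
    move=> l _; rewrite {1}[a l]cE mulr_sumr.
    by apply: eq_bigr => i _; rewrite mulrA rmorphM.
  rewrite exchange_big mulr_sumr -big_split; apply: eq_bigr => i _ /=.
  by rewrite mulrA -rmorphM -mulr_suml -rmorph_sum -mulrDl -rmorphD [in LHS](fps_seriesE _ m).
exists (w 0%N) => m; exists (w m); apply/matrixP => l0 j; apply: etrans (_ : _ = _ :> G).
  by rewrite mxE; apply: (key (fun l => (u l : 'M[G^c]_(p, n)) l0 j) m).
rewrite [RHS]mxE summxE sE mxE; congr (_ + _ : G).
by apply: eq_bigr => l _; rewrite sE.
Qed.

Lemma kmod_lin (M N : rmodType G) (f : {linear M -> N}) :
  linear (f : kmod iotaC M -> kmod iotaC N).
Proof. by move=> a x y; rewrite kmodZ linearP. Qed.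

Lemma fgproj_adic (P : rmodType G) : fin_generated P -> projective P -> adic (kmod iotaC P).
Proof.
move=> fP pP; have [n [p [s ps]]] := fgproj_split fP pP.
apply: (@adic_retract _ (kmod iotaC 'rV[G^c]_n) (kmod iotaC P)
  (mklin (kmod_lin s)) (mklin (kmod_lin p))) (order_adic 1 n).
by move=> w; rewrite !mklinE ps.
Qed.

(** Limits are chosen pointwise; the defect of linearity is divisible by every power of [X] and
    vanishes by separatedness. *)
Lemma lim_lin (M N : rmodType G) (h : nat -> {linear M -> N}) : adic (kmod iotaC N) ->
  exists L : {linear M -> N}, forall n x, exists y : kmod iotaC N,
    L x = \sum_(i < n) X ^+ i *: (h i x : kmod iotaC N) + X ^+ n *: y.
Proof.
move=> [r s c]; have /choice[L LE] := fun x => c (fun i => h i x).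
suff lL : linear (L : M -> N) by exists (mklin lL) => n x; rewrite mklinE.
move=> a x y; apply/eqP; rewrite -subr_eq0; apply/eqP; apply: s => n.
have [[[u uE] [v vE]] [w wE]] := (LE (a *: x + y) n, LE x n, LE y n).
exists (u - ((a *: (v : N) + (w : N)) : N)).
rewrite [L _]uE [L x]vE [L y]wE.
have Z m (z : N) : (X ^+ m *: ((a *: z : N) : kmod iotaC N) : N) = a *: (X ^+ m *: (z : kmod iotaC N) : N).
  by rewrite !kmodZ !scalerA -[_ * _](iotaC (X ^+ m) a).
have -> : \sum_(i < n) X ^+ i *: (h i (a *: x + y) : kmod iotaC N) =
   (a *: (\sum_(i < n) X ^+ i *: (h i x : kmod iotaC N) : N) : N)
   + \sum_(i < n) X ^+ i *: (h i y : kmod iotaC N).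
  rewrite scaler_sumr -big_split; apply: eq_bigr => i _ /=.
  by rewrite linearP scalerDr Z.
rewrite scalerDr scalerBr scalerDr Z.
by rewrite [_ + _ + (_ + _)]addrACA opprD addrACA subrr add0r.
Qed.
End Order.

(** The family [h] satisfies no condition, so a homotopy can be lifted term by term and its boundary
    is still a chain map. *)
Lemma homotopy_map (A : pzRingType) (X Y : complex A) (h : forall i j, {linear X i -> Y j}) :
  exists n : cmap X Y, forall i j l x, j + 1 = i -> l = i + 1 ->
    n i x = cdiff Y j i (h i j x) + h l i (cdiff X i l x).
Proof.
pose n i : {linear X i -> Y i} :=
  (cdiff Y (i - 1) i \o h i (i - 1)) \+ (h (i + 1) i \o cdiff X i (i + 1)).
have nE i j l x : j + 1 = i -> l = i + 1 -> n i x = cdiff Y j i (h i j x) + h l i (cdiff X i l x).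
  by move=> ji ->; have -> : j = i - 1 by rewrite -ji addrK.
have nC i j x : j = i + 1 -> n j (cdiff X i j x) = cdiff Y i j (n i x).
  move=> ji; rewrite (nE i (i - 1) j) ?subrK // (nE j i (j + 1)) //.
  by rewrite linearD !cdiffK linear0 addr0 add0r.
by exists (mkcmap nC).
Qed.

Lemma crestr_map_unit (R S : pzRingType) (phi : {rmorphism R -> S}) (X Y : complex R) (f : cmap X Y) :
  cmap_comp (crestr_map phi (bc_map phi f)) (bc_unit phi X) = cmap_comp (bc_unit phi Y) f.
Proof. by apply/cmapP => i x; rewrite /= restr_linE bc_mapE. Qed.

Lemma nullh_crestr (R S : pzRingType) (phi : {rmorphism R -> S}) (C D : complex S) (f : cmap C D) :
  nullh f -> nullh (crestr_map phi f).
Proof.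
move=> [h hE]; exists (fun i j => restr_lin phi (h i j)) => i j l x ji li.
by rewrite !crestrE /= !restr_linE (hE i j l).
Qed.

(** * Maps and their reductions modulo X *)

Section Reduction.
Variables (k : fieldType) (G : pzRingType) (iota : central_embedding k G).
Hypothesis iotaO : is_order iota.
Local Notation X := (fps_X k).
Let iotaC := cemb_central iota.
Let pK := @fps_principal k.
Let fG := order_kfinite iotaO.
Implicit Types M N : rmodType G.
Implicit Types T S Q : complex G.

Fact xscale_linear M : linear (fun m : M => (iota X : G^c) *: m).
Proof. by move=> a x y; rewrite scalerDr !scalerA -[_ * _](iotaC X a). Qed.
Definition xscale M := mklin (@xscale_linear M).
Lemma xscaleE M m : xscale M m = (iota X : G^c) *: m. Proof. exact: mklinE. Qed.
Lemma lin_xscale M N (f : {linear M -> N}) m : f (xscale M m) = xscale N (f m).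
Proof. by rewrite !xscaleE linearZ. Qed.

(** [q] identifies [Q] with [S / X S]. *)
Definition xquot S Q (q : cmap S Q) := forall i,
  (forall y, exists x, q i x = y) /\
  (forall x, q i x = 0 <-> exists x', x = xscale (S i) x').

Lemma fgproj_regular M : fin_generated M -> projective M ->
  forall m, xscale M m = 0 -> m = 0.
Proof.
move=> fM pM m; rewrite xscaleE => m0.
by have [r _ _] := fgproj_adic iotaO fM pM; apply: r.
Qed.

Lemma perfect_regular S : perfect S -> forall i x, xscale (S i) x = 0 -> x = 0.
Proof. by move=> [_ pS] i x; apply: fgproj_regular; case: (pS i). Qed.

Lemma to_modX_surj a : exists b, to_modX iota b = a.
Proof. by exists (repr a); apply: rpi_repr. Qed.

Lemma to_modX_eq0 a : to_modX iota a = 0 <-> exists b, a = iota X * b.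
Proof.
rewrite -(rmorph0 (to_modX iota)) rpi_eq subr0; by [].
Qed.

Lemma modX_unit_surj M u : exists m, tens_unit (to_modX iota) M m = u.
Proof.
rewrite -[u]tpi_repr tpi_sum; elim: (repr u) => [|p s [m mE]].
  by exists 0; rewrite linear0 big_nil.
have [b bE] := to_modX_surj p.2.
by exists ((b : G^c) *: p.1 + m); rewrite linearP big_cons mE restrZ bE.
Qed.

Lemma modX_unit_xscale M m : tens_unit (to_modX iota) M (xscale M m) = 0.
Proof.
rewrite xscaleE linearZ /= restrZ.
have -> : to_modX iota (iota X) = 0 by apply/to_modX_eq0; exists 1; rewrite mulr1.
by rewrite scale0r.
Qed.

(** Formal sums of tensors are evaluated in [M] through representatives of the coefficients. This is
    not additive, but an induction over the generating relations shows that it is well defined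
    modulo [X M]. *)
Lemma modX_unit_eq0 M m :
  tens_unit (to_modX iota) M m = 0 <-> exists m', m = xscale M m'.
Proof.
split=> [m0|[m' ->]]; last exact: modX_unit_xscale.
pose ev (s : seq (M * modX iota)) : M := \sum_(p <- s) (repr p.2 : G^c) *: p.1.
have reprE (a : modX iota) b : to_modX iota b = a ->
    forall n : M, exists n', (repr a : G^c) *: n - (b : G^c) *: n = xscale M n'.
  move=> ba n; have [c cE] : exists c, repr a - b = iota X * c.
    by apply/to_modX_eq0; rewrite rmorphB ba [to_modX iota _]rpi_repr subrr.
  by exists ((c : G^c) *: n); rewrite -scalerBl xscaleE scalerA -[_ * _]iotaC -cE.
suff H s t : tens_eq (to_modX iota) s t -> exists n, ev s - ev t = xscale M n.
  move/tpi_eq: (m0 : tpi (to_modX iota) [:: (m, 1)] = tpi _ [::]).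
  move=> /H[n]; rewrite /ev big_seq1 big_nil subr0 /= => nE.
  have [n' nE'] := reprE 1 1 (rmorph1 _) m; exists (n - n').
  by rewrite linearB -nE -nE' scale1r subKr.
have add0 (a b : M) : (exists n, a = xscale M n) -> (exists n, b = xscale M n) ->
    exists n, a + b = xscale M n.
  by move=> [n ->] [n' ->]; exists (n + n'); rewrite linearD.
have opp0 (a : M) : (exists n, a = xscale M n) -> exists n, - a = xscale M n.
  by move=> [n ->]; exists (- n); rewrite linearN.
elim=> {s t} [s|s t _ IH|t s u _ IH1 _ IH2|s s' t t' _ IH1 _ IH2|s t|b|n n' b|n b b'|n r b].
- by exists 0; rewrite subrr linear0.
- by rewrite -opprB; apply: opp0.
- by have := add0 _ _ IH1 IH2; rewrite addrA subrK.
- by rewrite /ev !big_cat opprD addrACA; apply: add0.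
- by exists 0; rewrite /ev !big_cat /= [X in X - _]addrC subrr linear0.
- by exists 0; rewrite /ev big_seq1 big_nil scaler0 subrr linear0.
- by exists 0; rewrite /ev !big_cons !big_nil !addr0 scalerDr subrr linear0.
- have [|c cE] := reprE (b + b') (repr b + repr b') _ n.
    by rewrite rmorphD; congr (_ + _); apply: rpi_repr.
  by exists c; rewrite /ev !big_cons !big_nil !addr0 -scalerDl.
have [|c cE] := reprE (to_modX iota r * b) (r * repr b) _ n.
  by rewrite rmorphM; congr (_ * _); apply: rpi_repr.
exists (- c); rewrite linearN -cE opprB /ev !big_seq1 /= scalerA.
by [].
Qed.

Lemma xquot_unit T : xquot (bc_unit (to_modX iota) T).
Proof. by move=> i; split=> [y|x]; [apply: modX_unit_surj | apply: modX_unit_eq0]. Qed.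

Lemma xquot_shift S Q (q : cmap S Q) n : xquot q -> xquot (cshift q n).
Proof. by move=> qX i; apply: (qX (i + n)). Qed.

(** Projectivity lifts [f] term by term. The failure of the lifts to commute with the differentials
    is [X g], where [g] is a chain map to [S[1]] because [X] is regular; a null-homotopy of [g],
    multiplied by [X], corrects the lifts. *)
Lemma xquot_lift T S Q (q : cmap S Q) : perfect T -> xquot q ->
  (forall i x, xscale (S i) x = 0 -> x = 0) -> hz0 T (shift S 1) ->
  forall f : cmap T Q, exists F : cmap T S, cmap_comp q F = f.
Proof.
move=> [_ pT] qX regS TS f.
have /all_sig[F0 F0E] : forall i, {g : {linear T i -> S i} | forall x, q i (g x) = f i x}.
  move=> i; apply: cid; apply: fgproj_lift; [exact: (pT i).1 | exact: (pT i).2 |].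
  by move=> x; apply: (qX i).1.
pose E i : {linear T i -> S (i + 1)} :=
  (cdiff S i (i + 1) \o F0 i) \- (F0 (i + 1) \o cdiff T i (i + 1)).
have /all_sig[g gE] : forall i, {g : {linear T i -> S (i + 1)} |
    forall x, xscale (S (i + 1)) (g x) = E i x}.
  move=> i; apply: cid; apply: fgproj_lift; [exact: (pT i).1 | exact: (pT i).2 |].
  move=> x; have [|y ->] := ((qX (i + 1)).2 (E i x)).1; last by exists y.
  by rewrite /E /= linearB cfunC !F0E cfunC subrr.
have gC i j x : j = i + 1 -> g j (cdiff T i j x) = cdiff (shift S 1) i j (g i x).
  move=> ji; subst j; apply/eqP; rewrite -subr_eq0; apply/eqP/regS.
  rewrite linearB shiftE sg1 mulrN1z linearN -(lin_xscale (cdiff S (i + 1) (i + 1 + 1))) !gE /E /= cdiffK linear0 subr0.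
  by rewrite linearB cdiffK sub0r opprK subrr.
have [h hE] := TS (@mkcmap G T (shift S 1) g gC).
pose h' i : {linear T i -> S i} := tr S (i - 1 + 1) i \o h i (i - 1).
have h'E i j x : i = j + 1 ->
    tr S (i - 1 + 1) i (h i (i - 1) x) = tr S (j + 1) i (h i j x).
  by move=> ij; have e : j = i - 1 by [rewrite ij addrK]; subst j.
pose F i : {linear T i -> S i} := F0 i \+ (xscale (S i) \o h' i).
have FC i j x : j = i + 1 -> F j (cdiff T i j x) = cdiff S i j (F i x).
  move=> ji; subst j; apply/esym/eqP; rewrite -subr_eq0 /F /= linearD opprD addrACA.
  have := gE i x; rewrite /E /= => <-; rewrite -[g i x]/(@mkcmap G T (shift S 1) g gC i x).
  rewrite (hE i (i - 1) (i + 1)) ?subrK // shiftE sg1 mulrN1z.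
  rewrite (lin_xscale (cdiff S i (i + 1))) -linearB -linearD; apply/eqP.
  rewrite (h'E (i + 1) i) // trid (diff_tr _ (subrK 1 i) (erefl _)) trid.
  by rewrite addrACA addNr add0r subrr linear0.
exists (mkcmap FC); apply/cmapP => i x; rewrite /= linearD F0E.
have -> : q i (xscale (S i) (h' i x)) = 0 by apply/(qX i).2; exists (h' i x).
by rewrite addr0.
Qed.

Lemma xquot_hz0 T S Q (q : cmap S Q) : perfect T -> xquot q ->
  (forall i x, xscale (S i) x = 0 -> x = 0) ->
  hz0 T S -> hz0 T (shift S 1) -> hz0 T Q.
Proof.
move=> pT qX regS TS TS1 f; have [F <-] := xquot_lift pT qX regS TS1 f.
exact: nullh_compl.
Qed.

Local Notation kc T S := (kcmap iotaC T S).

(** Lift the homotopy term by term: [f] minus the boundary of the lift vanishes modulo [X], so it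
    can be divided by [X], and regularity makes the quotient a chain map. *)
Lemma xquot_null T S Q (q : cmap S Q) (f : cmap T S) : perfect T -> xquot q ->
  (forall i x, xscale (S i) x = 0 -> x = 0) ->
  nullh (cmap_comp q f) -> exists g : kc T S, f ~ (X *: g : kc T S).
Proof.
move=> [_ pT] qX regS [h hE].
have h'E i j : {g : {linear T i -> S j} | forall x, q j (g x) = h i j x}.
  by apply/cid/fgproj_lift; [exact: (pT i).1 | exact: (pT i).2 | move=> x; apply: (qX j).1].
have [n nE] := homotopy_map (fun i j => sval (h'E i j)).
have hq i j x : q j (sval (h'E i j) x) = h i j x by case: (h'E i j).
have /all_sig[g gE] i : {g : {linear T i -> S i} | forall x, xscale (S i) (g x) = (f - n) i x}.
  apply/cid/fgproj_lift; [exact: (pT i).1 | exact: (pT i).2 |].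
  move=> x; have [|y ->] := ((qX i).2 ((f - n) i x)).1; last by exists y.
  rewrite cmapB linearB -[q i (f i x)]/(cmap_comp q f i x).
  rewrite (hE i (i - 1) (i + 1)) ?subrK // (nE i (i - 1) (i + 1)) ?subrK //.
  by rewrite linearD cfunC !hq subrr.
have gC i j x : j = i + 1 -> g j (cdiff T i j x) = cdiff S i j (g i x).
  move=> ji; apply/eqP; rewrite -subr_eq0; apply/eqP/regS.
  by rewrite linearB -(lin_xscale (cdiff S i j)) !gE cfunC subrr.
exists (mkcmap gC); have -> : (X *: (mkcmap gC : kc T S) : kc T S) = f - n :> cmap T S.
  by apply/cmapP => i x; rewrite kcmapZ -gE xscaleE.
rewrite /heq opprB addrC subrK; exists (fun i j => sval (h'E i j)).
exact: nE.
Qed.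

(** Nakayama for the module of strict chain maps. Homotopy enters through the choice of [N], so no
    quotient module is needed. *)
Lemma fps_nakayama T S (N : set (kc T S)) : perfect T -> perfect S -> submod N ->
  (forall f : kc T S, exists n g : kc T S, N n /\ f = n + X *: g) -> forall f, N f.
Proof.
move=> pT pS sN NX.
have [fs _ fsS] : exists2 fs : seq (kc T S), {in fs, forall f, setT f} &
    forall f, setT f -> span fs f.
  by apply: (cmap_fg pK fG pT) => // i; case: (pS.2 i).
move=> f; apply: (nakayama (s := fs) (M := setT) (@fps_1BX_unit k) sN) => // g _.
by have [n [g' [Nn gE]]] := NX g; exists n, g'.
Qed.

Lemma hz0_of_xquot T S Q (q : cmap S Q) : perfect T -> perfect S -> xquot q ->
  hz0 T Q -> hz0 T S.
Proof.
move=> pT pS qX TQ; apply: (@fps_nakayama T S (fun f : kc T S => nullh f)) => //.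
  by split=> [|f g|a f]; [exact: nullh0 | exact: nullhD | exact: nullh_scale].
move=> f; have [g fg] := xquot_null pT qX (perfect_regular pS) (TQ (cmap_comp q f)).
by exists ((f : cmap T S) - (X *: g : kc T S)), g; split; rewrite // subrK.
Qed.

(** As [f ~ 1 + X g], each [u] equals [(u + X g u) - X g u], where the bracket is homotopic to
    [f u]. Nakayama for the maps of the form [f v] up to homotopy gives a right inverse, and
    symmetrically a left one. *)
Lemma unit_mod_X T (f : cmap T T) : perfect T ->
  nullh (bc_map (to_modX iota) (f - cmap_id T)) ->
  exists v w : cmap T T, cmap_comp f v ~ cmap_id T /\ cmap_comp w f ~ cmap_id T.
Proof.
move=> pT fn.
have regT := perfect_regular pT.
have [g fg] : exists g : kc T T, f - cmap_id T ~ (X *: g : kc T T).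
  apply: (xquot_null pT (@xquot_unit T) regT).
  by rewrite -crestr_map_unit; apply: nullh_compr; apply: nullh_crestr.
have Zl a (u v : cmap T T) : cmap_comp ((a *: (u : kc T T) : kc T T) : cmap T T) v
    = (a *: (cmap_comp u v : kc T T) : kc T T).
  by apply/cmapP => i x; rewrite /= !kcmapZ.
have Zr a (u v : cmap T T) : cmap_comp v ((a *: (u : kc T T) : kc T T) : cmap T T)
    = (a *: (cmap_comp v u : kc T T) : kc T T).
  by apply/cmapP => i x; rewrite /= !kcmapZ linearZ.
have Zh a (u v : kc T T) : u ~ v -> (a *: u : kc T T) ~ (a *: v : kc T T).
  by rewrite /heq => uv; rewrite -[X in nullh X](scalerBr a u v); apply: nullh_scale.
have fE : f ~ cmap_id T + (X *: g : kc T T) by move: fg; rewrite /heq opprD addrA.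
have e0 (n u : kc T T) : u = (u + X *: n) + X *: (- n) by rewrite scalerN addrK.
suff [[v fv] [w wf]] : (exists v, cmap_comp f v ~ cmap_id T) /\ (exists w, cmap_comp w f ~ cmap_id T).
  by exists v, w.
split.
  apply: (@fps_nakayama T T (fun u : kc T T => exists v, cmap_comp f v ~ u)) => //.
    split=> [|u u' [v fv] [v' fv']|a u [v fv]].
    - exists 0; have -> : cmap_comp f (0 : cmap T T) = (0 : cmap T T) by apply/cmapP => i x /=; rewrite linear0.
      exact: heq_refl.
    - by exists (v + v'); rewrite comp_cmapDr; apply: heqD.
    by exists (a *: (v : kc T T) : kc T T); rewrite Zr; apply: Zh.
  move=> u; exists (u + X *: (cmap_comp g u : kc T T)), (- (cmap_comp g u : kc T T)).
  split; last exact: e0.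
  exists u; apply: heq_trans (heq_comp fE (heq_refl u)) _.
  by rewrite comp_cmapDl comp_1cmap Zl; apply: heq_refl.
apply: (@fps_nakayama T T (fun u : kc T T => exists v, cmap_comp v f ~ u)) => //.
  split=> [|u u' [v fv] [v' fv']|a u [v fv]].
  - exists 0; have -> : cmap_comp (0 : cmap T T) f = (0 : cmap T T) by apply/cmapP.
    exact: heq_refl.
  - by exists (v + v'); rewrite comp_cmapDl; apply: heqD.
  by exists (a *: (v : kc T T) : kc T T); rewrite Zl; apply: Zh.
move=> u; exists (u + X *: (cmap_comp u g : kc T T)), (- (cmap_comp u g : kc T T)).
split; last exact: e0.
exists u; apply: heq_trans (heq_comp (heq_refl u) fE) _.
by rewrite comp_cmapDr comp_cmap1 Zr; apply: heq_refl.
Qed.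

Local Notation bc := (base_change (to_modX iota)).

Lemma hz_bc_of_hz n T S : perfect T -> perfect S -> hz n T S -> hz (n + 1) T S -> hz n (bc T) (bc S).
Proof.
move=> pT pS TS TS1; apply/hz_bc.
apply: (@xquot_hz0 T _ _ (cshift (bc_unit (to_modX iota) S) n)) => //.
- by apply: xquot_shift; apply: xquot_unit.
- by move=> i x; apply: (perfect_regular pS).
by apply/(hz_shiftr 1).
Qed.

Lemma hz_of_hz_bc n T S : perfect T -> perfect S -> hz n (bc T) (bc S) -> hz n T S.
Proof.
move=> pT pS /hz_bc TS.
apply: (@hz0_of_xquot T _ _ (cshift (bc_unit (to_modX iota) S) n)) => //.
  exact: perfect_shift.
by apply: xquot_shift; apply: xquot_unit.
Qed.

Lemma bc_map_lift T S (f : cmap (bc T) (bc S)) : perfect T -> perfect S -> hz 1 T S ->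
  exists F : cmap T S, bc_map (to_modX iota) F = f.
Proof.
move=> pT pS TS.
have [F FE] := xquot_lift pT (@xquot_unit S) (perfect_regular pS) TS
  (cmap_comp (crestr_map (to_modX iota) f) (bc_unit (to_modX iota) T)).
exists F; apply: bc_map_ext => i m; rewrite bc_mapE.
have := congr1 (fun c : cmap T (crestr _ (bc S)) => c i m) FE.
by move=> /= ->; exact: restr_linE.
Qed.

Lemma hiso_of_bc T S : perfect T -> perfect S -> hz 1 (bc T) (bc S) -> hz 1 (bc S) (bc T) ->
  hiso (bc T) (bc S) -> hiso T S.
Proof.
move=> pT pS TS ST /hisoP[f [g [gf fg]]].
have [F FE] := bc_map_lift f pT pS (hz_of_hz_bc pT pS TS).
have [H HE] := bc_map_lift g pS pT (hz_of_hz_bc pS pT ST).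
have [|v [w [vE _]]] := @unit_mod_X S (cmap_comp F H) pS.
  by rewrite bc_mapB bc_map_comp FE HE bc_map_id.
have [|v' [w' [_ wE]]] := @unit_mod_X T (cmap_comp H F) pT.
  by rewrite bc_mapB bc_map_comp FE HE bc_map_id.
rewrite -comp_cmapA in vE; rewrite comp_cmapA in wE.
apply/hisoP; exists F, (cmap_comp w' H); split=> //.
apply: heq_trans (vE); apply: heq_comp (heq_refl _) _.
apply: (@heq_trans _ _ _ (cmap_comp (cmap_comp w' H) (cmap_comp F (cmap_comp H v)))).
  rewrite -{1}[cmap_comp w' H]comp_cmap1; apply: heq_comp (heq_refl _) (heq_sym _) => //.
rewrite (comp_cmapA (cmap_comp w' H)) -[X in _ ~ X]comp_1cmap.
by apply: heq_comp (heq_refl _); rewrite -comp_cmapA in wE *; exact: wE.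
Qed.
End Reduction.

(** * Torsion-silting complexes *)

Section RadicalNakayama.
Variables (A : pzRingType) (V : rmodType A).

(** Zorn's lemma: as [M] is finitely generated, a chain whose union contains [M] has a member that
    already does. *)
Lemma max_submod (s : seq V) (M N : set V) : submod M -> submod N ->
  {in s, forall e, M e} -> (forall v, M v -> span s v) -> ~ (M `<=` N) ->
  exists D : set V, [/\ submod D, N `<=` D, ~ (M `<=` D) &
    forall E : set V, submod E -> D `<=` E -> D <> E -> M `<=` E].
Proof.
move=> sM sN Ms sMs MN.
(* Adjoining [N] inside the property admits the empty chain, whose union is empty. *)
pose P (B : set V) := submod (B `|` N) /\ ~ (M `<=` B `|` N).
have [F FP Ftot|B [[sB MB] Bmax]] := @Zorn_bigcup V P.
  have [[B0 FB0]|F0] := pselect (exists B, F B); last first.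
    have -> : \bigcup_(B in F) B = set0.
      by rewrite -subset0 => x [B FB _]; apply: F0; exists B.
    by rewrite /P set0U.
  have sub2 B C : F B -> F C -> exists D, [/\ F D, B `<=` D & C `<=` D].
    by move=> FB FC; have [BC|CB] := Ftot B C FB FC; [exists C | exists B]; split=> // x.
  have in1 x : (\bigcup_(B in F) B `|` N) x -> exists B, F B /\ (B `|` N) x.
    by move=> [[B FB Bx]|Nx]; [exists B; split=> //; left | exists B0; split=> //; right].
  have out B x : F B -> (B `|` N) x -> (\bigcup_(B in F) B `|` N) x.
    by move=> FB [Bx|Nx]; [left; exists B | right].
  have subU (B D : set V) : B `<=` D -> B `|` N `<=` D `|` N by move=> BD; apply: setSU.
  split.
    have [N0 _ _] := sN; split=> [|x y /in1[B [FB Bx]] /in1[C [FC Cy]]|a x /in1[B [FB Bx]]].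
    - by right.
    - have [D [FD BD CD]] := sub2 B C FB FC; apply: (out D) => //.
      have [[_ DD _] _] := FP D FD; apply: DD; [exact: subU BD _ Bx | exact: subU CD _ Cy].
    by apply: (out B) => //; have [[_ _ BZ] _] := FP B FB; apply: BZ.
  move=> MU.
  have [D [FD sD]] : exists D, F D /\ {in s, forall e, (D `|` N) e}.
    have : {in s, forall e, (\bigcup_(B in F) B `|` N) e} by move=> e /Ms /MU.
    elim: (s) => [|e s' IH] H; first by exists B0.
    have [D [FD sD]] : exists D, F D /\ {in s', forall e, (D `|` N) e}.
      by apply: IH => u us; apply: H; rewrite inE us orbT.
    have [B [FB Be]] := in1 e (H e (mem_head _ _)).
    have [E [FE BE DE]] := sub2 B D FB FD; exists E; split=> // u.
    rewrite inE => /orP[/eqP->|/sD]; [exact: subU BE _ Be | exact: subU DE _].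
  have [sDN nD] := FP D FD; apply: nD => x Mx.
  by apply: span_min (sMs x Mx).
exists (B `|` N); split=> // E sE BE nBE.
apply: contrapT => ME; apply: (Bmax E); last first.
  have -> : P E = (submod E /\ ~ M `<=` E); last by split.
  by rewrite /P (_ : E `|` N = E) // setUidl // => x Nx; apply: BE; right.
split; first by move=> x Bx; apply: BE; left.
move=> EB; apply: nBE; apply/seteqP; split=> // x Ex.
by left; apply: EB.
Qed.

(** Take [D] maximal among the submodules that contain [N] but not [M]. For [x] in [M] outside [D],
    the [b] with [x b] in [D] form a maximal right ideal, so they include the radical. Hence the
    radical multiples of [M] lie in [D], and then so does [M]. *)
Lemma rad_nakayama (s : seq V) (M N : set V) : submod M -> submod N ->
  {in s, forall e, M e} -> (forall v, M v -> span s v) ->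
  (forall z, M z -> exists n (y : 'I_n -> V) (r : 'I_n -> A),
     [/\ forall l, M (y l), forall l, jacobson_radical (r l) &
         N (z - \sum_(l < n) (r l : A^c) *: y l)]) ->
  M `<=` N.
Proof.
move=> sM sN Ms sMs MJ; apply: contrapT => MN.
have [D [sD ND MD Dmax]] := max_submod sM sN Ms sMs MN.
have [D0 DD DZ] := sD.
apply: MD => z Mz; have [n [y [r [My Jr Nz]]]] := MJ z Mz.
rewrite -[z](subrK (\sum_(l < n) (r l : A^c) *: y l)); apply: (DD); first exact: ND.
apply: submod_sum => // l _; move: {My}(y l) (My l) (r l) {Jr}(Jr l) => x Mx a Ja.
apply: contrapT => Dxa.
pose I : set A := [set b | D ((b : A^c) *: x)].
have Dx : ~ D x by move=> Dx; apply: Dxa; apply: (DZ).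
apply: Dxa; apply: (Ja I); split.
- split=> [|b c /= Db Dc|b c /= Db]; first by rewrite /I /= scale0r.
    by rewrite /I /= scalerDl; apply: (DD).
  by rewrite /I /= -[b * c]/((c : A^c) * (b : A^c)) -scalerA; apply: (DZ).
- by rewrite /I /= scale1r.
move=> I' [I'0 I'D I'M] I'1 II'; apply/seteqP; split=> // b I'b.
apply: contrapT => Db; apply: I'1.
(* If [b] is outside the annihilator [I] of [x] modulo [D], then [D + x b A] is strictly larger than
   [D], so it contains [x]. Writing [x = d + x b c] puts [1 - b c] into [I]. *)
pose E : set V := [set v | exists2 d, D d & exists c : A, v = d + (c : A^c) *: ((b : A^c) *: x)].
have sE : submod E.
  split=> [|u v [d Dd [c ->]] [d' Dd' [c' ->]]|e u [d Dd [c ->]]].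
  - by exists 0 => //; exists 0; rewrite scale0r addr0.
  - by exists (d + d'); [exact: DD | exists (c + c'); rewrite scalerDl addrACA].
  exists (e *: d); [exact: DZ | exists (c * (e : A)); rewrite scalerDr].
  by rewrite -[c * _]/((e : A^c) * (c : A^c)) -[in RHS]scalerA.
have DE : D `<=` E by move=> d Dd; exists d => //; exists 0; rewrite scale0r addr0.
have [|d Dd [c xE]] := Dmax E sE DE _ x Mx.
  move=> e; apply: Db; rewrite /I /= e; exists 0 => //; exists 1.
  by rewrite scale1r add0r.
rewrite -(subrK (b * c) 1); apply: I'D; last exact: I'M.
apply: II'; rewrite /I /= scalerBl scale1r {1}xE.
by rewrite -[b * c]/((c : A^c) * (b : A^c)) -scalerA addrK.
Qed.
End RadicalNakayama.

(** * Reduced products of modules and complexes *)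

Section Germs.
Variables (R : pzRingType).
Implicit Types V W : nat -> lmodType R.

Definition fam V : Type := forall m, V m.
HB.instance Definition _ V := gen_eqMixin (fam V).
HB.instance Definition _ V := gen_choiceMixin (fam V).
Section FamLmod.
Variable V : nat -> lmodType R.
Let famP (u v : fam V) : (forall m, u m = v m) -> u = v.
Proof. exact: functional_extensionality_dep. Qed.
Definition fam_add (u v : fam V) : fam V := fun m => u m + v m.
Definition fam_opp (u : fam V) : fam V := fun m => - u m.
Definition fam_scale (a : R) (u : fam V) : fam V := fun m => a *: u m.
Fact fam_addA : associative fam_add.
Proof. by move=> u v w; apply: famP => m; apply: addrA. Qed.
Fact fam_addC : commutative fam_add.
Proof. by move=> u v; apply: famP => m; apply: addrC. Qed.
Fact fam_add0 : left_id (fun m => 0 : V m) fam_add.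
Proof. by move=> u; apply: famP => m; apply: add0r. Qed.
Fact fam_addN : left_inverse (fun m => 0 : V m) fam_opp fam_add.
Proof. by move=> u; apply: famP => m; apply: addNr. Qed.
HB.instance Definition _ := GRing.isZmodule.Build (fam V) fam_addA fam_addC fam_add0 fam_addN.
Fact fam_scaleA a b u : fam_scale a (fam_scale b u) = fam_scale (a * b) u.
Proof. by apply: famP => m; apply: scalerA. Qed.
Fact fam_scale1 : left_id 1 fam_scale.
Proof. by move=> u; apply: famP => m; apply: scale1r. Qed.
Fact fam_scaleDr : right_distributive fam_scale +%R.
Proof. by move=> a u v; apply: famP => m; apply: scalerDr. Qed.
Fact fam_scaleDl u : {morph fam_scale^~ u : a b / a + b}.
Proof. by move=> a b; apply: famP => m; apply: scalerDl. Qed.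
HB.instance Definition _ := GRing.Zmodule_isLmodule.Build R (fam V)
  fam_scaleA fam_scale1 fam_scaleDr fam_scaleDl.

Definition ev_eq (u v : fam V) := exists M : nat, forall m, (M <= m)%N -> u m = v m.
Definition ev_rel : rel (fam V) := fun u v => `[< ev_eq u v >].
Fact ev_rel_refl : reflexive ev_rel.
Proof. by move=> u; apply/asboolP; exists 0%N. Qed.
Fact ev_rel_sym : symmetric ev_rel.
Proof. by move=> u v; apply/asboolP/asboolP => -[M H]; exists M => m /H. Qed.
Fact ev_rel_trans : transitive ev_rel.
Proof.
move=> v u w /asboolP[M H] /asboolP[M' H']; apply/asboolP; exists (maxn M M') => m.
by rewrite geq_max => /andP[/H-> /H'].
Qed.
Canonical ev_equiv := EquivRel ev_rel ev_rel_refl ev_rel_sym ev_rel_trans.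
Definition germ := {eq_quot ev_rel}.
HB.instance Definition _ := Choice.on germ.
Definition gpi (u : fam V) : germ := \pi_germ u.
Lemma gpi_eq u v : gpi u = gpi v <-> ev_eq u v.
Proof.
split=> [/eqP|uv]; first by rewrite /gpi piE => /asboolP.
by apply/eqP; rewrite /gpi piE; apply/asboolP.
Qed.
Lemma gpi_repr (g : germ) : gpi (repr g) = g.
Proof. by rewrite /gpi reprK. Qed.
Lemma repr_gpi u : ev_eq (repr (gpi u)) u.
Proof. by apply/gpi_eq; rewrite gpi_repr. Qed.

Definition germ_add (g h : germ) := gpi (repr g + repr h).
Definition germ_opp (g : germ) := gpi (- repr g).
Definition germ_scale (a : R) (g : germ) := gpi (a *: repr g).
Lemma gpi_add u v : germ_add (gpi u) (gpi v) = gpi (u + v).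
Proof.
apply/gpi_eq; have [[M H] [M' H']] := (repr_gpi u, repr_gpi v); exists (maxn M M') => m.
by rewrite geq_max => /andP[/H e /H' e']; rewrite -[LHS]/(_ m + _ m) e e'.
Qed.
Lemma gpi_opp u : germ_opp (gpi u) = gpi (- u).
Proof. by apply/gpi_eq; have [M H] := repr_gpi u; exists M => m /H e; rewrite -[LHS]/(- _ m) e. Qed.
Lemma gpi_scale a u : germ_scale a (gpi u) = gpi (a *: u).
Proof. by apply/gpi_eq; have [M H] := repr_gpi u; exists M => m /H e; rewrite -[LHS]/(_ *: _ m) e. Qed.
Fact germ_addA : associative germ_add.
Proof. by move=> u v w; rewrite -[u]gpi_repr -[v]gpi_repr -[w]gpi_repr !gpi_add addrA. Qed.
Fact germ_addC : commutative germ_add.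
Proof. by move=> u v; rewrite -[u]gpi_repr -[v]gpi_repr !gpi_add addrC. Qed.
Fact germ_add0 : left_id (gpi 0) germ_add.
Proof. by move=> u; rewrite -[u]gpi_repr !gpi_add add0r. Qed.
Fact germ_addN : left_inverse (gpi 0) germ_opp germ_add.
Proof. by move=> u; rewrite -[u]gpi_repr gpi_opp gpi_add addNr. Qed.
HB.instance Definition _ := GRing.isZmodule.Build germ germ_addA germ_addC germ_add0 germ_addN.
Fact germ_scaleA a b u : germ_scale a (germ_scale b u) = germ_scale (a * b) u.
Proof. by rewrite -[u]gpi_repr !gpi_scale scalerA. Qed.
Fact germ_scale1 : left_id 1 germ_scale.
Proof. by move=> u; rewrite -[u]gpi_repr !gpi_scale scale1r. Qed.
Fact germ_scaleDr : right_distributive germ_scale +%R.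
Proof.
move=> a u v; rewrite -[u]gpi_repr -[v]gpi_repr.
rewrite -[gpi (repr u) + gpi (repr v)]/(germ_add (gpi (repr u)) (gpi (repr v))).
rewrite -[RHS]/(germ_add (germ_scale a (gpi (repr u))) (germ_scale a (gpi (repr v)))).
by rewrite gpi_add !gpi_scale gpi_add scalerDr.
Qed.
Fact germ_scaleDl u : {morph germ_scale^~ u : a b / a + b}.
Proof.
move=> a b; rewrite -[u]gpi_repr.
rewrite -[RHS]/(germ_add (germ_scale a (gpi (repr u))) (germ_scale b (gpi (repr u)))).
by rewrite !gpi_scale gpi_add scalerDl.
Qed.
HB.instance Definition _ := GRing.Zmodule_isLmodule.Build R germ
  germ_scaleA germ_scale1 germ_scaleDr germ_scaleDl.
Fact gpi_linear : linear gpi.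
Proof.
by move=> a u v; rewrite -[RHS]/(germ_add (germ_scale a (gpi u)) (gpi v)) gpi_scale gpi_add.
Qed.
HB.instance Definition _ := GRing.isLinear.Build R (fam V) germ *:%R gpi gpi_linear.
End FamLmod.

Lemma famD V (u v : fam V) m : (u + v) m = u m + v m. Proof. by []. Qed.
Lemma famZ V a (u : fam V) m : (a *: u) m = a *: u m. Proof. by []. Qed.
Lemma fam_sum V I (r : seq I) (F : I -> fam V) m :
  (\sum_(i <- r) F i) m = \sum_(i <- r) F i m.
Proof. by elim: r => [|i r IH]; rewrite ?big_nil // !big_cons famD IH. Qed.

Section GermMap.
Variables (V W : nat -> lmodType R) (f : forall m, {linear V m -> W m}).
Definition germ_map_fun (g : germ V) : germ W := gpi (fun m => f m (repr g m)).
Lemma germ_mapE u : germ_map_fun (gpi u) = gpi (fun m => f m (u m)).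
Proof. by apply/gpi_eq; have [M H] := repr_gpi u; exists M => m /H ->. Qed.
Fact germ_map_linear : linear germ_map_fun.
Proof.
move=> a u v; rewrite -[u]gpi_repr -[v]gpi_repr -linearP !germ_mapE -linearP.
by congr gpi; apply: functional_extensionality_dep => m; rewrite linearP.
Qed.
Definition germ_map := mklin germ_map_linear.
End GermMap.
End Germs.

Lemma eventually_bounded (N : nat) (Q : nat -> int -> Prop) :
  (forall i, exists M : nat, forall m, (M <= m)%N -> Q m i) ->
  exists M : nat, forall m, (M <= m)%N -> forall i, (`|i| <= N)%N -> Q m i.
Proof.
move=> /choice[M HM]; exists (\max_(n < N + N + 1) M (n%:Z - N%:Z)%R)%N => m Mm i iN.
apply: HM; apply: leq_trans Mm.
have iN' : (absz (i + N%:Z)%R < N + N + 1)%N by lia.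
apply: leq_trans (leq_bigmax (Ordinal iN')) => /=.
by have -> : (absz (i + N%:Z))%:Z - N%:Z = i by lia.
Qed.

Section GermComplex.
Variable A : pzRingType.
Implicit Types T : complex A.

Section Def.
Variable C : nat -> complex A.
Fact germ_shape i j : j <> i + 1 -> forall x, germ_map (fun m => cdiff (C m) i j) x = 0.
Proof.
move=> ij x; rewrite -[x]gpi_repr mklinE germ_mapE -(linear0 (@gpi _ _)).
by congr gpi; apply: functional_extensionality_dep => m; rewrite cdiff_shape.
Qed.
Fact germ_diffK i j l x : germ_map (fun m => cdiff (C m) j l)
  (germ_map (fun m => cdiff (C m) i j) x) = 0.
Proof.
rewrite -[x]gpi_repr !mklinE !germ_mapE -(linear0 (@gpi _ _)).
by congr gpi; apply: functional_extensionality_dep => m; rewrite cdiffK.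
Qed.
(** The reduced product [prod_m C m / (+)_m C m]. *)
Definition germ_complex : complex A :=
  @Complex A (fun i => germ (fun m => C m i)) (fun i j => germ_map (fun m => cdiff (C m) i j))
    germ_shape germ_diffK.
Lemma germ_complexE i j (u : fam (fun m => C m i)) :
  cdiff germ_complex i j (gpi u) = gpi (fun m => cdiff (C m) i j (u m)).
Proof. by rewrite /= mklinE germ_mapE. Qed.
End Def.

(** The images of the finitely many basis vectors of a free cover are represented by sequences,
    which determine one linear map for each [m]. *)
Lemma germ_lin_lift (P : rmodType A) (V : nat -> rmodType A) (f : {linear P -> germ V}) :
  fin_generated P -> projective P ->
  exists F : forall m, {linear P -> V m}, forall x, f x = gpi (fun m => F m x).
Proof.
move=> fP pP; have [n [p [s ps]]] := fgproj_split fP pP.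
exists (fun m => rowlin (fun l => (repr (f (p (delta_mx 0 l))) : fam V) m) \o s) => x.
rewrite -{1}(ps x) (lin_row p) linear_sum.
transitivity (gpi (\sum_(l < n) s x 0 l *: (repr (f (p (delta_mx 0 l))) : fam V))).
  rewrite linear_sum; apply: eq_bigr => l _; rewrite !linearZ; congr (_ *: _).
  exact/esym/gpi_repr.
congr gpi; apply: functional_extensionality_dep => m.
rewrite fam_sum /= rowlinE; apply: eq_bigr => l _.
by rewrite famZ.
Qed.

Lemma eventually_lin (P : rmodType A) (V : nat -> rmodType A) (f g : forall m, {linear P -> V m}) :
  fin_generated P -> (forall x, ev_eq (fun m => f m x) (fun m => g m x)) ->
  exists M : nat, forall m, (M <= m)%N -> forall x, f m x = g m x.
Proof.
move=> /fgP[s sP] fg.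
have [M HM] : exists M : nat, forall m, (M <= m)%N -> {in s, forall x, f m x = g m x}.
  elim: (s) => [|e t [M HM]]; first by exists 0%N.
  have [M' HM'] := fg e; exists (maxn M M') => m; rewrite geq_max => /andP[/HM Hm /HM' Hm'] x.
  by rewrite inE => /orP[/eqP->|/Hm].
exists M => m /HM Hm x; apply: (span_min (N := [set x | f m x = g m x])) (sP x) => //.
split=> [|u v /= uE vE|a u /= uE]; first by rewrite /= !linear0.
  by rewrite !linearD uE vE.
by rewrite !linearZ uE.
Qed.

(** As [T] has finitely many generators, a map to the reduced product is represented by linear
    families that are chain maps from some index on. Their null-homotopies assemble to one of the
    given map. *)
Lemma germ_hz0 T (C : nat -> complex A) : perfect T ->
  (exists M : nat, forall m, (M <= m)%N -> hz0 T (C m)) -> hz0 T (germ_complex C).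
Proof.
move=> [[N bT] pT] [M0 TC] f.
have /all_sig[F FE] i := cid (germ_lin_lift (f i) (pT i).1 (pT i).2).
have FC i : exists M : nat, forall m, (M <= m)%N ->
    forall x, F (i + 1) m (cdiff T i (i + 1) x) = cdiff (C m) i (i + 1) (F i m x).
  apply: (eventually_lin (f := fun m => F (i + 1) m \o cdiff T i (i + 1))
    (g := fun m => cdiff (C m) i (i + 1) \o F i m)); first exact: (pT i).1.
  move=> x; apply/gpi_eq; rewrite -[LHS]/(gpi (fun m => F (i + 1) m (cdiff T i (i + 1) x))).
  by rewrite -FE cfunC FE germ_complexE.
have [M1 HM1] := eventually_bounded N FC.
have FC' m : (M1 <= m)%N -> forall i j x, j = i + 1 -> F j m (cdiff T i j x) = cdiff (C m) i j (F i m x).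
  move=> Mm i j x ->; have [iN|/(HM1 m Mm)//] := ltnP N `|i|%N.
  by rewrite (bT i iN x) !linear0.
(* For small [m] the family need not be a chain map and the homotopy is set to 0, which does not
   affect the germ. *)
have /all_sig[h hE] m : {h : forall i j, {linear T i -> C m j} | (maxn M0 M1 <= m)%N ->
    forall i j l x, j + 1 = i -> l = i + 1 ->
    F i m x = cdiff (C m) j i (h i j x) + h l i (cdiff T i l x)}.
  apply: cid; case: leqP => [|_]; last by exists (fun i j => \0).
  rewrite geq_max => /andP[Mm0 Mm1].
  by have [h hE] := TC m Mm0 (mkcmap (f := fun i => F i m) (FC' m Mm1)); exists h.
have H i j : linear (fun x => gpi (fun m => h m i j x) : germ_complex C j).
  move=> a x y; rewrite -[RHS](@linearP _ _ _ _ (@gpi _ _)).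
  by congr gpi; apply: functional_extensionality_dep => m; rewrite linearP.
exists (fun i j => mklin (H i j)) => i j l x ji li.
rewrite !mklinE FE. rewrite germ_mapE -[RHS](@linearD _ _ _ _ (@gpi _ _)).
apply/gpi_eq; exists (maxn M0 M1) => m Mm.
exact: hE.
Qed.

Lemma germ_shift (C : nat -> complex A) n :
  hiso (germ_complex (fun m => shift (C m) n)) (shift (germ_complex C) n).
Proof.
have E i j x : cdiff (germ_complex (fun m => shift (C m) n)) i j x
    = cdiff (shift (germ_complex C) n) i j x.
  rewrite -[x]gpi_repr germ_complexE shiftE germ_complexE -(lin_mulz (@gpi _ _)); congr gpi.
  apply: functional_extensionality_dep => m.
  have evL : linear (fun u : fam (fun m => shift (C m) n j) => u m) by [].
  by have := lin_mulz (mklin evL) (fun m => cdiff (C m) (i + n) (j + n) (repr x m)) (sg n); rewrite !mklinE.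
by apply: (@hiso_strict _ _ _ (@CMap _ (germ_complex (fun m => shift (C m) n)) (shift (germ_complex C) n)
    (fun i => idfun) E) (@CMap _ (shift (germ_complex C) n) (germ_complex (fun m => shift (C m) n))
    (fun i => idfun) (fun i j x => esym (E i j x)))).
Qed.

Lemma germ_hz T (C : nat -> complex A) n : perfect T ->
  (exists M : nat, forall m, (M <= m)%N -> hz n T (C m)) -> hz n T (germ_complex C).
Proof. by move=> pT TC; apply: hz0_isor (germ_shift C n) _; apply: germ_hz0. Qed.

Lemma cocycle_submod (C : complex A) i : submod (@cocycle A C i).
Proof.
split=> [|x y xZ yZ|a x xZ]; rewrite /cocycle /=; first exact: linear0.
  by rewrite linearD (xZ : _ = 0) (yZ : _ = 0) addr0.
by rewrite linearZ (xZ : _ = 0) /= scaler0.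
Qed.
Lemma coboundary_submod (C : complex A) i : submod (@coboundary A C i).
Proof.
split=> [|_ _ [u ->] [v ->]|a _ [u ->]]; first by exists 0; rewrite linear0.
  by exists (u + v); rewrite linearD.
by exists (a *: u); rewrite linearZ.
Qed.

(** If the complexes were not eventually exact, Nakayama would provide a germ of
cocycles outside the radical, against the definition of torsion-silting for
the complex of germs. *)
Lemma torsion_silting_exact T (C : nat -> complex A) j : torsion_silting T ->
  (forall i, exists M : nat, forall m, (M <= m)%N -> hz i T (C m)) ->
  (forall m, exists s : seq (C m j), {in s, forall e, cocycle e} /\
     forall z, cocycle z -> span s z) ->
  exists M : nat, forall m, (M <= m)%N -> exact_at (C m) j.
Proof.
move=> [[pT _] tT] TC fC.
have rC : cohomology_in_radical (germ_complex C) j.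
  move: j {fC}; apply: tT => i; apply/(dhom_zeroP _ (perfect_shift _ pT)).
  by apply/hz_0/hz_shiftl; apply: germ_hz.
pose R m (z : C m j) := exists n (y : 'I_n -> C m j) (r : 'I_n -> A),
  [/\ forall l, cocycle (y l), forall l, jacobson_radical (r l) &
      coboundary (z - \sum_(l < n) (r l : A^c) *: y l)].
(* The cocycle [z m] violates [R m] if any cocycle does, so knowing [R m] for [z m] gives it for all
   cocycles. *)
have /all_sig2[z zZ zR] m : {z : C m j | cocycle z & R m z -> forall z', cocycle z' -> R m z'}.
  apply: cid2; have [[z zZ zR]|nz] := pselect (exists2 z, @cocycle _ (C m) j z & ~ R m z).
    by exists z.
  exists 0; first by have [] := cocycle_submod (C m) j.
  by move=> _ z' zZ'; apply: contrapT => zR'; apply: nz; exists z'.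
have [|n [y [r [yZ rJ [w zE]]]]] := rC (gpi z).
  rewrite /cocycle /= mklinE germ_mapE -(linear0 (@gpi _ _)).
  by congr gpi; apply: functional_extensionality_dep => m; apply: zZ.
have yE l : exists M : nat, forall m, (M <= m)%N -> cocycle ((repr (y l) : fam (fun m => C m j)) m).
  have := yZ l; rewrite /cocycle /= -[y l]gpi_repr mklinE germ_mapE -(linear0 (@gpi _ _)).
  by move=> /gpi_eq[M HM]; exists M => m /HM; rewrite gpi_repr.
have [M1 HM1] : exists M : nat, forall m, (M <= m)%N -> forall l,
     cocycle ((repr (y l) : fam (fun m => C m j)) m).
  have /choice[M HM] := yE; exists (\max_l M l)%N => m Mm l; apply: HM.
  exact: leq_trans (leq_bigmax l) Mm.
have [M2 HM2] : exists M : nat, forall m, (M <= m)%N ->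
    z m - \sum_(l < n) (r l : A^c) *: (repr (y l) : fam (fun m => C m j)) m
    = cdiff (C m) (j - 1) j ((repr w : fam (fun m => C m (j - 1))) m).
  have : gpi ((z : fam (fun m => C m j)) - \sum_(l < n) (r l : A^c) *: (repr (y l) : fam (fun m => C m j)))
      = gpi (fun m => cdiff (C m) (j - 1) j ((repr w : fam (fun m => C m (j - 1))) m)).
    rewrite linearB linear_sum -[RHS]germ_complexE gpi_repr -zE; congr (_ - _).
  move=> /gpi_eq[M HM]; exists M => m /HM <-.
  by rewrite -[RHS]/(z m - (\sum_(l < n) (r l : A^c) *: (repr (y l) : fam (fun m => C m j))) m) fam_sum.
exists (maxn M1 M2) => m; rewrite geq_max => /andP[/HM1 yZm /HM2 zEm].
have [s [sZ Zs]] := fC m.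
apply: (rad_nakayama (cocycle_submod _ _) (coboundary_submod _ _) sZ Zs).
apply: zR; exists n, (fun l => (repr (y l) : fam (fun m => C m j)) m), r; split=> //.
by rewrite zEm; exists ((repr w : fam (fun m => C m (j - 1))) m).
Qed.
End GermComplex.

(** * Detection and exactness under reduction *)

Section Transfer.
Variables (k : fieldType) (G : pzRingType) (iota : central_embedding k G).
Hypothesis iotaO : is_order iota.
Local Notation X := (fps_X k).
Local Notation bc := (base_change (to_modX iota)).
Let iotaC := cemb_central iota.
Let pK := @fps_principal k.
Let fG := order_kfinite iotaO.
Implicit Types T S Q : complex G.

Lemma kmod_span (M : rmodType G) (s : seq (kmod iotaC M)) x : span s x -> @span G^c M s x.
Proof.
elim: s x => //= e s IH x [c [y [sy ->]]]; exists (iota c), y; split=> //.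
exact: IH.
Qed.

Lemma cocycle_fg (C : complex G) j : fin_generated (C j) ->
  exists s : seq (kmod iotaC (C j)), {in s, forall e, @cocycle _ C j e} /\
    forall z, @cocycle _ C j z -> span s z.
Proof.
move=> fC; have [t tC] := kmod_fg iotaC fG fC.
have [|//|s sZ Zs] := @submod_fg _ (kmod iotaC (C j)) t (@cocycle _ C j) pK.
  by have [Z0 ZD ZZ] := cocycle_submod C j; split=> // a x /ZZ; apply.
by exists s.
Qed.

Lemma fg_restr (N : rmodType (modX iota)) : fin_generated N -> fin_generated (restr (to_modX iota) N).
Proof.
move=> /fgP[s sN]; apply/fgP; exists s => x; have := sN x; elim: {sN} s x => [//|e s IH x] /=.
move=> [a [y [/IH sy ->]]]; have [b bE] := to_modX_surj a.
by exists b, y; split=> //; rewrite restrZ bE.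
Qed.

(** The sequence is restricted to [G], where its terms are no longer projective; finite generation
    of their cocycles over [k[[X]]] is all that is asked of them. *)
Lemma torsion_silting_detects T : torsion_silting T -> detects (bc T).
Proof.
move=> tT C pC TC j.
have [i||M HM] := torsion_silting_exact (C := fun m => crestr (to_modX iota) (C m)) (j := j) tT.
- by have [M HM] := TC i; exists M => m /HM /hz_bc.
- move=> m; have [|s [sZ Zs]] := @cocycle_fg (crestr (to_modX iota) (C m)) j.
    by apply: fg_restr; have [_ /(_ j)[]] := pC m.
  by exists s; split=> // z /Zs /kmod_span.
by exists M => m /HM; apply: exact_crestr.
Qed.

(** If a cocycle [z] becomes a boundary modulo [X], then [z - d w = X z'] and [z'] is a cocycle by
    regularity. So the cocycles are boundaries modulo [X] times cocycles, and Nakayama applies. *)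
Lemma exact_of_bc S j : perfect S -> exact_at (bc S) j -> exact_at S j.
Proof.
move=> pS eS.
have [s [sZ Zs]] := cocycle_fg (pS.2 j).1.
apply: (nakayama (V := kmod iotaC (S j)) (@fps_1BX_unit k) _ sZ Zs).
  by have [Z0 ZD ZZ] := coboundary_submod S j; split=> // a x /ZZ; apply.
move=> z dz.
have [|u uE] := eS (tens_unit (to_modX iota) (S j) z).
  suff : cdiff (bc S) j (j + 1) (tens_unit (to_modX iota) (S j) z) = 0 by [].
  by rewrite bc_diff_unit (dz : _ = 0) linear0.
have [w wE] := modX_unit_surj u.
have [z' zE] : exists z', z - cdiff S (j - 1) j w = xscale iota (S j) z'.
  by apply/modX_unit_eq0; rewrite linearB uE -wE bc_diff_unit subrr.
exists (cdiff S (j - 1) j w), z'; split; first by exists w.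
  apply: (perfect_regular iotaO pS); rewrite -lin_xscale -zE linearB (dz : _ = 0).
  by rewrite cdiffK subrr.
by rewrite kmodZ -xscaleE -zE subrKC.
Qed.

Lemma detects_of_bc T : perfect T -> detects (bc T) -> detects T.
Proof.
move=> pT dT C pC TC j.
have [m|i|M HM] := dT (fun m => bc (C m)) _ _ j.
- exact: perfect_base_change.
- have [[M HM] [M' HM']] := (TC i, TC (i + 1)); exists (maxn M M') => m.
  by rewrite geq_max => /andP[/HM ? /HM' ?]; apply: hz_bc_of_hz.
by exists M => m /HM; apply: exact_of_bc.
Qed.
End Transfer.

(** * Lifting complexes modulo X *)

Section FixedSubmodule.
Variables (R : pzRingType) (V : lmodType R) (f : {linear V -> V}).

(** For idempotent [f] the fixed vectors are its image; as a decidable predicate they inherit the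
    module structure through a subtype. *)
Definition fixed_pred : {pred V} := fun v => f v == v.
Fact fixed_submod : submod_closed fixed_pred.
Proof.
split=> [|a u v]; rewrite !unfold_in ?linear0 // => /eqP fu /eqP fv.
by rewrite linearP fu fv.
Qed.
HB.instance Definition _ := GRing.isSubmodClosed.Build R V fixed_pred fixed_submod.

Record fixmod := Fixmod { fix_val :> V; _ : fix_val \in fixed_pred }.
HB.instance Definition _ := [isSub for fix_val].
HB.instance Definition _ := [Choice of fixmod by <:].
HB.instance Definition _ := [SubChoice_isSubLmodule of fixmod by <:].

Definition fix_in : {linear fixmod -> V} := val.
Lemma fix_inP u : f (fix_in u) = fix_in u.
Proof. by case: u => v /= /eqP. Qed.

Hypothesis ff : forall v, f (f v) = f v.
Fact fix_mem v : f v \in fixed_pred. Proof. by rewrite unfold_in ff. Qed.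
Fact fix_out_linear : linear (fun v => Fixmod (fix_mem v)).
Proof. by move=> a u v; apply: val_inj; rewrite /= linearP. Qed.
Definition fix_out := mklin fix_out_linear.
Lemma fix_outE v : fix_in (fix_out v) = f v.
Proof. by rewrite mklinE. Qed.
Lemma fix_inK u : fix_out (fix_in u) = u.
Proof. by apply: val_inj; rewrite mklinE /=; exact: fix_inP. Qed.
End FixedSubmodule.

Section Recursion.
Variables (T H : Type) (Q : nat -> T -> Prop) (st : nat -> T -> H -> T) (a0 : T).
Fixpoint st_rec (h : nat -> H) n := if n is n'.+1 then st n' (st_rec h n') (h n') else a0.
(** The conclusion exposes the choices [h] and not only the states, because the limits below are
    series in the corrections [h n]. *)
Lemma dependent_choice_step : Q 0%N a0 -> (forall n a, Q n a -> exists h, Q n.+1 (st n a h)) ->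
  exists h : nat -> H, forall n, Q n (st_rec h n).
Proof.
move=> Q0 QS.
pose next n (a : {a | Q n a}) := cid (QS n (sval a) (proj2_sig a)).
pose f := fix f n : {a | Q n a} :=
  if n is n'.+1 then exist _ (st n' (sval (f n')) (sval (next n' (f n')))) (proj2_sig (next n' (f n')))
  else exist _ a0 Q0.
exists (fun n => sval (next n (f n))) => n.
suff -> : st_rec (fun n => sval (next n (f n))) n = sval (f n) by exact: proj2_sig.
by elim: n => //= n ->.
Qed.
End Recursion.

(** * Lifting idempotents along the powers of a central element *)

Section IdempotentLift.
Variables (B : pzRingType) (x : B).
Hypothesis xC : forall b, x * b = b * x.
Hypothesis xreg : forall b, x * b = 0 -> b = 0.
Hypothesis xsep : forall b, (forall n, exists w, b = x ^+ n * w) -> b = 0.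
Hypothesis xcomplete : forall u : nat -> B, exists s, forall n, exists w,
  s = \sum_(i < n) x ^+ i * u i + x ^+ n * w.

Lemma xnC n b : x ^+ n * b = b * x ^+ n.
Proof.
by elim: n => [|n IH]; rewrite ?expr0 ?mul1r ?mulr1 // exprS -mulrA IH mulrA xC !mulrA.
Qed.
Lemma xnreg n b : x ^+ n * b = 0 -> b = 0.
Proof.
by elim: n => [|n IH]; rewrite ?expr0 ?mul1r // exprS -mulrA => /xreg.
Qed.

Lemma idem_defectD (a z : B) :
  (a + z) * (a + z) - (a + z) = (a * a - a) + (a * z + z * a - z) + z * z.
Proof.
rewrite mulrDl !mulrDr opprD addrACA [a * a + _ - a]addrAC [z * a + _ - _]addrAC.
by rewrite !addrA.
Qed.

Lemma idem_step n a w : a * a - a = x ^+ n.+1 * w ->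
  exists h w', let a' := a + x ^+ n.+1 * h in a' * a' - a' = x ^+ n.+2 * w'.
Proof.
set y := x ^+ n.+1 => awE.
have yC b : y * b = b * y by apply: xnC.
have aw : w * a = a * w.
  apply/eqP; rewrite -subr_eq0; apply/eqP/(@xnreg n.+1); rewrite -/y mulrBr !mulrA [y * a]yC -awE.
  by rewrite -[a * y * w]mulrA -awE mulrBl mulrBr mulrA subrr.
(* The Newton step: [h = (1 - 2 a) w] turns [a] into [3 a^2 - 2 a^3]. The terms of first order in
   [y] leave [- 4 y w^2], so the new defect is divisible by [y^2], hence by [x^(n+2)]. *)
pose h := w - (a * w) *+ 2.
exists h, (x ^+ n * (h * h - (w * w) *+ 4)) => /=.
have ha : h * a = a * h by rewrite /h mulrBl mulrBr mulrnAl mulrnAr aw -!mulrA aw.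
have E : w + (a * h + a * h) - h = - (y * (w * w)) *+ 4.
  have -> : y * (w * w) = a * (a * w) - a * w by rewrite mulrA -awE mulrBl mulrA.
  rewrite /h mulrBr mulrnAr opprB; move: (a * w) (a * (a * w)) => p q.
  rewrite addrC -addrA [- w + _]addrA addNr add0r -mulr2n mulrnBl -mulrnA addrA -mulrnDr.
  by rewrite mulNrn mulrnBl opprB.
have -> : x ^+ n.+2 * (x ^+ n * (h * h - (w * w) *+ 4)) = y * (y * (h * h - (w * w) *+ 4)).
  by rewrite !mulrA /y -!exprD addSnnS.
rewrite idem_defectD awE; clearbody h.
have -> : y * h * (y * h) = y * (y * (h * h)) by rewrite -!mulrA [h * (y * h)]mulrA -yC !mulrA.
have -> : a * (y * h) = y * (a * h) by rewrite mulrA -yC mulrA.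
have -> : y * h * a = y * (a * h) by rewrite -mulrA ha.
rewrite -!mulrDr -mulrBr -!mulrDr [w + (_ - h)]addrA [a * (h + h)]mulrDr E addrC mulrBr.
by rewrite mulNrn mulrnAr.
Qed.

Lemma idem_lift a w : a * a - a = x * w -> exists e v, e * e = e /\ e - a = x * v.
Proof.
move=> aw.
pose Q n (b : B) := exists w, b * b - b = x ^+ n.+1 * w.
have [||h Qh] := @dependent_choice_step B B Q (fun n b h => b + x ^+ n.+1 * h) a.
- by exists w; rewrite expr1.
- by move=> n b [w' /idem_step[h [w'' hE]]]; exists h, w''.
(* The states of the recursion are the partial sums of the series with initial term [a] and
   coefficient [h n] at [x^(n+1)]. *)
have [e eE] := xcomplete (fun n => if n is n'.+1 then h n' else a).
have eE' n : exists v, e = st_rec (fun n b h => b + x ^+ n.+1 * h) a h n + x ^+ n.+1 * v.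
  have [v ->] := eE n.+1; exists v; congr (_ + _).
  rewrite big_ord_recl expr0 mul1r; elim: n => [|n IH]; first by rewrite big_ord0 addr0.
  by rewrite big_ord_recr /= addrA IH.
have [v0 v0E] := eE' 0%N.
exists e, v0; split; last by rewrite v0E /= expr1 addrAC subrr add0r.
apply/eqP; rewrite -subr_eq0; apply/eqP; apply: xsep => n.
have [v ->] := eE' n; have [u] := Qh n; set b := st_rec _ _ _ _ => uE.
have yC c : x ^+ n.+1 * c = c * x ^+ n.+1 by apply: xnC.
exists (x * (u + (b * v + v * b + x ^+ n.+1 * (v * v)) - v)).
rewrite mulrA -exprSr; move: (x ^+ n.+1) yC uE => y yC uE.
rewrite idem_defectD uE.
have -> : y * v * (y * v) = y * (y * (v * v)) by rewrite -!mulrA [v * (y * v)]mulrA -yC !mulrA.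
have -> : b * (y * v) = y * (b * v) by rewrite mulrA -yC mulrA.
rewrite -[y * v * b]mulrA -mulrDr -mulrBr -!mulrDr; congr (_ * _).
by rewrite -!addrA; congr (_ + (_ + (_ + _))); rewrite addrC.
Qed.
End IdempotentLift.

Section ModuleLift.
Variables (k : fieldType) (G : pzRingType) (iota : central_embedding k G).
Hypothesis iotaO : is_order iota.
Local Notation X := (fps_X k).
Local Notation phi := (to_modX iota).
Let iotaC := cemb_central iota.
Implicit Types (M P : rmodType G) (N Q : rmodType (modX iota)).


Lemma matrix_idem_lift n (a : 'M[G^c]_n) :
  (exists w : 'M[G^c]_n, a *m a - a = (iota X : G^c) *: w) ->
  exists e v : 'M[G^c]_n, e *m e = e /\ e - a = (iota X : G^c) *: v.
Proof.
move=> [w aw]; have [r s c] := order_adic iotaO n n.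
pose x : 'M[G^c]_n := (iota X : G^c)%:M.
have xE (b : 'M[G^c]_n) : x * b = (iota X : G^c) *: b by rewrite -mul_scalar_mx.
have xnE m (b : 'M[G^c]_n) : x ^+ m * b = X ^+ m *: (b : kmod iotaC 'M[G^c]_n).
  elim: m b => [|m IH] b; first by rewrite expr0 mul1r scale1r.
  by rewrite exprS -mulrA IH xE exprS -scalerA.
have [|||||e [v [ee ev]]] := @idem_lift 'M[G^c]_n x _ _ _ _ a w.
- move=> b; apply/matrixP => i j; rewrite xE -[b * x]/(b *m x) !mxE (bigD1 j) //=.
  rewrite !mxE eqxx mulr1n big1 ?addr0 => [|l lj]; last by rewrite !mxE (negPf lj) mulr0.
  by rewrite -[LHS]/((b i j : G) * iota X) -[RHS]/(iota X * (b i j : G)) iotaC.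
- by move=> b; rewrite xE; apply: r.
- by move=> b H; apply: s => m; have [u ->] := H m; exists u; rewrite xnE.
- move=> u; have [t tE] := c u; exists t => m; have [v vE] := tE m; exists v.
  by rewrite xnE vE; congr (_ + _); apply: eq_bigr => i _; rewrite xnE.
- by rewrite xE.
by exists e, v; split; [exact: ee | rewrite ev xE].
Qed.

Section RowReduction.
Variable n : nat.
Local Notation rV := 'rV[G^c]_n.
Local Notation rV' := 'rV[(modX iota)^c]_n.
Definition row_red_fun (v : rV) : restr phi rV' := (\row_j (phi (v 0 j) : (modX iota)^c) : rV').
Fact row_red_linear : linear row_red_fun.
Proof.
move=> a u v; rewrite restrZ; apply/rowP => j; rewrite !mxE.
by rewrite rmorphD rmorphM.
Qed.
Definition row_red : {linear rV -> restr phi rV'} := mklin row_red_linear.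
Lemma row_redE v j : (row_red v : rV') 0 j = phi (v 0 j).
Proof. by rewrite mklinE mxE. Qed.
Lemma row_red_surj (y : rV') : exists x, row_red x = y.
Proof.
have /choice[b bE] := fun j => to_modX_surj (y 0 j).
by exists (\row_j (b j : G^c)); apply/rowP => j; rewrite row_redE mxE.
Qed.
Lemma row_red_eq0 v : row_red v = 0 <-> exists w, v = xscale iota rV w.
Proof.
split=> [v0|[w ->]]; last first.
  apply/rowP => j; rewrite row_redE xscaleE mxE [RHS]mxE.
  by apply/to_modX_eq0; exists (w 0 j); exact/esym/iotaC.
have /choice[b bE] j : exists b, v 0 j = iota X * b.
  apply/to_modX_eq0; rewrite -row_redE v0; exact: mxE.
exists (\row_j (b j : G^c)); apply/rowP => j.
by rewrite xscaleE bE !mxE; exact: iotaC.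
Qed.
End RowReduction.

Lemma module_lift Q : fin_generated Q -> projective Q ->
  exists (P : rmodType G) (p : {linear P -> restr phi Q}),
  [/\ fin_generated P, projective P, forall y, exists x, p x = y &
      forall x, p x = 0 <-> exists x', x = xscale iota P x'].
Proof.
move=> fQ pQ; have [n [p [s ps]]] := fgproj_split fQ pQ.
pose red := row_red n.
have mulL (a : 'M[G^c]_n) : linear (fun v : 'rV[G^c]_n => v *m a).
  by move=> c u v; rewrite mulmxDl -scalemxAl.
have /choice[ar arE] := fun i : 'I_n => @row_red_surj n (s (p (delta_mx 0 i))).
(* The matrix of the idempotent [s p] with its rows lifted to [G]: idempotent only modulo [X], which
   the next step repairs. *)
pose a : 'M[G^c]_n := \matrix_i ar i.
have redA v : red (v *m a) = s (p (red v)).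
  pose f : {linear 'rV[G^c]_n -> restr phi 'rV_n} := red \o mklin (mulL a).
  pose g : {linear 'rV[G^c]_n -> restr phi 'rV_n} := restr_lin phi (s \o p) \o red.
  suff fg : f v = g v by move: fg; rewrite /f /g /= (mklinE (mulL a)) => ->; exact: restr_linE.
  rewrite (lin_row f) (lin_row g); apply: eq_bigr => i _; congr (_ *: _).
  rewrite /f /g /= (mklinE (mulL a)) restr_linE -rowE rowK arE; congr (s (p _)).
  apply/rowP => j; rewrite row_redE !mxE eqxx.
  by case: (j == i); rewrite /= ?mulr1n ?mulr0n; [apply: esym (rmorph1 phi) | apply: esym (rmorph0 phi)].
have red_eq0M (v : 'M[G^c]_n) : (forall i, red (row i v) = 0) ->
    exists w : 'M[G^c]_n, v = (iota X : G^c) *: w.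
  move=> v0; have /choice[w wE] i : exists w, row i v = xscale iota _ w by apply/row_red_eq0.
  exists (\matrix_i w i); apply/row_matrixP => i.
  by rewrite wE xscaleE linearZ /= rowK.
have [|e [v [ee ev]]] := @matrix_idem_lift n a.
  apply: red_eq0M => i; rewrite linearB /= linearB !rowE mulmxA !redA ps.
  by rewrite subrr.
have redE u : red (u *m e) = s (p (red u)).
  rewrite -redA; apply/eqP; rewrite -subr_eq0 -linearB -mulmxBr ev; apply/eqP.
  apply/row_red_eq0; exists (u *m v); rewrite xscaleE; apply/rowP => j.
  rewrite !mxE mulr_sumr; apply: eq_bigr => l _; rewrite mxE mulrA [RHS]mulrA.
  by congr (_ * _); exact: iotaC.
pose E := mklin (mulL e).
have EE u : E (E u) = E u by rewrite !(mklinE (mulL e)) -mulmxA ee.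
pose q : {linear fixmod E -> restr phi Q} := restr_lin phi p \o (red \o fix_in E).
exists (fixmod E), q; split.
- by apply: (fg_surj (f := fix_out EE)) (fg_row G n) => u; exists (fix_in E u); apply: fix_inK.
- by apply: (@proj_retract _ _ _ (fix_in E) (fix_out EE)); [exact: fix_inK | exact: proj_row].
- move=> y; have [u uE] := row_red_surj (s y); exists (fix_out EE u).
  by rewrite -[q _]/(restr_lin phi p (red (fix_in E (fix_out EE u)))) restr_linE fix_outE (mklinE (mulL e)) redE uE !ps.
move=> x; split=> [|[x' ->]]; last first.
  rewrite xscaleE linearZ /= restrZ.
  have -> : phi (iota X) = 0 by apply/to_modX_eq0; exists 1; rewrite mulr1.
  by rewrite scale0r.
rewrite -[q x]/(restr_lin phi p (red (fix_in E x))) restr_linE => px.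
have [w wE] : exists w, fix_in E x = xscale iota _ w.
  apply/row_red_eq0; rewrite -(fix_inP x) (mklinE (mulL e)) redE px linear0 //.
exists (fix_out EE w); apply: (can_inj (fix_inK EE)).
by rewrite lin_xscale fix_outE -lin_xscale -wE fix_inP.
Qed.
End ModuleLift.

Lemma bijective_hiso (A : pzRingType) (X Y : complex A) (f : cmap X Y) :
  (forall i y, exists x, f i x = y) -> (forall i x, f i x = 0 -> x = 0) -> hiso X Y.
Proof.
move=> fs fi.
have finj i : injective (f i).
  by move=> x y fxy; apply/eqP; rewrite -subr_eq0; apply/eqP/fi; rewrite linearB fxy subrr.
have /all_sig[g gE] i : {g : Y i -> X i | forall y, f i (g y) = y}.
  by have [h hE] := choice (fs i); exists h.
have gL i : linear (g i) by move=> a x y; apply: finj; rewrite linearP !gE.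
have gC i j x : j = i + 1 -> mklin (gL j) (cdiff Y i j x) = cdiff X i j (mklin (gL i) x).
  by move=> _; apply: finj; rewrite !mklinE gE cfunC gE.
apply: (hiso_strict (f := f) (g := mkcmap gC)) => i x /=; rewrite mklinE ?gE //.
by apply: finj; rewrite gE.
Qed.

(** * Lifting the differential *)

Section ComplexLift.
Variables (k : fieldType) (G : pzRingType) (iota : central_embedding k G).
Hypothesis iotaO : is_order iota.
Local Notation X := (fps_X k).
Local Notation phi := (to_modX iota).
Let iotaC := cemb_central iota.
Implicit Types (M P : rmodType G) (N Q : rmodType (modX iota)).

Lemma xscale_restr N (x : restr phi N) : xscale iota _ x = 0.
Proof.
rewrite xscaleE restrZ.
have -> : phi (iota X) = 0 by apply/to_modX_eq0; exists 1; rewrite mulr1.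
by rewrite scale0r.
Qed.

Lemma modX_factor P Q N (p : {linear P -> restr phi Q}) (g : {linear P -> restr phi N}) :
  (forall y, exists x, p x = y) -> (forall x, p x = 0 -> exists x', x = xscale iota P x') ->
  exists h : {linear Q -> N}, forall x, h (p x) = g x.
Proof.
move=> ps pK; have /choice[c cE] := ps.
have gE x y : p x = p y -> g x = g y.
  move=> pxy; apply/eqP; rewrite -subr_eq0 -linearB; apply/eqP.
  have [|z ->] := pK (x - y); first by rewrite linearB pxy subrr.
  by rewrite lin_xscale xscale_restr.
have hL : linear ((fun y => g (c y)) : Q -> N).
  move=> a y z; have [b <-] := to_modX_surj a.
  rewrite -[RHS]/((b : G^c) *: g (c y) + g (c z)) -linearP; apply: gE.
  by rewrite linearP !cE.
by exists (mklin hL) => x; rewrite mklinE; apply: gE; rewrite cE.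
Qed.

Fact xnscale_linear n M : linear (fun m : M => (iota (X ^+ n) : G^c) *: m).
Proof. by move=> a x y; rewrite scalerDr !scalerA -[_ * _](iotaC (X ^+ n) a). Qed.
Definition xnscale n M := mklin (@xnscale_linear n M).
Lemma xnscaleE n M m : xnscale n M m = (iota (X ^+ n) : G^c) *: m. Proof. exact: mklinE. Qed.
Lemma lin_xnscale n P M (f : {linear P -> M}) m : f (xnscale n P m) = xnscale n M (f m).
Proof. by rewrite !xnscaleE linearZ. Qed.
Lemma xnscaleD m n M x : xnscale m M (xnscale n M x) = xnscale (m + n) M x.
Proof. by rewrite !xnscaleE scalerA exprD rmorphM -[_ * _]iotaC -rmorphM mulrC rmorphM. Qed.
Lemma xnscale1 M x : xnscale 1 M x = xscale iota M x.
Proof. by rewrite xnscaleE xscaleE expr1. Qed.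
Lemma xnscale_regular n M : fin_generated M -> projective M -> forall x, xnscale n M x = 0 -> x = 0.
Proof.
move=> fM pM; elim: n => [|n IH] x; first by rewrite xnscaleE expr0 rmorph1 scale1r.
by rewrite -addn1 -xnscaleD xnscale1 => /IH; apply: fgproj_regular.
Qed.

Section Lift.
Variables (T' : complex (modX iota)) (P : int -> rmodType G).
Variable p : forall i, {linear P i -> restr phi (T' i)}.
Hypothesis fP : forall i, fin_generated (P i).
Hypothesis pP : forall i, projective (P i).
Hypothesis p_surj : forall i y, exists x, p i x = y.
Hypothesis p_eq0 : forall i x, p i x = 0 <-> exists x', x = xscale iota (P i) x'.
Hypothesis T'2 : hz 2 T' T'.

Local Notation pre := (forall i j : int, {linear P i -> P j}).

(** Families lifting the differential of [T'] whose square vanishes modulo [X^(n+1)]. *)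
Definition predifferential n (d : pre) :=
  [/\ forall i j, j <> i + 1 -> forall x, d i j x = 0,
      forall i j x, p j (d i j x) = cdiff T' i j (p i x) &
      forall i j l x, exists y, d j l (d i j x) = xnscale n.+1 (P l) y].

(** The predicate [Q] marks the pairs of degrees with a component to be lifted; setting the others
    to 0 keeps the shape condition of a differential. *)
Lemma lift_family (Q : int -> int -> bool) (h : forall i j : int, {linear P i -> restr phi (T' j)}) :
  exists H : pre, forall i j, (Q i j -> forall x, p j (H i j x) = h i j x) /\
    (~~ Q i j -> forall x, H i j x = 0).
Proof.
suff /all_sig[H HE] i : {H : forall j, {linear P i -> P j} | forall j,
    (Q i j -> forall x, p j (H j x) = h i j x) /\ (~~ Q i j -> forall x, H j x = 0)} by exists H.
suff /all_sig[H HE] j : {H : {linear P i -> P j} |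
    (Q i j -> forall x, p j (H x) = h i j x) /\ (~~ Q i j -> forall x, H x = 0)} by exists H.
apply: cid; case: (Q i j); last by exists \0.
have [|H HE] := @fgproj_lift _ (P i) _ _ (p j) (h i j) (@fP i) (@pP i); last by exists H.
by move=> x; apply: p_surj.
Qed.

Lemma predifferential0 : exists d, predifferential 0 d.
Proof.
have [d dE] := @lift_family (fun i j => j == i + 1) (fun i j => restr_lin phi (cdiff T' i j) \o p i).
have d0 i j : j <> i + 1 -> forall x, d i j x = 0.
  by move=> /eqP ij; apply: (dE i j).2.
have dp i j x : p j (d i j x) = cdiff T' i j (p i x).
  have [/eqP ij|ij] := pselect (j = i + 1); first by rewrite (dE i j).1 //= restr_linE.
  by rewrite d0 // linear0 cdiff_shape.
exists d; split=> // i j l x.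
have [|y ->] := (p_eq0 (d j l (d i j x))).1; first by rewrite !dp cdiffK.
by exists y; rewrite xnscale1.
Qed.

(** Dividing the square of [d] by [X^(n+1)] gives [W], whose reduction is a chain map from [T'] to
    [T'[2]]. A null-homotopy of it supplies the correction. *)
Lemma predifferentialS n (d : pre) : predifferential n d ->
  exists h : pre, predifferential n.+1 (fun i j => d i j \+ (xnscale n.+1 (P j) \o h i j)).
Proof.
move=> [d0 dp dd].
have reg i x : xnscale n.+1 (P i) x = 0 -> x = 0 by apply: xnscale_regular.
have /all_sig[W WE] : forall i, {W : forall l, {linear P i -> P l} | forall l x,
    xnscale n.+1 (P l) (W l x) = d (i + 1) l (d i (i + 1) x)}.
  move=> i; suff /all_sig[W WE] l : {W : {linear P i -> P l} | forall x,
    xnscale n.+1 (P l) (W x) = d (i + 1) l (d i (i + 1) x)} by exists W.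
  apply: cid; apply: (fgproj_lift (f := d (i + 1) l \o d i (i + 1))) => // x.
  by have [y yE] := dd i (i + 1) l x; exists y.
have WC i l l' x : l = i + 1 + 1 -> l' = l + 1 ->
    d l l' (W i l x) = W (i + 1) l' (d i (i + 1) x).
  move=> -> ->; apply/eqP; rewrite -subr_eq0; apply/eqP/reg.
  by rewrite linearB -(lin_xnscale _ (d _ _)) !WE subrr.
have /all_sig[w wE] i : {w : {linear T' i -> T' (i + 2)} | forall x,
    w (p i x) = p (i + 2) (W i (i + 2) x)}.
  apply: cid; apply: (@modX_factor _ _ _ (p i) (p (i + 2) \o W i (i + 2))); first exact: p_surj.
  by move=> x /p_eq0.
have s2 : sg 2 = 1 by rewrite -[2]/(1 + 1 : int) sgD sg2.
have wC i j y : j = i + 1 -> w j (cdiff T' i j y) = cdiff (shift T' 2) i j (w i y).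
  move=> ->; have [x <-] := p_surj y.
  rewrite -dp wE shiftE s2 mulr1z wE -dp; congr (p _ _).
  by apply/esym/WC; lia.
have [h hE] := T'2 (@mkcmap _ T' (shift T' 2) w wC).
have hE' i y : w i y = cdiff T' (i - 1 + 2) (i + 2) (h i (i - 1) y)
    + h (i + 1) i (cdiff T' i (i + 1) y).
  rewrite -[w i y]/(@mkcmap _ T' (shift T' 2) w wC i y).
  by rewrite (hE i (i - 1) (i + 1)) ?subrK // shiftE s2.
(* The sign is chosen so that [W + d H + H d] vanishes modulo [X]. *)
have [H HE] := @lift_family (fun i j => j == i + 1)
  (fun i j => restr_lin phi (tr T' (i - 1 + 2) j \o \- (h i (i - 1))) \o p i).
have Hp i j x : j = i + 1 -> p j (H i j x) = - tr T' (i - 1 + 2) j (h i (i - 1) (p i x)).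
  by move=> ij; rewrite (HE i j).1 /= ?restr_linE /= ?linearN //; apply/eqP.
have H0 i j x : j <> i + 1 -> H i j x = 0 by move=> /eqP ij; apply: (HE i j).2.
have pX i m (x : P i) : p i (xnscale m.+1 (P i) x) = 0.
  by apply/p_eq0; exists (xnscale m _ x); rewrite -xnscale1 xnscaleD.
exists H; split=> [i j ij x|i j x|i j l x] /=.
- by rewrite d0 // H0 // linear0 addr0.
- by rewrite linearD pX addr0 dp.
have [ij|ij] := pselect (j = i + 1); last first.
  by exists 0; rewrite (d0 i j) // (H0 i j) // !linear0 !addr0 !linear0 addr0.
have [jl|jl] := pselect (l = j + 1); last first.
  by exists 0; rewrite (d0 j l) // (H0 j l) // !linear0 addr0.
have [u uE] : exists u, W i l x + d j l (H i j x) + H j l (d i j x) = xscale iota (P l) u.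
  apply/p_eq0; rewrite !linearD dp (Hp i j x ij) (Hp j l (d i j x) jl) dp.
  have e : i + 2 = l by lia.
  have -> : p l (W i l x) = tr T' (i + 2) l (w i (p i x)).
    by clear jl; subst l; rewrite trid wE.
  have -> : tr T' (j - 1 + 2) l (h j (j - 1) (cdiff T' i j (p i x)))
      = tr T' (i + 2) l (h j i (cdiff T' i j (p i x))).
    have e' : i = j - 1 by lia.
    by clear e ij; subst i.
  have e1 : i - 1 + 2 = j by lia.
  rewrite linearN (diff_tr _ e1 e) hE' linearD; subst j.
  by rewrite addrAC addrK subrr.
(* The quadratic term of the new square is [X^(2n+2) H H]; dividing it by [X^(n+2)] leaves the
   factor [X^n]. *)
exists (u + xnscale n (P l) (H j l (H i j x))).
have -> : xnscale n.+2 (P l) (u + xnscale n (P l) (H j l (H i j x)))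
    = xnscale n.+1 (P l) (xscale iota (P l) u)
      + xnscale n.+1 (P l) (xnscale n.+1 (P l) (H j l (H i j x))).
  by rewrite linearD -xnscale1 !xnscaleD addn1 -addSnnS.
rewrite -uE !linearD (lin_xnscale _ (d j l)) (lin_xnscale _ (H j l)) WE -ij.
by rewrite !addrA.
Qed.

Lemma lift_terms_complex : (exists N : nat, forall i, (N < `|i|)%N -> forall x : T' i, x = 0) ->
  exists T : complex G, perfect T /\ hiso (base_change phi T) T'.
Proof.
move=> [N bT].
have reg i x : xscale iota (P i) x = 0 -> x = 0 by apply: fgproj_regular.
have sep i (x : P i) : (forall n, exists y, x = xnscale n (P i) y) -> x = 0.
  move=> H; have [_ s _] := fgproj_adic iotaO (@fP i) (@pP i); apply: s => n.
  by have [y ->] := H n; exists y; rewrite xnscaleE.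
have [d d_pre] := predifferential0.
have [h hP] := dependent_choice_step d_pre predifferentialS.
pose u i j n := if n is n'.+1 then h n' i j else d i j.
have /all_sig[L LE] i : {L : forall j, {linear P i -> P j} | forall j n x, exists y,
    L j x = st_rec (fun n (d h : pre) i j => d i j \+ (xnscale n.+1 (P j) \o h i j)) d h n i j x
      + xnscale n.+1 (P j) y}.
  suff /all_sig[L LE] j : {L : {linear P i -> P j} | forall n x, exists y,
    L x = st_rec (fun n (d h : pre) i j => d i j \+ (xnscale n.+1 (P j) \o h i j)) d h n i j x
      + xnscale n.+1 (P j) y} by exists L.
  apply: cid; have [L LE] := lim_lin (u i j) (fgproj_adic iotaO (@fP j) (@pP j)).
  exists L => n x; have [y ->] := LE n.+1 x; exists y; rewrite xnscaleE; congr (_ + _).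
  rewrite big_ord_recl expr0 scale1r; elim: n {y} => [|n IH]; first by rewrite big_ord0 addr0.
  by rewrite big_ord_recr /= addrA IH /= xnscaleE.
pose D n := st_rec (fun n (d h : pre) i j => d i j \+ (xnscale n.+1 (P j) \o h i j)) d h n.
have L0 i j : j <> i + 1 -> forall x, L i j x = 0.
  move=> ij x; apply: sep => n; have [y ->] := LE i j n x; have [D0 _ _] := hP n.
  by rewrite D0 // add0r; exists (xscale iota _ y); rewrite -xnscale1 xnscaleD addn1.
have LL i j l x : L j l (L i j x) = 0.
  apply: sep => n; have [y ->] := LE i j n x; have [_ _ /(_ i j l x)[z zE]] := hP n.
  rewrite linearD lin_xnscale; have [y' ->] := LE j l n (D n i j x).
  rewrite zE -!linearD; exists (xscale iota _ (z + y' + L j l y)).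
  by rewrite -xnscale1 xnscaleD addn1.
pose T := @Complex G P L L0 LL.
have pT : perfect T.
  split=> [|i]; last by split; [exact: fP | exact: pP].
  (* Where [T'] vanishes, each element of [P i] is divisible by [X], hence by all its powers, and is
     0 by separatedness. *)
  exists N => i Ni x; apply: sep; elim=> [|n [y ->]].
    by exists x; rewrite xnscaleE expr0 rmorph1 scale1r.
  have [y' ->] : exists y', y = xscale iota (P i) y' by apply/p_eq0; apply: (bT i Ni).
  by exists y'; rewrite -xnscale1 xnscaleD addn1.
exists T; split=> //.
have qC i j x : p j (cdiff T i j x) = cdiff (crestr phi T') i j (p i x).
  rewrite crestrE; have [y ->] := LE i j 0%N x; have [_ <- _] := d_pre.
  rewrite linearD xnscale1 /=.
  have -> : p j (xscale iota (P j) y) = 0 by apply/p_eq0; exists y.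
  exact: addr0.
pose q := @CMap G T (crestr phi T') p qC.
apply: (bijective_hiso (f := bc_ext q)) => [i y|i x].
  by have [x xE] := p_surj y; exists (tens_unit phi (P i) x); rewrite (bc_extE q).
have [m <-] := modX_unit_surj x; rewrite (bc_extE q) => /p_eq0[m' ->].
exact: modX_unit_xscale.
Qed.
End Lift.

Lemma complex_lift (T' : complex (modX iota)) : perfect T' -> hz 2 T' T' ->
  exists T : complex G, perfect T /\ hiso (base_change phi T) T'.
Proof.
move=> [bT pT] T2.
pose Pi i := cid (module_lift iotaO (pT i).1 (pT i).2).
pose pi i := cid (proj2_sig (Pi i)).
have H i := proj2_sig (pi i).
apply: (@lift_terms_complex T' (fun i => sval (Pi i)) (fun i => sval (pi i))) => // i.
- by case: (H i).
- by case: (H i).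
- by case: (H i).
by case: (H i).
Qed.
End ComplexLift.

(** * Krull-Schmidt property *)

Section SumAlgebra.
Variable A : pzRingType.
Implicit Types X Y Z W C S T U : complex A.

Fact csum_map_comm X X' Y Y' (f : cmap X X') (g : cmap Y Y') i j p :
  pair_lin (f j \o fst_lin (X j) (Y j)) (g j \o snd_lin (X j) (Y j)) (cdiff (csum X Y) i j p)
  = cdiff (csum X' Y') i j (pair_lin (f i \o fst_lin (X i) (Y i)) (g i \o snd_lin (X i) (Y i)) p).
Proof. by rewrite !pair_linE /= !cfunC. Qed.
Definition csum_map X X' Y Y' (f : cmap X X') (g : cmap Y Y') : cmap (csum X Y) (csum X' Y') :=
  @CMap A (csum X Y) (csum X' Y')
    (fun i => pair_lin (f i \o fst_lin (X i) (Y i)) (g i \o snd_lin (X i) (Y i)))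
    (@csum_map_comm X X' Y Y' f g).
Lemma csum_mapE X X' Y Y' (f : cmap X X') (g : cmap Y Y') i p :
  csum_map f g i p = (f i p.1, g i p.2).
Proof. exact: pair_linE. Qed.
Lemma csum_map_heq X X' Y Y' (f f' : cmap X X') (g g' : cmap Y Y') :
  f ~ f' -> g ~ g' -> csum_map f g ~ csum_map f' g'.
Proof.
move=> [h hE] [h' hE'].
exists (fun i j => pair_lin (h i j \o fst_lin (X i) (Y i)) (h' i j \o snd_lin (X i) (Y i))).
move=> i j l p ji li; rewrite cmapB !csum_mapE !pair_linE.
by apply: pairE; rewrite /= -?(hE i j l) -?(hE' i j l).
Qed.
Lemma hiso_csum X X' Y Y' : hiso X X' -> hiso Y Y' -> hiso (csum X Y) (csum X' Y').
Proof.
move=> /hisoP[f [g [gf fg]]] /hisoP[f' [g' [gf' fg']]]; apply/hisoP.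
exists (csum_map f f'), (csum_map g g').
have c U U' V V' W W' (a : cmap U V) (b : cmap V W) (a' : cmap U' V') (b' : cmap V' W') :
    cmap_comp (csum_map b b') (csum_map a a') = csum_map (cmap_comp b a) (cmap_comp b' a').
  by apply/cmapP => i p /=; rewrite !pair_linE.
have i U V : csum_map (cmap_id U) (cmap_id V) = cmap_id (csum U V).
  by apply/cmapP => i p /=; rewrite !pair_linE; case: p.
by split; rewrite c -i; apply: csum_map_heq.
Qed.
Lemma isum_sym W X Y : isum W X Y -> isum W Y X.
Proof.
move=> [i1 [i2 [p1 [p2 [e1 e2 z1 z2 e]]]]]; exists i2, i1, p2, p1; split=> //.
by rewrite addrC.
Qed.
Lemma csumC X Y : hiso (csum X Y) (csum Y X).
Proof. by apply/isumP/isum_sym/isumP; apply: hiso_refl. Qed.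
Lemma csumA X Y Z : hiso (csum X (csum Y Z)) (csum (csum X Y) Z).
Proof.
have C i j (p : csum X (csum Y Z) i) : j = i + 1 ->
  pair_lin (pair_lin (fst_lin (X j) (Y j * Z j)%type) (fst_lin (Y j) (Z j) \o snd_lin (X j) (Y j * Z j)%type))
     (snd_lin (Y j) (Z j) \o snd_lin (X j) (Y j * Z j)%type) (cdiff (csum X (csum Y Z)) i j p)
  = cdiff (csum (csum X Y) Z) i j (pair_lin (pair_lin (fst_lin (X i) (Y i * Z i)%type) (fst_lin (Y i) (Z i) \o snd_lin (X i) (Y i * Z i)%type))
     (snd_lin (Y i) (Z i) \o snd_lin (X i) (Y i * Z i)%type) p).
  by rewrite !pair_linE.
have C' i j (p : csum (csum X Y) Z i) : j = i + 1 ->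
  pair_lin (fst_lin (X j) (Y j) \o fst_lin (X j * Y j)%type (Z j))
    (pair_lin (snd_lin (X j) (Y j) \o fst_lin (X j * Y j)%type (Z j)) (snd_lin (X j * Y j)%type (Z j)))
     (cdiff (csum (csum X Y) Z) i j p)
  = cdiff (csum X (csum Y Z)) i j (pair_lin (fst_lin (X i) (Y i) \o fst_lin (X i * Y i)%type (Z i))
    (pair_lin (snd_lin (X i) (Y i) \o fst_lin (X i * Y i)%type (Z i)) (snd_lin (X i * Y i)%type (Z i))) p).
  by rewrite !pair_linE.
apply: (hiso_strict (f := @mkcmap _ (csum X (csum Y Z)) (csum (csum X Y) Z) _ C)
  (g := @mkcmap _ (csum (csum X Y) Z) (csum X (csum Y Z)) _ C')) => i.
  by move=> [x [y z]]; rewrite /= !pair_linE.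
by move=> [[x y] z]; rewrite /= !pair_linE.
Qed.
Lemma isum_zero X Y : nullh (cmap_id Y) -> hiso X (csum X Y).
Proof.
move=> Y0; apply/isumP; exists (cmap_id X), 0, (cmap_id X), 0.
have c0 U V W (f : cmap U V) : cmap_comp f (0 : cmap W U) = 0.
  by apply/cmapP => i x /=; rewrite linear0.
have c0' U V W (f : cmap U V) : cmap_comp (0 : cmap V W) f = 0 by apply/cmapP.
rewrite !c0 !c0' !comp_cmap1; split; try exact: heq_refl; try exact: nullh0.
  by apply: heq_sym; apply/heq0.
by rewrite addr0; apply: heq_refl.
Qed.

Lemma hzeroP X : hzero X <-> nullh (cmap_id X).
Proof. by rewrite /hzero homotopicP; split; rewrite -[cmap0 X X]/(0 : cmap X X) subr0. Qed.

Definition retract X Y := exists (a : cmap X Y) (b : cmap Y X), cmap_comp b a ~ cmap_id X.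


(** A null-homotopy of [f a] is just the datum needed to extend [f] to the cone, strictly and not
    only up to homotopy. *)
Lemma cone_extend X Y W (a : cmap X Y) (f : cmap Y W) : nullh (cmap_comp f a) ->
  exists g : cmap (cone a) W, cmap_comp g (cone_in a) = f.
Proof.
move=> [h hE].
pose g i : {linear cone a i -> W i} :=
  (h (i + 1) i \o fst_lin (X (i + 1)) (Y i)) \+ (f i \o snd_lin (X (i + 1)) (Y i)).
have gC i j p : j = i + 1 -> g j (cdiff (cone a) i j p) = cdiff W i j (g i p).
  move=> ji; subst j; rewrite coneE // /g /= trid !linearD linearN cfunC addrA; congr (_ + _).
  by rewrite -[f _ (a _ _)]/(cmap_comp f a (i + 1) p.1) (hE (i + 1) i (i + 1 + 1)) // addrC addrK.
exists (@mkcmap A (cone a) W g gC); apply/cmapP => i y.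
have h0 : h (i + 1) i 0 = 0 by exact: linear0.
by rewrite /= (cone_inE a) /g /= h0 add0r.
Qed.

Lemma add_cancel4 (V : zmodType) (D E H p : V) : p = - (D + E) + (E + H + p + D - H).
Proof.
rewrite (addrAC (E + H + p) D) (addrAC E H p) addrK (addrAC E p D).
by rewrite addrA (addrC E D) addNr add0r.
Qed.

Lemma cone_out_null X Y (a : cmap X Y) (b : cmap Y X) :
  cmap_comp b a ~ cmap_id X -> nullh (cone_out a).
Proof.
move=> [h hE].
exists (fun i j => (tr X i (j + 1) \o (b i \o snd_lin (X (i + 1)) (Y i)))
   \+ (h (i + 1) (j + 1) \o fst_lin (X (i + 1)) (Y i))).
move=> i j l p ji li; subst i l; rewrite coneE // shiftE sg1 mulrN1z !trid cone_outE /= !trid.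
have := hE (j + 1 + 1) (j + 1) (j + 1 + 1 + 1) p.1 erefl erefl.
rewrite cmapB /= => /(canRL (subrK _)) e.
rewrite (linearD (cdiff X _ _)) (linearD (b _)) cfunC (linearN (h _ _)) e.
exact: add_cancel4.
Qed.

(** The complement of a retract is the cone of its inclusion, so idempotents up to homotopy need not
    be split. *)
Lemma isum_retract X Y (a : cmap X Y) (b : cmap Y X) :
  cmap_comp b a ~ cmap_id X -> isum Y X (cone a).
Proof.
move=> ba; set p2 := cone_in a; set q := cmap_id Y - cmap_comp a b.
have qa : nullh (cmap_comp q a).
  have -> : cmap_comp q a = cmap_comp a (cmap_id X - cmap_comp b a).
    by rewrite comp_cmapBl comp_cmapBr comp_1cmap comp_cmap1 comp_cmapA.
  by apply: nullh_compl; apply: heq_sym.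
have [g gE] := cone_extend qa.
have bq : nullh (cmap_comp b q).
  have -> : cmap_comp b q = cmap_comp (cmap_id X - cmap_comp b a) b.
    by rewrite comp_cmapBl comp_cmapBr comp_1cmap comp_cmap1 comp_cmapA.
  by apply: nullh_compr; apply: heq_sym.
(* The extension [g] alone need not be annihilated by [b]; composing with [q] once more ensures
   this, because [b q] is null. *)
pose i2 := cmap_comp q g.
have i2p2 : cmap_comp i2 p2 ~ q.
  have -> : cmap_comp i2 p2 = q - cmap_comp (cmap_comp q a) b.
    by rewrite /i2 -comp_cmapA gE {2}/q comp_cmapBr comp_cmap1 comp_cmapA.
  rewrite -[X in _ ~ X]subr0; apply: heqB (heq_refl _) _.
  by apply/heq0/nullh_compr.
have p2a : nullh (cmap_comp p2 a) by apply: cone_in_null.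
have p2q : cmap_comp p2 q ~ p2.
  rewrite /q comp_cmapBr comp_cmap1 comp_cmapA -[X in _ ~ X]subr0.
  by apply: heqB (heq_refl _) _; apply/heq0/nullh_compr.
exists a, i2, b, p2; split=> //.
- pose z := cmap_comp p2 i2 - cmap_id (cone a).
  have zp2 : nullh (cmap_comp z p2).
    rewrite /z comp_cmapBl comp_1cmap -comp_cmapA; apply: heq_trans p2q.
    exact: heq_comp (heq_refl _) i2p2.
  have [c zc] := cone_map_factor zp2.
  by apply: heq_nullh zc _; apply: nullh_compl; apply: cone_out_null ba.
- by rewrite /i2 comp_cmapA; apply: nullh_compr.
- apply: (@heq_trans _ _ _ (cmap_comp a b + q)); last by rewrite /q subrKC; apply: heq_refl.
  exact: heqD (heq_refl _) i2p2.
Qed.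

Lemma retract_hiso X Y : perfect X -> perfect Y -> retract X Y ->
  exists2 Z, perfect Z & hiso Y (csum X Z).
Proof.
move=> pX pY [a [b ba]]; exists (cone a); first exact: perfect_cone.
exact/isumP/isum_retract/ba.
Qed.

Lemma hzero_hiso X Y : hiso X Y -> hzero X -> hzero Y.
Proof.
move=> /hisoP[f [g [_ fg]]] /hzeroP X0; apply/hzeroP.
apply: (heq_nullh (heq_sym fg)); rewrite -[f]comp_cmap1 -comp_cmapA.
by apply: nullh_compl; apply: nullh_compr.
Qed.
Lemma retract_csum1 X Y : retract X (csum X Y).
Proof. by exists (csum_in1 X Y), (csum_out1 X Y); rewrite csum_out1_in1; apply: heq_refl. Qed.
Lemma retract_csum2 X Y : retract Y (csum X Y).
Proof. by exists (csum_in2 X Y), (csum_out2 X Y); rewrite csum_out2_in2; apply: heq_refl. Qed.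
Lemma retract_trans Y X Z : retract X Y -> retract Y Z -> retract X Z.
Proof.
move=> [a [b ba]] [c [d dc]]; exists (cmap_comp c a), (cmap_comp b d).
apply: heq_trans ba; rewrite comp_cmapA -(comp_cmapA b) -{2}[b]comp_cmap1.
by apply: heq_comp (heq_refl _); apply: heq_comp (heq_refl _) dc.
Qed.
Lemma hiso_retract X Y : hiso X Y -> retract X Y.
Proof. by move=> /hisoP[f [g [gf _]]]; exists f, g. Qed.
End SumAlgebra.

Lemma span_dependent (K : fieldType) (V : lmodType K) (s : seq V) n (v : 'I_n -> V) :
  (size s < n)%N -> (forall i, span s (v i)) ->
  exists2 c : 'I_n -> K, (exists i, c i != 0) & \sum_(i < n) c i *: v i = 0.
Proof.
move=> sn vs; have /choice[m mE] := fun i => span_nth (vs i).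
pose M : 'M[K]_(n, size s) := \matrix_(i, j) m i j.
have : kermx M != 0.
  by rewrite kermx_eq0 /row_free neq_ltn (leq_ltn_trans (rank_leq_col _) sn).
move=> /rowV0Pn[u /sub_kermxP uM u0].
exists (fun i => u 0 i); first exact/rV0Pn.
under eq_bigr do rewrite mE scaler_sumr.
rewrite exchange_big big1 // => j _ /=.
under eq_bigr do rewrite scalerA.
rewrite -scaler_suml; have := congr1 (fun w : 'M__ => w 0 j) uM.
rewrite !mxE => uMj.
by rewrite (eq_bigr (fun i => u 0 i * M i j)) ?uMj ?scale0r // => i _; rewrite mxE.
Qed.

(** Let [m] be the least index with a nonzero coefficient. Dividing by that coefficient expresses
    [f^m] as [f^(m+1)] times a polynomial in [f], which commutes with [f]. *)
Lemma fitting_relation (K : fieldType) (E : pzRingType) (z : {rmorphism K -> E}) (f : E) n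
    (c : nat -> K) :
  (forall c a, z c * a = a * z c) -> (exists2 l, (l < n)%N & c l != 0) ->
  \sum_(l < n) z (c l) * f ^+ l = 0 ->
  exists m r, f * r = r * f /\ f ^+ m = f ^+ m.+1 * r.
Proof.
move=> zC [l ln cl] S0.
have : exists l, (l < n)%N && (c l != 0) by exists l; rewrite ln.
move=> /ex_minnP[m /andP[mn cm] mmin].
exists m, (- (z (c m)^-1 * \sum_(l < n - m.+1) z (c (m.+1 + l)%N) * f ^+ l)); split.
  rewrite mulrN mulNr mulrA -zC -!mulrA mulr_sumr mulr_suml; congr (- (_ * _)).
  by apply: eq_bigr => i _; rewrite mulrA -zC -!mulrA -exprS -exprSr.
have := S0; rewrite -(big_mkord xpredT (fun l => z (c l) * f ^+ l)).
rewrite (@big_cat_nat _ _ _ m) //=; last exact: ltnW.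
rewrite big_nat big1 => [|i /= im]; last first.
  case: (eqVneq (c i) 0) => [->|ci]; first by rewrite rmorph0 mul0r.
  by have := mmin i; rewrite ci (ltn_trans _ mn) // => /(_ isT); rewrite leqNgt im.
rewrite add0r big_ltn // => /eqP; rewrite addr_eq0 => /eqP e.
have -> : f ^+ m = z (c m)^-1 * (z (c m) * f ^+ m).
  by rewrite mulrA -rmorphM mulVf // rmorph1 mul1r.
rewrite e mulrN mulrN mulrA -zC -!mulrA; congr (- (_ * _)).
rewrite -{1}[m.+1]add0n -[n in \sum_(_ <= _ < n) _](subnK mn) big_addn big_mkord addnK ?mulr_sumr.
apply: eq_bigr => i _; rewrite mulrA -zC -mulrA -exprD addnC.
by rewrite [(m.+1 + i)%N]addnC.
Qed.

Section KrullSchmidt.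
Variables (A : pzRingType) (K : fieldType) (rho : {rmorphism K -> A}).
Hypothesis rhoC : forall c a, rho c * a = a * rho c.
Hypotheses (pK : principal_ideals K) (fA : kfinite rho).
Implicit Types X Y Z W C S T U I : complex A.

(** Strict endomorphisms, not homotopy classes: those of a perfect complex are finite-dimensional
    over [K], and strict idempotents split degree by degree. *)
Definition cend X : Type := cmap X X.
HB.instance Definition _ X := GRing.Zmodule.on (cend X).
Fact cend_mulA X : associative (fun f g : cend X => cmap_comp f g : cend X).
Proof. by move=> f g h; apply: comp_cmapA. Qed.
Fact cend_mul1 X : left_id (cmap_id X : cend X) (fun f g : cend X => cmap_comp f g : cend X).
Proof. by move=> f; apply: comp_1cmap. Qed.
Fact cend_mul1r X : right_id (cmap_id X : cend X) (fun f g : cend X => cmap_comp f g : cend X).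
Proof. by move=> f; apply: comp_cmap1. Qed.
Fact cend_mulDl X : left_distributive (fun f g : cend X => cmap_comp f g : cend X) +%R.
Proof. by move=> f g h; apply: comp_cmapDl. Qed.
Fact cend_mulDr X : right_distributive (fun f g : cend X => cmap_comp f g : cend X) +%R.
Proof. by move=> f g h; apply: comp_cmapDr. Qed.
HB.instance Definition _ X := GRing.Zmodule_isPzRing.Build (cend X)
  (@cend_mulA X) (@cend_mul1 X) (@cend_mul1r X) (@cend_mulDl X) (@cend_mulDr X).

Definition cend_scalar X (c : K) : cend X := (c *: (cmap_id X : kcmap rhoC X X) : kcmap rhoC X X).
Lemma cend_scalarE X c (f : cend X) :
  cend_scalar X c * f = ((c *: (f : kcmap rhoC X X) : kcmap rhoC X X) : cmap X X).
Proof.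
apply/cmapP => i x; transitivity ((rho c : A^c) *: (f : cmap X X) i x); last by symmetry; exact: kcmapZ.
exact: (kcmapZ c (cmap_id X : kcmap rhoC X X) (f i x)).
Qed.
Fact cend_scalar_zmod X : zmod_morphism (cend_scalar X).
Proof. by move=> a b; exact: (scalerBl a b (cmap_id X : kcmap rhoC X X)). Qed.
Fact cend_scalar_monoid X : monoid_morphism (cend_scalar X).
Proof.
split=> [|a b]; first exact: (scale1r (cmap_id X : kcmap rhoC X X)).
by rewrite cend_scalarE; exact: esym (scalerA a b (cmap_id X : kcmap rhoC X X)).
Qed.
HB.instance Definition _ X := GRing.isZmodMorphism.Build K (cend X) _ (@cend_scalar_zmod X).
HB.instance Definition _ X := GRing.isMonoidMorphism.Build K (cend X) _ (@cend_scalar_monoid X).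
Lemma cend_scalarC X c (f : cend X) : cend_scalar X c * f = f * cend_scalar X c.
Proof.
apply/cmapP => i x; rewrite cend_scalarE kcmapZ -linearZ; congr (f i _).
Qed.

Lemma cend_fitting X (f : cend X) : perfect X ->
  exists m r, f * r = r * f /\ f ^+ m = f ^+ m.+1 * r.
Proof.
move=> pX; have [||fs _ fsS] := @cmap_fg A K rho rhoC pK fA X X setT pX.
- by move=> i; have [] := pX.2 i.
- by split.
have [c [l cl] S0] := @span_dependent K (kcmap rhoC X X) fs _
  (fun i : 'I_(size fs).+1 => (f ^+ i : cend X)) (ltnSn _) (fun i => fsS _ I).
pose c' (n : nat) := if insub n is Some i then c i else 0.
have c'E (i : 'I_(size fs).+1) : c' i = c i by rewrite /c' valK.
apply: (@fitting_relation K (cend X) (cend_scalar X) f (size fs).+1 c').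
- exact: cend_scalarC.
- by exists l; rewrite ?c'E.
rewrite -[RHS]S0; apply: eq_bigr => i _; rewrite c'E; exact: cend_scalarE.
Qed.

End KrullSchmidt.

(** * Splitting strict idempotents *)

Section Split.
Variables (A : pzRingType) (X : complex A) (e : cmap X X).
Hypothesis ee : cmap_comp e e = e.

Fact cfix_ff i v : e i (e i v) = e i v.
Proof. by have /(congr1 (fun f : cmap X X => f i v)) := ee. Qed.
Definition cfix_diff i j : {linear fixmod (e i) -> fixmod (e j)} :=
  fix_out (@cfix_ff j) \o (cdiff X i j \o fix_in (e i)).
Lemma cfix_diffE i j v : fix_in (e j) (cfix_diff i j v) = cdiff X i j (fix_in (e i) v).
Proof. by rewrite [LHS]fix_outE cfunC fix_inP. Qed.
Lemma fix_in_inj i : injective (fix_in (e i)).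
Proof. exact: val_inj. Qed.
Fact cfix_shape i j : j <> i + 1 -> forall x, cfix_diff i j x = 0.
Proof. by move=> ij x; apply: fix_in_inj; rewrite cfix_diffE cdiff_shape // linear0. Qed.
Fact cfix_diffK i j l x : cfix_diff j l (cfix_diff i j x) = 0.
Proof. by apply: fix_in_inj; rewrite !cfix_diffE cdiffK linear0. Qed.
Definition cfix : complex A := @Complex A (fun i => fixmod (e i)) _ cfix_shape cfix_diffK.

Fact cfix_in_comm i j x : fix_in (e j) (cdiff cfix i j x) = cdiff X i j (fix_in (e i) x).
Proof. exact: cfix_diffE. Qed.
Definition cfix_in : cmap cfix X := @CMap A cfix X (fun i => fix_in (e i)) cfix_in_comm.
Fact cfix_out_comm i j x :
  fix_out (@cfix_ff j) (cdiff X i j x) = cdiff cfix i j (fix_out (@cfix_ff i) x).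
Proof. by apply: fix_in_inj; rewrite cfix_diffE !fix_outE cfunC. Qed.
Definition cfix_out : cmap X cfix := @CMap A X cfix (fun i => fix_out (@cfix_ff i)) cfix_out_comm.

Lemma cfix_outK : cmap_comp cfix_out cfix_in = cmap_id cfix.
Proof. by apply/cmapP => i x /=; rewrite fix_inK. Qed.
Lemma cfix_inK : cmap_comp cfix_in cfix_out = e.
Proof. by apply/cmapP => i x; apply: fix_outE. Qed.

Lemma perfect_cfix : perfect X -> perfect cfix.
Proof.
move=> [[N bX] pX]; split.
  by exists N => i Ni x; apply: fix_in_inj; rewrite linear0; apply: bX.
move=> i; split.
  apply: (@fg_surj _ _ _ (fix_out (@cfix_ff i))) (pX i).1 => y.
  by exists (fix_in (e i) y); apply: fix_inK.
exact: proj_retract (fix_inK (@cfix_ff i)) (pX i).2.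
Qed.
End Split.

Lemma cfix_isum (A : pzRingType) (X : complex A) (e f : cmap X X)
    (ee : cmap_comp e e = e) (ff : cmap_comp f f = f) :
  e + f = cmap_id X -> isum X (cfix ee) (cfix ff).
Proof.
move=> ef; have fE : f = cmap_id X - e by rewrite -ef addrC addKr.
have eE : e = cmap_id X - f by rewrite -ef addrK.
have ef0 : cmap_comp e f = 0 by rewrite fE comp_cmapBr comp_cmap1 ee subrr.
have fe0 : cmap_comp f e = 0 by rewrite eE comp_cmapBr comp_cmap1 ff subrr.
have null0 (e1 e2 : cmap X X) (e11 : cmap_comp e1 e1 = e1) (e22 : cmap_comp e2 e2 = e2) :
    cmap_comp e1 e2 = 0 -> nullh (cmap_comp (cfix_out e11) (cfix_in e22)).
  move=> z; have -> : cmap_comp (cfix_out e11) (cfix_in e22) = 0; last exact: nullh0.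
  apply/cmapP => i x; apply: (@fix_in_inj A X e1 i); rewrite [LHS]fix_outE [RHS]linear0.
  apply: etrans (congr1 (e1 i) (esym (fix_inP x))) _.
  exact: (congr1 (fun g : cmap X X => g i (fix_in (e2 i) x)) z).
exists (cfix_in ee), (cfix_in ff), (cfix_out ee), (cfix_out ff).
rewrite !cfix_outK !cfix_inK ef; split; try exact: heq_refl; exact: null0.
Qed.

Section LocalEndo.
Variables (A : pzRingType) (K : fieldType) (rho : {rmorphism K -> A}).
Hypothesis rhoC : forall c a, rho c * a = a * rho c.
Hypotheses (pK : principal_ideals K) (fA : kfinite rho).
Implicit Types X Y Z W C S T U I : complex A.


Definition hlinv X Y (f : cmap X Y) := exists g : cmap Y X, cmap_comp g f ~ cmap_id X.

(** Fitting's decomposition: [e = f^n r^n] is a strict idempotent with [f^n e = f^n].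
    Indecomposability makes [e] or [1 - e] null; in the first case [f^n] is null, in the second [e]
    provides a left inverse of [f]. *)
Lemma indecomposable_endo I (f : cend I) : indecomposable I ->
  (exists n, nullh (f ^+ n : cend I)) \/ hlinv f.
Proof.
move=> [pI _ dI]; have [m [r [fr fm]]] := cend_fitting rhoC pK fA f pI.
have fn j : f ^+ m.+1 = f ^+ (m.+1 + j) * r ^+ j.
  elim: j => [|j IH]; first by rewrite addn0 expr0 mulr1.
  have e : f ^+ (m.+1 + j) = f ^+ (m.+1 + j.+1) * r.
    by rewrite addSnnS addnC exprD fm mulrA -exprD addnC -addSnnS addSn.
  by rewrite IH e -mulrA -exprS.
(* Taking the successor of [m] ensures that [e] ends with a factor [f]. *)
set n := m.+1 in fn; set e := f ^+ n * r ^+ n.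
have frn : r ^+ n * f ^+ n = f ^+ n * r ^+ n.
  by apply: commrX; apply: commr_sym; apply: commrX; rewrite /GRing.comm fr.
have fe : f ^+ n * e = f ^+ n by rewrite mulrA -exprD -fn.
have ee : e * e = e by rewrite {1}/e -frn -mulrA fe frn.
have dd : (1 - e) * (1 - e) = 1 - e by rewrite mulrBl mul1r mulrBr mulr1 ee subrr subr0.
have nullfix (u : cmap I I) (uu : cmap_comp u u = u) : hzero (cfix uu) -> nullh u.
  move=> /hzeroP u0; rewrite -(cfix_inK uu) -[cfix_out uu]comp_1cmap.
  by apply: nullh_compl; apply: nullh_compr.
have /isumP ise : isum I (@cfix A I e ee) (@cfix A I (1 - e) dd) by apply: cfix_isum; apply: subrKC.
case: (dI _ _ (perfect_cfix ee pI) (perfect_cfix dd pI) ise) => /nullfix e0; [left|right].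
  by exists n; rewrite -fe; apply: (@nullh_compl A I I I (f ^+ n) e e0).
exists (r ^+ n * f ^+ m : cend I); apply: heq_sym.
by have -> : cmap_comp (r ^+ n * f ^+ m : cend I) f = e by rewrite -[LHS]/((r ^+ n * f ^+ m) * f) -mulrA -exprSr frn.
Qed.

(** If a power of [f] is null, the finite geometric sum in [f] inverts [1 - f]. Left inverses are
    enough, since they exhibit retracts. *)
Lemma hlinv_local I (f g : cmap I I) : indecomposable I -> f + g ~ cmap_id I -> hlinv f \/ hlinv g.
Proof.
move=> dI fg; case: (indecomposable_endo (f : cend I) dI) => [[n fn]|]; last by left.
right; exists (\sum_(i < n) (f : cend I) ^+ i).
have fgN : g ~ cmap_id I - f by rewrite -(addKr f g) addrC; apply: heqB fg (heq_refl _).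
apply: heq_trans (heq_comp (heq_refl _) fgN) _.
rewrite -[cmap_comp _ _]/(((\sum_(i < n) (f : cend I) ^+ i) * (1 - (f : cend I))) : cend I).
have -> : (\sum_(i < n) (f : cend I) ^+ i) * (1 - (f : cend I)) = 1 - (f : cend I) ^+ n.
  rewrite -opprB mulrN -[RHS]opprB subrX1; congr (- _).
  by apply: commr_sym; apply: commr_sum => i _; apply: commrX; apply: commr_sym; apply: commrB => //; apply: commr1.
rewrite -[X in _ ~ X]subr0; apply: heqB (heq_refl _) _; exact/heq0.
Qed.

Lemma hlinv_comp X Y Z (g : cmap Y Z) (f : cmap X Y) : hlinv (cmap_comp g f) -> hlinv f.
Proof. by move=> [h hE]; exists (cmap_comp h g); rewrite -comp_cmapA. Qed.
Lemma hlinv_heq X Y (f g : cmap X Y) : f ~ g -> hlinv f -> hlinv g.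
Proof.
move=> fg [h hE]; exists h; apply: heq_trans hE; apply: heq_comp (heq_refl _) _; exact: heq_sym.
Qed.

Lemma hlinv_sum I T (s : seq (cmap T I * cmap I T)) : indecomposable I ->
  hlinv (\sum_(p <- s) cmap_comp p.1 p.2) -> retract I T.
Proof.
move=> dI; elim: s => [|p s IH].
  rewrite big_nil => -[h]; have -> : cmap_comp h (0 : cmap I I) = 0.
    by apply/cmapP => i x; rewrite [RHS]/(0 : I i); exact: (linear0 (h i)).
  by move=> /heq_sym/heq0/hzeroP; have [_ nz _] := dI.
rewrite big_cons => -[h]; rewrite comp_cmapDr => /(hlinv_local dI)[] /hlinv_comp.
  by rewrite /hlinv => -[g gE]; exists p.2, (cmap_comp g p.1); rewrite -comp_cmapA.
exact: IH.
Qed.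

Lemma factors_retract T I : indecomposable I -> factors_through T (cmap_id I) -> retract I T.
Proof.
move=> dI [s sE]; apply: (@hlinv_sum I T s dI); apply: hlinv_heq sE _.
by exists (cmap_id I); rewrite comp_1cmap; apply: heq_refl.
Qed.
End LocalEndo.

Lemma nat_max_exists (P : nat -> Prop) N : P 0%N -> (forall n, P n -> (n <= N)%N) ->
  exists n, P n /\ ~ P n.+1.
Proof.
move=> P0 PN; apply: contrapT => H.
have Pall n : P n by elim: n => // n Pn; apply: contrapT => Pn1; apply: H; exists n.
by have := PN _ (Pall N.+1); rewrite ltnn.
Qed.

Section KrullSchmidt.
Variables (A : pzRingType) (K : fieldType) (rho : {rmorphism K -> A}).
Hypothesis rhoC : forall c a, rho c * a = a * rho c.
Hypotheses (pK : principal_ideals K) (fA : kfinite rho).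
Implicit Types X Y Z W C S T U V I : complex A.

Lemma retract_csum X X' Y Y' : retract X X' -> retract Y Y' -> retract (csum X Y) (csum X' Y').
Proof.
move=> [a [b ba]] [a' [b' ba']]; exists (csum_map a a'), (csum_map b b').
have -> : cmap_comp (csum_map b b') (csum_map a a') = csum_map (cmap_comp b a) (cmap_comp b' a').
  by apply/cmapP => i p /=; rewrite !pair_linE.
have <- : csum_map (cmap_id X) (cmap_id Y) = cmap_id (csum X Y).
  by apply/cmapP => i p /=; rewrite !pair_linE; case: p.
exact: csum_map_heq.
Qed.

Lemma retract_contractible X Y : hzero X -> retract X Y.
Proof.
move=> /hzeroP X0; exists 0, 0; apply: heq_sym.
have -> : cmap_comp (0 : cmap Y X) (0 : cmap X Y) = 0 by apply/cmapP.
exact/heq0.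
Qed.

Lemma zero_perfect X : perfect X -> exists2 Z : complex A, perfect Z & hzero Z.
Proof.
move=> pX; exists (cone (cmap_id X)); first exact: perfect_cone.
by apply/hzeroP; apply: cone_id_null.
Qed.

(** [W] is a direct sum of [n] nonzero perfect complexes and of a perfect
complement, which may be zero. *)
Fixpoint nsum n W : Prop := perfect W /\
  if n is n'.+1 then
    exists U V, [/\ perfect U, ~ hzero U, nsum n' V & hiso W (csum U V)]
  else True.

Lemma nsum_perfect n W : nsum n W -> perfect W. Proof. by case: n => [|n] []. Qed.

Lemma nsum_csum n W Z : perfect Z -> nsum n W -> nsum n (csum W Z).
Proof.
move=> pZ; elim: n W => [|n IH] W [pW H]; split=> //; try exact: perfect_csum.
have [U [V [pU U0 nV WUV]]] := H; exists U, (csum V Z); split=> //; first exact: IH.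
by apply: hiso_trans (hiso_csum WUV (hiso_refl Z)) _; apply: hiso_sym (csumA _ _ _).
Qed.

Lemma nsum_hiso n W W' : perfect W' -> hiso W W' -> nsum n W -> nsum n W'.
Proof.
move=> pW' WW'; case: n => [|n] [pW H]; split=> //.
have [U [V [pU U0 nV WUV]]] := H; exists U, V; split=> //.
exact: hiso_trans (hiso_sym WW') WUV.
Qed.

Lemma nsum_retract n W X : perfect X -> retract W X -> nsum n W -> nsum n X.
Proof.
move=> pX rW nW; have [Z pZ XWZ] := retract_hiso (nsum_perfect nW) pX rW.
by apply: nsum_hiso pX (hiso_sym XWZ) _; apply: nsum_csum.
Qed.

(** The projections onto the nonzero summands; their number is bounded below by linear
    independence. *)
Lemma nsum_idempotents n W : nsum n W -> exists e : nat -> cend W,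
  (forall i, (i < n)%N -> ~ nullh (e i) /\ e i * e i ~ e i) /\
  (forall i j, (i < n)%N -> (j < n)%N -> i != j -> nullh (e i * e j : cend W)).
Proof.
elim: n W => [|n IH] W [pW H]; first by exists (fun=> 0).
have [U [V [pU U0 /IH[e [e1 e2]] /isumP[i1 [i2 [p1 [p2 [z1 z2 z12 z21 _]]]]]]]] := H.
exists (fun i => if i is i'.+1 then cmap_comp i2 (cmap_comp (e i') p2) else cmap_comp i1 p1).
have sandwich X (i : cmap X W) (p : cmap W X) (f g : cmap X X) : cmap_comp p i ~ cmap_id X ->
    cmap_comp (cmap_comp i (cmap_comp f p)) (cmap_comp i (cmap_comp g p)) ~ cmap_comp i (cmap_comp (cmap_comp f g) p).
  move=> pi; rewrite -(comp_cmapA f) -!(comp_cmapA i) -!(comp_cmapA f) (comp_cmapA p).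
  do 2!apply: heq_comp (heq_refl _) _.
  rewrite -[X in _ ~ X]comp_1cmap; exact: heq_comp pi (heq_refl _).
have sandwich0 X (i : cmap X W) (p : cmap W X) (f : cmap X X) : cmap_comp p i ~ cmap_id X ->
    nullh (cmap_comp i (cmap_comp f p)) -> nullh f.
  move=> pi N; have M : nullh (cmap_comp (cmap_comp p i) (cmap_comp f (cmap_comp p i))).
    by rewrite -(comp_cmapA p) (comp_cmapA f) (comp_cmapA i); apply: nullh_compl; apply: nullh_compr.
  apply: heq_nullh (heq_sym _) M.
  rewrite -[X in _ ~ X]comp_1cmap -{2}[f]comp_cmap1.
  exact: heq_comp pi (heq_comp (heq_refl _) pi).
have e0E : cmap_comp i1 p1 = cmap_comp i1 (cmap_comp (cmap_id U) p1) by rewrite comp_1cmap.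
split=> [[|i] /= Hi|[|i] [|j] //= Hi Hj ij].
- rewrite e0E; split; first by move=> /(sandwich0 _ _ _ _ z1)/hzeroP.
  by apply: heq_trans (sandwich _ _ _ _ _ z1) _; rewrite comp_1cmap; apply: heq_refl.
- have [e1n e1i] := e1 i Hi; split; first by move=> /(sandwich0 _ _ _ _ z2).
  apply: heq_trans (sandwich _ _ _ _ _ z2) _.
  by apply: heq_comp (heq_refl _) _; apply: heq_comp _ (heq_refl _).
- rewrite -[_ * _]/(cmap_comp _ _) -comp_cmapA (comp_cmapA p1); apply: nullh_compl; exact: nullh_compr.
- rewrite -[_ * _]/(cmap_comp _ _) -comp_cmapA -comp_cmapA (comp_cmapA p2).
  by do 2!apply: nullh_compl; apply: nullh_compr.
apply: heq_nullh (sandwich _ _ _ _ _ z2) _.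
by apply: nullh_compl; apply: nullh_compr; apply: e2.
Qed.

(** More idempotents than the dimension of the endomorphism space satisfy a linear relation.
    Multiplying it by [e l] with nonzero coefficient leaves, up to homotopy, only that term, so
    [e l] would be null. *)
Lemma nsum_bounded X : perfect X -> exists N, forall n, nsum n X -> (n <= N)%N.
Proof.
move=> pX; have [||fs _ fsS] := @cmap_fg A K rho rhoC pK fA X X setT pX.
- by move=> i; have [] := pX.2 i.
- by split.
exists (size fs) => n /nsum_idempotents[e [e1 e2]]; rewrite leqNgt; apply/negP => sn.
have [c [l cl] S0] := @span_dependent K (kcmap rhoC X X) fs _
  (fun i : 'I_n => e i) sn (fun i => fsS _ Logic.I).
have {}S0 : \sum_(i < n) (cend_scalar rhoC X (c i) * e i) = 0.
  by rewrite -[RHS]S0; apply: eq_bigr => i _; apply: cend_scalarE.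
have nl : nullh (cend_scalar rhoC X (c l) * e l : cend X).
  have : nullh ((\sum_(i < n) (cend_scalar rhoC X (c i) * e i)) * e l : cend X).
    by rewrite S0 mul0r; apply: nullh0.
  rewrite mulr_suml (bigD1 l) //= => N.
  have M : nullh (\sum_(i < n | i != l) cend_scalar rhoC X (c i) * e i * e l : cend X).
    apply: nullh_sum => i il; rewrite -mulrA.
    by apply: (@nullh_compl _ _ _ _ (cend_scalar rhoC X (c i))); apply: e2.
  have := nullhB N M; rewrite addrK -mulrA => N'.
  apply: heq_nullh N'; apply: heq_comp (heq_refl _) _; apply: heq_sym; exact: (e1 l _).2.
apply: (e1 l (ltn_ord l)).1.
have -> : e l = cend_scalar rhoC X (c l)^-1 * (cend_scalar rhoC X (c l) * e l).
  by rewrite mulrA -rmorphM mulVf // rmorph1 mul1r.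
exact: (@nullh_compl _ _ _ _ (cend_scalar rhoC X (c l)^-1) _ nl).
Qed.

(** In a decomposition with as many nonzero summands as possible, the first one is indecomposable:
    splitting it would give a longer decomposition. *)
Lemma indecomposable_retract X : perfect X -> ~ hzero X ->
  exists2 I : complex A, indecomposable I & retract I X.
Proof.
move=> pX X0; have [N HN] := nsum_bounded pX.
have [O pO O0] := zero_perfect pX.
have [||[|n] [HX Hm]] := @nat_max_exists (fun n => nsum n X) N.
- by split.
- exact: HN.
- case: Hm; split=> //; exists X, O; split=> //; apply: isum_zero; exact/hzeroP.
have [_ [U [V [pU U0 nV XUV]]]] := HX.
exists U; last by apply: retract_trans (retract_csum1 U V) (hiso_retract (hiso_sym XUV)).
split=> // Y Z pY pZ UYZ; apply: contrapT => /not_orP[Y0 Z0]; apply: Hm.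
split=> //; exists Y, (csum Z V); split=> //.
  split; first by apply: perfect_csum => //; apply: nsum_perfect nV.
  by exists Z, V; split=> //; apply: hiso_refl.
apply: hiso_trans XUV _; apply: hiso_trans (hiso_csum UYZ (hiso_refl V)) _.
exact/hiso_sym/csumA.
Qed.

Lemma factors_through_retract T X Y : retract X Y -> factors_through T (cmap_id Y) ->
  factors_through T (cmap_id X).
Proof.
move=> [a [b ba]] [s sE]; exists [seq (cmap_comp b p.1, cmap_comp p.2 a) | p <- s].
rewrite big_map; apply: heq_trans (heq_sym ba) _.
have -> : \sum_(p <- s) cmap_comp (cmap_comp b p.1) (cmap_comp p.2 a)
   = cmap_comp b (cmap_comp (\sum_(p <- s) cmap_comp p.1 p.2) a).
  elim: s {sE} => [|p s IH].
    by rewrite !big_nil; apply/cmapP => i x; symmetry; exact: (linear0 (b i)).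
  by rewrite !big_cons IH comp_cmapDl comp_cmapDr !comp_cmapA.
rewrite -{1}[a]comp_1cmap.
by apply: heq_comp (heq_refl _) _; apply: heq_comp _ (heq_refl _).
Qed.

Lemma indecomposable_retract_csum I X Y : indecomposable I -> retract I (csum X Y) ->
  retract I X \/ retract I Y.
Proof.
move=> dI [a [b ba]].
have : cmap_comp b (cmap_comp (csum_in1 X Y) (cmap_comp (csum_out1 X Y) a))
    + cmap_comp b (cmap_comp (csum_in2 X Y) (cmap_comp (csum_out2 X Y) a)) ~ cmap_id I.
  rewrite -comp_cmapDr !(comp_cmapA (csum_in1 _ _)) !(comp_cmapA (csum_in2 _ _)) -comp_cmapDl.
  by rewrite csum_in_out comp_1cmap.
move=> /(hlinv_local rhoC pK fA dI)[] /hlinv_comp/hlinv_comp[g gE]; [left|right].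
  by exists (cmap_comp (csum_out1 X Y) a), g.
by exists (cmap_comp (csum_out2 X Y) a), g.
Qed.

(** [W] is a common summand of [S] and [T] that cannot be enlarged. A further
indecomposable summand of [S] would be one of [T], hence one of [W] or of its
complement in [T]: the first contradicts that [S] is basic, the second the
maximality of [W]. *)
Lemma basic_common_summand S T W n : perfect S -> perfect T -> basic S ->
  factors_through T (cmap_id S) -> nsum n W -> retract W S -> retract W T ->
  (forall W', nsum n.+1 W' -> retract W' S -> retract W' T -> False) -> hiso S W.
Proof.
move=> pS pT bS fS nW WS WT Hmax; have pW := nsum_perfect nW.
have [S' pS' SE] := retract_hiso pW pS WS; have [T' pT' TE] := retract_hiso pW pT WT.
suff S'0 : hzero S' by apply: hiso_trans SE _; apply/hiso_sym/isum_zero/hzeroP.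
apply: contrapT => S'0; have [I dI IS'] := indecomposable_retract pS' S'0.
have [pI I0 _] := dI.
have IS : retract I S.
  apply: retract_trans IS' _; apply: retract_trans (retract_csum2 W S') _.
  exact/hiso_retract/hiso_sym.
have IT := factors_retract rhoC pK fA dI (factors_through_retract IS fS).
case: (indecomposable_retract_csum dI (retract_trans IT (hiso_retract TE))) => [IW|IT'].
  have [W' pW' WE] := retract_hiso pI pW IW; have [S'' pS'' S'E] := retract_hiso pI pS' IS'.
  apply: bS; exists I, I, (csum W' S''); split=> //; [exact: perfect_csum|exact: hiso_refl|].
  apply: hiso_trans SE _; apply: hiso_trans (hiso_csum WE S'E) _.
  apply: hiso_trans (hiso_sym (csumA _ _ _)) _; apply: hiso_csum (hiso_refl I) _.
  apply: hiso_trans (csumA _ _ _) _; apply: hiso_trans (hiso_csum (csumC _ _) (hiso_refl _)) _.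
  exact/hiso_sym/csumA.
apply: (Hmax (csum W I)).
- split; first exact: perfect_csum.
  by exists I, W; split=> //; apply: csumC.
- apply: retract_trans (hiso_retract (hiso_sym SE)); exact: retract_csum (hiso_retract (hiso_refl W)) IS'.
apply: retract_trans (hiso_retract (hiso_sym TE)); exact: retract_csum (hiso_retract (hiso_refl W)) IT'.
Qed.

(** A common summand with the greatest number of nonzero parts exists because decompositions of [S]
    are bounded in length; it is then isomorphic to both sides. *)
Theorem basic_same_add S T : perfect S -> perfect T -> basic S -> basic T ->
  factors_through T (cmap_id S) -> factors_through S (cmap_id T) -> hiso S T.
Proof.
move=> pS pT bS bT fS fT; have [N HN] := nsum_bounded pS; have [O pO O0] := zero_perfect pS.
pose P n := exists W, [/\ nsum n W, retract W S & retract W T].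
have [||n [[W [nW WS WT]] Hm]] := @nat_max_exists P N.
- by exists O; split=> //; apply: retract_contractible.
- by move=> n [W [nW WS _]]; apply: HN; apply: nsum_retract WS nW.
apply: (@hiso_trans _ W).
  by apply: basic_common_summand nW WS WT _ => // W' nW' W'S W'T; apply: Hm; exists W'.
by apply: hiso_sym; apply: basic_common_summand nW WT WS _ => // W' nW' W'T W'S; apply: Hm; exists W'.
Qed.
End KrullSchmidt.

(** * Order on silting complexes *)

Section SiltingOrder.
Variable A : pzRingType.
Implicit Types X Y Z W C S T U V : complex A.

Lemma retract_shift X Y n : retract X Y -> retract (shift X n) (shift Y n).
Proof.
move=> [a [b ba]]; exists (cshift a n), (cshift b n).
by move: (nullh_shift n ba); congr nullh; apply/cmapP.
Qed.

Lemma hz_retract n X X' Y Y' : retract X X' -> retract Y Y' -> hz n X' Y' -> hz n X Y.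
Proof.
move=> [a [b ba]] /(@retract_shift _ _ n)[a' [b' ba']] H.
exact: hz0_retr ba' (hz0_retl ba H).
Qed.

Lemma hzero_hz X : hzero X <-> hz 0 X X.
Proof.
rewrite hz_0; split=> [/hzeroP X0 f|X0]; last by apply/hzeroP; apply: X0.
by rewrite -[f]comp_cmap1; apply: nullh_compl.
Qed.

Lemma pretilt_hiso T S : perfect S -> hiso T S -> pretilt T -> pretilt S.
Proof.
move=> pS TS [_ HT]; split=> // n n0.
by apply: hz_retract (HT n n0); apply/hiso_retract/hiso_sym.
Qed.

Lemma silting_hiso T S : perfect S -> hiso T S -> silting T -> silting S.
Proof.
move=> pS TS [/pretiltP pT gT]; split; first exact/pretiltP/pretilt_hiso/pT.
move=> P tP PS; apply: gT => //; have [_ iP _ _ _] := tP.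
exact: iP PS pT.1 (hiso_sym TS).
Qed.

Lemma basic_hiso T S : hiso T S -> basic T -> basic S.
Proof.
move=> TS bT [X [Y [Z [dX dY pZ XY SE]]]]; apply: bT; exists X, Y, Z; split=> //.
exact: hiso_trans TS SE.
Qed.

Lemma indecomposable_hiso X Y : perfect Y -> hiso X Y -> indecomposable X -> indecomposable Y.
Proof.
move=> pY XY [pX X0 dX]; split=> //; first by move=> /(hzero_hiso (hiso_sym XY)).
move=> U V pU pV YE; apply: dX pU pV _; exact: hiso_trans XY YE.
Qed.

Lemma iso_class_eq S T : perfect T -> iso_class S = iso_class T <-> hiso S T.
Proof.
move=> pT; split=> [e|ST].
  by have [] : iso_class S T by rewrite e; split=> //; apply: hiso_refl.
apply/funext => X; apply/propext; split=> -[pX H]; split=> //.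
  exact: hiso_trans (hiso_sym ST) H.
exact: hiso_trans ST H.
Qed.

Lemma silt_ge_class S T : perfect S -> perfect T ->
  silt_ge (iso_class S) (iso_class T) <-> forall n : int, 0 < n -> hz n S T.
Proof.
move=> pS pT; split=> [H n n0|H S' T' [pS' SS'] [pT' TT'] n n0].
  by apply/(dhom_zeroP _ pS); apply: H n n0; split=> //; apply: hiso_refl.
apply/(dhom_zeroP _ pS').
exact: hz_retract (hiso_retract (hiso_sym SS')) (hiso_retract (hiso_sym TT')) (H n n0).
Qed.

Lemma silting_detects T : silting T -> detects T.
Proof. by move=> sT C _; apply: (silting_eventually_exact sT). Qed.

Lemma detects_shift T n : detects T -> detects (shift T n).
Proof.
move=> dT C pC TC; apply: dT => // i.
by have [M HM] := TC (i + n); exists M => m /HM /hz_shiftl; rewrite addrK.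
Qed.

Lemma hz_trans (K : comNzRingType) (rho : {rmorphism K -> A}) S T U :
  (forall c a, rho c * a = a * rho c) -> principal_ideals K -> kfinite rho ->
  silting T -> perfect S -> perfect U ->
  (forall n : int, 0 < n -> hz n S T) -> (forall n : int, 0 < n -> hz n T U) ->
  forall n : int, 0 < n -> hz n S U.
Proof.
move=> rhoC pK fA sT pS pU ST TU n n0; have pT := (pretiltP T).2 sT.1.
rewrite -[n]add0r -[n in 0 + n]opprK; apply/hz_shiftl/hz_0.
apply: (@hz0_tower _ _ _ rhoC pK fA T) => // [||l l0].
- exact: silting_detects.
- exact: perfect_shift.
by apply/hz_shiftl; rewrite opprK; apply: ST; apply: ltr_wpDl.
Qed.

(** Killing the maps from [T] to [S] yields a complex [C] that receives only null maps from [S]. So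
    the identity of [S] dies in [C], and such maps factor through copies of [T]. *)
Lemma silting_factors (K : comNzRingType) (rho : {rmorphism K -> A}) S T :
  (forall c a, rho c * a = a * rho c) -> principal_ideals K -> kfinite rho ->
  silting T -> perfect S ->
  (forall n : int, 0 < n -> hz n S T) -> (forall n : int, 0 < n -> hz n T S) ->
  factors_through T (cmap_id S).
Proof.
move=> rhoC pK fA sT pS ST TS; have pT := (pretiltP T).2 sT.1.
have [C [i [pC TC iC _]]] := cone_kill_generators rhoC pK fA pT pS TS.
apply: iC; rewrite comp_cmap1.
suff SC : hz0 S C by apply: SC.
(* The shift by 1 fits both conditions: [Hom(T, C[n])] vanishes already from [n = 0] on, and [Hom(S,
   T[n])] from [n = 1] on. *)
apply: (@hz0_tower _ _ _ rhoC pK fA (shift T 1)) => //.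
- exact: pretilt_shift.
- exact/detects_shift/silting_detects.
- by move=> n n0; apply/hz_shiftl; apply: TC; rewrite subr_ge0 -gtz0_ge1.
by move=> n n0; apply/hz_shiftr; apply: ST; apply: ltr_wpDr.
Qed.

Lemma silt_partial_order (K : fieldType) (rho : {rmorphism K -> A}) :
  (forall c a, rho c * a = a * rho c) -> principal_ideals K -> kfinite rho ->
  partial_order_on (@silt A) (@silt_ge A).
Proof.
move=> rhoC pK fA; have sP T : silting T -> perfect T by case=> [[]].
split.
- move=> _ [T [sT _ ->]]; apply/silt_ge_class; try exact: sP.
  by have [] := (pretiltP T).2 sT.1.
- move=> _ _ [S [sS bS ->]] [T [sT bT ->]] /silt_ge_class ST /silt_ge_class TS.
  have {}ST := ST (sP _ sS) (sP _ sT); have {}TS := TS (sP _ sT) (sP _ sS).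
  apply/iso_class_eq; first exact: sP.
  apply: (basic_same_add rhoC pK fA) => //; try exact: sP.
    by apply: (silting_factors rhoC pK fA) => //; apply: sP.
  by apply: (silting_factors rhoC pK fA) => //; apply: sP.
move=> _ _ _ [S [sS _ ->]] [T [sT _ ->]] [U [sU _ ->]] /silt_ge_class ST /silt_ge_class TU.
apply/silt_ge_class; try exact: sP.
apply: (hz_trans rhoC pK fA sT); try exact: sP.
  by apply: ST; apply: sP.
by apply: TU; apply: sP.
Qed.
End SiltingOrder.

(** * Reduction modulo X *)

Section BaseChangeSums.
Variables (R S : pzRingType) (phi : {rmorphism R -> S}).
Implicit Types X Y T : complex R.

Lemma nullh_bc_id X : nullh (cmap_id X) -> nullh (cmap_id (base_change phi X)).
Proof. by rewrite -bc_map_id; apply: nullh_bc. Qed.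

Lemma hzero_bc X : hzero X -> hzero (base_change phi X).
Proof. by move=> /hzeroP X0; apply/hzeroP/nullh_bc_id. Qed.

Lemma csum_bc X Y : hiso (base_change phi (csum X Y)) (csum (base_change phi X) (base_change phi Y)).
Proof.
apply/isumP.
exists (bc_map phi (csum_in1 X Y)), (bc_map phi (csum_in2 X Y)).
exists (bc_map phi (csum_out1 X Y)), (bc_map phi (csum_out2 X Y)).
have bc0 U V : bc_map phi (0 : cmap U V) = 0 by rewrite -(subrr (0 : cmap U V)) bc_mapB subrr.
have bcD U V (f g : cmap U V) : bc_map phi f + bc_map phi g = bc_map phi (f + g).
  by rewrite -[g in RHS]opprK bc_mapB -sub0r bc_mapB bc0 sub0r opprK.
rewrite -!bc_map_comp csum_out1_in1 csum_out2_in2 csum_out1_in2 csum_out2_in1 !bc0 !bc_map_id.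
split; try exact: heq_refl; try exact: nullh0.
by rewrite bcD csum_in_out bc_map_id; apply: heq_refl.
Qed.

Lemma hiso_bc_csum T X Y : hiso T (csum X Y) ->
  hiso (base_change phi T) (csum (base_change phi X) (base_change phi Y)).
Proof. by move=> /(hiso_bc phi) H; apply: hiso_trans H (csum_bc X Y). Qed.

Lemma class_base_change_iso T : perfect T ->
  class_base_change phi (iso_class T) = iso_class (base_change phi T).
Proof.
move=> pT; apply/funext => P; apply/propext; split=> [[pP [U [pU TU] UP]]|[pP TP]].
  by split=> //; apply: hiso_trans UP; apply: hiso_bc.
by split=> //; exists T => //; split=> //; apply: hiso_refl.
Qed.
End BaseChangeSums.

Section Reduction.
Variables (k : fieldType) (G : pzRingType) (iota : central_embedding k G).
Hypothesis iotaO : is_order iota.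
Implicit Types T S X Y : complex G.

Definition scalar_modX : {rmorphism k -> modX iota} := (to_modX iota \o (iota \o @fps_const k))%FUN.

Lemma scalar_modX_central c a : scalar_modX c * a = a * scalar_modX c.
Proof.
have [b <-] := to_modX_surj a.
by rewrite /scalar_modX /= -!rmorphM cemb_central.
Qed.

Lemma modX_kfinite : kfinite scalar_modX.
Proof.
have [n [e eG]] := order_kfinite iotaO; exists n, (to_modX iota \o e) => a.
have [b <-] := to_modX_surj a; have [c ->] := eG b.
exists (fun i => fps_coef (c i) 0); rewrite rmorph_sum; apply: eq_bigr => i _.
have [g gE] := fps_split (c i); rewrite {1}gE rmorphD mulrDl rmorphD rmorphM /=.
have -> : to_modX iota (iota (fps_X k * g) * e i) = 0.
  by apply/to_modX_eq0; exists (iota g * e i); rewrite rmorphM mulrA.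
by rewrite addr0.
Qed.

Lemma order_central (c : k[[X]]) a : iota c * a = a * iota c.
Proof. exact: cemb_central. Qed.

Local Notation bc := (base_change (to_modX iota)).
Local Notation perfect_bc := (perfect_base_change (to_modX iota)).

Lemma hz_bcP T S : perfect T -> perfect S ->
  (forall n : int, 0 < n -> hz n T S) <-> (forall n : int, 0 < n -> hz n (bc T) (bc S)).
Proof.
move=> pT pS; split=> H n n0; last exact: (@hz_of_hz_bc _ _ _ iotaO n T S pT pS) (H n n0).
by apply: (hz_bc_of_hz iotaO) => //; apply: H => //; apply: ltr_wpDr.
Qed.

Lemma pretilt_bcP T : perfect T -> pretilt T <-> pretilt (bc T).
Proof.
move=> pT; split=> -[_ H]; split=> //; first exact: perfect_bc.
  exact/hz_bcP.
exact/hz_bcP.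
Qed.

Lemma hzero_bcP X : perfect X -> hzero (bc X) <-> hzero X.
Proof.
move=> pX; split; last exact: hzero_bc.
by move=> /hzero_hz H; apply/hzero_hz; exact: (@hz_of_hz_bc _ _ _ iotaO 0 X X pX pX) H.
Qed.

Lemma pretilt_lift (T' : complex (modX iota)) : perfect T' ->
  (forall n : int, 0 < n -> hz n T' T') -> exists2 T, perfect T & hiso (bc T) T'.
Proof.
move=> pT' H; have [|T [pT TT']] := complex_lift iotaO pT'; first exact: H.
by exists T.
Qed.

Lemma hiso_bcP T S : pretilt T -> pretilt S -> hiso (bc T) (bc S) -> hiso T S.
Proof.
move=> pT pS TS; have [pbT HT] := (pretilt_bcP pT.1).1 pT.
apply: (hiso_of_bc iotaO) => //; [exact: pT.1|exact: pS.1| |].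
  exact: hz_isor TS (HT 1 _).
exact: hz_isol TS (HT 1 _).
Qed.

Lemma pretilt_retract T X : perfect X -> retract X T -> pretilt T -> pretilt X.
Proof. by move=> pX XT [_ H]; split=> // n n0; apply: (hz_retract XT XT); apply: H. Qed.

(** Summands of a pre-silting complex have no positive self-extensions, so they lift. The sum of the
    lifts has the same reduction as [T], hence is isomorphic to [T]. *)
Lemma csum_lift T (X' Y' : complex (modX iota)) : pretilt T -> perfect X' -> perfect Y' ->
  hiso (bc T) (csum X' Y') ->
  exists X Y, [/\ pretilt X, pretilt Y, hiso (bc X) X', hiso (bc Y) Y' & hiso T (csum X Y)].
Proof.
move=> pT pX' pY' TE; have [_ H] := (pretilt_bcP pT.1).1 pT.
have rX : retract X' (bc T) := retract_trans (retract_csum1 X' Y') (hiso_retract (hiso_sym TE)).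
have rY : retract Y' (bc T) := retract_trans (retract_csum2 X' Y') (hiso_retract (hiso_sym TE)).
have [X pX XE] := pretilt_lift pX' (fun n n0 => hz_retract rX rX (H n n0)).
have [Y pY YE] := pretilt_lift pY' (fun n n0 => hz_retract rY rY (H n n0)).
have E : hiso (bc T) (bc (csum X Y)).
  apply: hiso_trans TE _; apply: hiso_sym.
  by apply: hiso_trans (csum_bc _ X Y) _; apply: hiso_csum.
have pXY : pretilt (csum X Y).
  apply/(pretilt_bcP (perfect_csum pX pY)); apply: pretilt_hiso E _.
    exact/perfect_bc/perfect_csum.
  exact/(pretilt_bcP pT.1).
exists X, Y; split=> //; last exact: hiso_bcP.
  exact: pretilt_retract (retract_csum1 X Y) pXY.
exact: pretilt_retract (retract_csum2 X Y) pXY.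
Qed.

Lemma indecomposable_bcP X : pretilt X -> indecomposable X <-> indecomposable (bc X).
Proof.
move=> pX; split=> -[_ X0 dX]; split.
- exact: perfect_bc pX.1.
- by move=> /(hzero_bcP pX.1).
- move=> Y' Z' pY' pZ' XE; have [Y [Z [pY pZ YE ZE /dX]]] := csum_lift pX pY' pZ' XE.
  by move=> [||Y0|Z0]; [exact: pY.1|exact: pZ.1|left|right]; [apply: hzero_hiso YE _|apply: hzero_hiso ZE _];
     apply: hzero_bc.
- exact: pX.1.
- by move=> /(hzero_bcP pX.1).
move=> Y Z pY pZ /(hiso_bc_csum (to_modX iota)) XE.
by case: (dX _ _ (perfect_bc pY) (perfect_bc pZ) XE) => /hzero_bcP; [left|right]; auto.
Qed.

Lemma basic_bcP T : pretilt T -> basic T <-> basic (bc T).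
Proof.
move=> pT; split=> bT.
  move=> [X' [Y' [Z' [dX dY pZ XY TE]]]]; apply: bT.
  have [pX' _ _] := dX; have [pY' _ _] := dY.
  have [X [V [pX pV XE VE TV]]] := csum_lift pT pX' (perfect_csum pY' pZ) TE.
  have [Y [Z [pY pZ' YE ZE VYZ]]] := csum_lift pV pY' pZ VE.
  exists X, Y, Z; split.
  - by apply/(indecomposable_bcP pX); apply: indecomposable_hiso (hiso_sym XE) dX; apply: perfect_bc pX.1.
  - by apply/(indecomposable_bcP pY); apply: indecomposable_hiso (hiso_sym YE) dY; apply: perfect_bc pY.1.
  - exact: pZ'.1.
  - by apply: hiso_bcP => //; apply: hiso_trans XE _; apply: hiso_trans XY (hiso_sym YE).
  by apply: hiso_trans TV _; apply: hiso_csum (hiso_refl X) VYZ.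
move=> [X [Y [Z [dX dY pZ XY TE]]]]; apply: bT.
have [pX _ _] := dX; have [pY _ _] := dY; have pYZ := perfect_csum pY pZ.
have rX : retract X T := retract_trans (retract_csum1 _ _) (hiso_retract (hiso_sym TE)).
have tX := pretilt_retract pX rX pT; have tY := pretilt_hiso pY XY tX.
exists (bc X), (bc Y), (bc Z); split.
- exact/indecomposable_bcP.
- exact/indecomposable_bcP.
- exact: perfect_bc.
- exact: hiso_bc.
apply: hiso_trans (hiso_bc_csum _ TE) _.
exact: hiso_csum (hiso_refl _) (csum_bc _ Y Z).
Qed.

Lemma torsion_silting_bcP T : presilting T -> torsion_silting T <-> silting (bc T).
Proof.
move=> /pretiltP pT; split=> [tT|sT].
  apply: (detects_silting scalar_modX_central (@field_principal k) modX_kfinite).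
    exact/(pretilt_bcP pT.1).
  exact: torsion_silting_detects.
apply: silting_torsion_silting.
apply: (detects_silting order_central (@fps_principal k) (order_kfinite iotaO)) => //.
exact: (@detects_of_bc _ _ _ iotaO T pT.1 (silting_detects sT)).
Qed.

Lemma presilt_bij : bij_on (@presilt G) (@presilt (modX iota)) (class_reduction iota).
Proof.
split=> [_ [T pT ->]|_ _ [T pT ->] [S pS ->]|_ [T' pT' ->]].
- have /pretiltP tT := pT.
  exists (bc T); first by apply/pretiltP/pretilt_bcP => //; apply: tT.1.
  by apply: class_base_change_iso; apply: tT.1.
- move/pretiltP: pT => pT; move/pretiltP: pS => pS.
  rewrite /class_reduction !class_base_change_iso; try exact: pT.1; try exact: pS.1.
  move=> /(iso_class_eq _ (perfect_bc pS.1)) TS; apply/iso_class_eq; first exact: pS.1.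
  exact: hiso_bcP.
have /pretiltP[pT HT] := pT'; have [T tT TT'] := pretilt_lift pT HT.
exists (iso_class T).
  exists T => //; apply/pretiltP/pretilt_bcP => //.
  exact: pretilt_hiso (perfect_bc tT) (hiso_sym TT') (conj pT HT).
by rewrite /class_reduction class_base_change_iso //; apply/iso_class_eq.
Qed.

Lemma tsilt_bij : bij_on (@tsilt G) (@silt (modX iota)) (class_reduction iota).
Proof.
have [_ inj sur] := presilt_bij.
split=> [_ [T [tT bT ->]]|_ _ [T [tT _ ->]] [S [tS _ ->]]|_ [T' [sT' bT' ->]]].
- have /pretiltP pT := tT.1; exists (bc T); split.
  + by apply/torsion_silting_bcP => //; apply: tT.1.
  + exact/basic_bcP.
  by apply: class_base_change_iso; apply: pT.1.
- by apply: inj; [exists T|exists S] => //; [apply: tT.1|apply: tS.1].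
have [|_ [T pT ->]] := sur (iso_class T'); first by exists T' => //; apply: sT'.1.
have /pretiltP tT := pT; have pT' : perfect T' by have [[]] := sT'.
rewrite /class_reduction class_base_change_iso; last exact: tT.1.
move=> e; have TT' := (iso_class_eq _ pT').1 e.
exists (iso_class T); last by rewrite class_base_change_iso //; apply: tT.1.
exists T; split=> //.
  apply/torsion_silting_bcP => //; exact: silting_hiso (perfect_bc tT.1) (hiso_sym TT') sT'.
by apply/basic_bcP => //; apply: basic_hiso (hiso_sym TT') bT'.
Qed.

(** The partial order on [tsilt] is pulled back: by [geE] the bijection preserves and reflects the
    relation, so the three axioms are inherited from [silt] over [G/XG]. *)
Lemma tsilt_poset_iso : poset_iso (@tsilt G) (@silt_ge G)
  (@silt (modX iota)) (@silt_ge (modX iota)) (class_reduction iota).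
Proof.
have bij := tsilt_bij; have [im inj _] := bij.
have [ge_refl ge_anti ge_trans] :=
  silt_partial_order scalar_modX_central (@field_principal k) modX_kfinite.
have geE C D : tsilt C -> tsilt D ->
    silt_ge C D <-> silt_ge (class_reduction iota C) (class_reduction iota D).
  move=> [T [[/pretiltP[pT _] _] _ ->]] [S [[/pretiltP[pS _] _] _ ->]].
  rewrite /class_reduction !class_base_change_iso //.
  rewrite !silt_ge_class //; try exact: perfect_bc.
  exact: hz_bcP.
split=> //; split=> [C tC|C D tC tD /geE CD /geE DC|C D E tC tD tE /geE CD /geE DE].
- by apply/geE => //; apply: ge_refl; apply: im.
- apply: inj => //; apply: ge_anti; [exact: im|exact: im|exact: CD|exact: DC].
apply/geE => //; apply: (ge_trans _ (class_reduction iota D)); try exact: im; [exact: CD|exact: DE].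
Qed.
End Reduction.

Theorem corollary6p5 (k : fieldType) (Gamma : pzRingType)
    (iota1 iota2 : central_embedding k Gamma)
    (order1 : is_order iota1) (order2 : is_order iota2) :
  (* bijections between isomorphism classes of pre-silting complexes *)
  (bij_on (@presilt Gamma) (@presilt (modX iota1)) (class_reduction iota1) /\
   bij_on (@presilt Gamma) (@presilt (modX iota2)) (class_reduction iota2)) /\
  (* isomorphisms of partially ordered sets *)
  (poset_iso (@tsilt Gamma) (@silt_ge Gamma)
             (@silt (modX iota1)) (@silt_ge (modX iota1)) (class_reduction iota1) /\
   poset_iso (@tsilt Gamma) (@silt_ge Gamma)
             (@silt (modX iota2)) (@silt_ge (modX iota2)) (class_reduction iota2)).
Proof.
split; split; [exact: presilt_bij|exact: presilt_bij| |]; exact: tsilt_poset_iso.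
Qed.
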